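(* Let $\mathfrak R$ be an expansion of $\overline{\mathbb R}$ that does not define $\mathbb N$, let $m\le n$ be natural numbers, and let $E\subseteq\mathbb R^n$ be bounded and $\mathrm D_\Sigma$ (that is, a coordinate projection of a closed set definable in $\mathfrak R$). Then for every $d\in\{0,\dots,n-m\}$, $$\overline{\dim}_{\mathrm M}\{E_x: x\in\mathbb R^m \text{ and } \dim E_x=d\}\le d.$$
   Context: $\overline{\mathbb R}=(\mathbb R,+,\cdot,(r)_{r\in\mathbb R})$ is the real field with a constant for each real number. An expansion $\mathfrak R$ of $\overline{\mathbb R}$ may be identified with a sequence $(\mathfrak S_m)_{m\ge 1}$ such that for each $m$: $\mathfrak S_m$ is a boolean algebra of subsets of $\mathbb R^m$; if $S\in\mathfrak S_m$ then $S\times\mathbb R,\ \mathbb R\times S\in\mathfrak S_{m+1}$; if $S\in\mathfrak S_{m+1}$ then the projection of $S$ on the first $m$ coordinates is in $\mathfrak S_m$; $\{x\in\mathbb R^m: x_i=x_j\}\in\mathfrak S_m$ for $1\le i\le j\le m$; the graphs of addition and multiplication belong to $\mathfrak S_3$; and $\{r\}\in\mathfrak S_1$ for every $r\in\mathbb R$. A subset of $\mathbb R^m$ is definable in $\mathfrak R$ if it belongs to $\mathfrak S_m$ (equivalently, it is first-order definable with parameters). ''$\mathfrak R$ defines $\mathbb N$'' means $\mathbb N=\{0,1,2,\dots\}\subseteq\mathbb R$ is definable in $\mathfrak R$. A coordinate projection of $S\subseteq\mathbb R^n$ is the image of $S$ under a map $(x_1,\dots,x_n)\mapsto(x_{\lambda(1)},\dots,x_{\lambda(m)})$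 with $0\le m\le n$ and $\lambda\colon\{1,\dots,m\}\to\{1,\dots,n\}$ strictly increasing; $\mathbb R^0=\{0\}$ is a one-point space, and $\mathbb R^m\times\mathbb R^{n-m}$ is identified with $\mathbb R^n$. For $x\in\mathbb R^m$, $E_x=\{y\in\mathbb R^{n-m}:(x,y)\in E\}$. For $A\subseteq\mathbb R^n$, $\dim A$ is the supremum of all $k\in\mathbb N$ such that some coordinate projection of $A$ on $\mathbb R^k$ has nonempty interior ($\dim\emptyset=-\infty$). For $S\subseteq\mathbb R^n$ (sup metric $|\cdot|$) and $r>0$, $\operatorname{net}_rS$ is the supremum of all $k\in\mathbb N$ for which there exist $x_1,\dots,x_k\in S$ with $|x_i-x_j|\ge r$ for all $i\ne j$. For a collection $\mathcal S$ of subsets of $\mathbb R^n$, the upper Minkowski dimension $\overline{\dim}_{\mathrm M}\mathcal S$ is the supremum of all $\alpha\in[-\infty,+\infty]$ for which there are a sequence $(r_k)$ of positive reals with $r_k\to0$ and a sequence $(S_k)$ of elements of $\mathcal S$ such that $(\log\operatorname{net}_{r_k}S_k)/(-\log r_k)\to\alpha$ (with $\log 0=-\infty$, $\log(+\infty)=+\infty$, $\sup\emptyset=-\infty$). *)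

(* Defs.v *)
From HB Require Import structures.
From mathcomp Require Import all_boot all_order all_algebra.
From mathcomp Require Import all_classical all_reals all_analysis.
Set Implicit Arguments.
Unset Strict Implicit.
Unset Printing Implicit Defensive.
Import Order.TTheory GRing.Theory Num.Theory.
Import numFieldNormedType.Exports.
Local Open Scope classical_set_scope.
Local Open Scope ring_scope.

(* Points of R^n are row vectors 'rV[R]_n; the norm and the topology of the
   library on 'rV[R]_n are the sup norm and the product topology, including
   for n = 0, where the space is a single point. *)

(* An expansion of the real field with a constant for each real number, given
   by its definable sets in each dimension m >= 1; [definable 0] is junk. *)
Record expansion (R : realType) := Expansion {
  definable : forall m : nat, set (set 'rV[R]_m);
  definable_algebra : forall m, (0 < m)%N ->
    [/\ definable (set0 : set 'rV[R]_m), setC_closed (@definable m)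
      & setU_closed (@definable m)];
  definable_prodr : forall m (S : set 'rV[R]_m), (0 < m)%N ->
    definable S -> definable [set x : 'rV[R]_(m + 1) | S (lsubmx x)];
  definable_prodl : forall m (S : set 'rV[R]_m), (0 < m)%N ->
    definable S -> definable [set x : 'rV[R]_(1 + m) | S (rsubmx x)];
  definable_proj : forall m (S : set 'rV[R]_(m + 1)), (0 < m)%N ->
    definable S -> definable ((fun x => lsubmx x) @` S);
  definable_diag : forall m (i j : 'I_m), (i <= j)%N ->
    definable [set x : 'rV[R]_m | x 0 i = x 0 j];
  definable_add : definable [set x : 'rV[R]_3 | x 0 0 + x 0 1 = x 0 2%:R];
  definable_mul : definable [set x : 'rV[R]_3 | x 0 0 * x 0 1 = x 0 2%:R];
  definable_const : forall r : R, definable [set x : 'rV[R]_1 | x 0 0 = r]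
}.

Definition defines_nat (R : realType) (RR : expansion R) : Prop :=
  definable RR [set x : 'rV[R]_1 | exists k : nat, x 0 0 = k%:R].

Definition strictly_increasing (m n : nat) (lam : 'I_m -> 'I_n) : Prop :=
  forall i j : 'I_m, (i < j)%N -> (lam i < lam j)%N.

Definition coord_proj (R : realType) (m n : nat) (lam : 'I_m -> 'I_n)
  (x : 'rV[R]_n) : 'rV[R]_m := \row_i x 0 (lam i).

(* Restricting to N >= 1 loses nothing: every subset of the one-point space
   R^0 is a coordinate projection of a closed definable subset of R^1. *)
Definition D_Sigma (R : realType) (RR : expansion R) (n : nat)
    (E : set 'rV[R]_n) : Prop :=
  exists (N : nat) (F : set 'rV[R]_N) (lam : 'I_n -> 'I_N),
    [/\ (0 < N)%N, definable RR F, closed F, strictly_increasing lam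
      & E = coord_proj lam @` F].

(* E_x, with R^m * R^(n - m) identified with R^n by concatenation. *)
Definition fiber (R : realType) (m n : nat) (hmn : (m <= n)%N)
    (E : set 'rV[R]_n) (x : 'rV[R]_m) : set 'rV[R]_(n - m) :=
  [set y | E (castmx (erefl 1%N, subnKC hmn) (row_mx x y))].

Definition proj_dim (R : realType) (n : nat) (A : set 'rV[R]_n) : \bar R :=
  ereal_sup [set (k%:R : R)%:E | k in [set k : nat |
    exists lam : 'I_k -> 'I_n,
      strictly_increasing lam /\ (coord_proj lam @` A)° !=set0]].

Definition net (R : realType) (n : nat) (r : R) (S : set 'rV[R]_n) : \bar R :=
  ereal_sup [set (k%:R : R)%:E | k in [set k : nat |
    exists x : 'I_k -> 'rV[R]_n,
      (forall i, S (x i)) /\ (forall i j, i != j -> r <= `|x i - x j|)]].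

(* Since r_k --> 0, the denominators are eventually positive, so the
   convention for division by 0 in \bar R is irrelevant. *)
Definition upper_Minkowski_dim (R : realType) (n : nat)
    (SS : set (set 'rV[R]_n)) : \bar R :=
  ereal_sup [set alpha : \bar R |
    exists (r : nat -> R) (S : nat -> set 'rV[R]_n),
      [/\ forall k, 0 < r k, r k @[k --> \oo] --> (0 : R),
          forall k, SS (S k)
        & (lne (net (r k) (S k)) / (- ln (r k))%:E)%E @[k --> \oo] --> alpha]].

(* Main.v *)
Require Import Defs.
From HB Require Import structures.
From mathcomp Require Import all_boot all_order all_algebra.
From mathcomp Require Import all_classical all_reals all_analysis.
From mathcomp Require Import ring lra zify.
Import Order.TTheory GRing.Theory Num.Theory.
Import numFieldNormedType.Exports.
Local Open Scope classical_set_scope.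
Local Open Scope ring_scope.

(* Assume that [N] is not definable.

   An increasing definable family of finite sets whose union is dense in an
   interval would define [N]: to a point [y] of the union attach its gap [M y],
   the largest distance from [y] to the other points of a member containing
   [y]; by nested choices the numbers [M y ^+ 2 / (c - y)], for [y] in a
   suitable range of gaps, approximate [2, ..., k + 1] for a suitable [c]
   (Hieronymi).
   Therefore a closed definable family [T s], [s > 0], of subsets of the line
   cannot be [s]-dense in an interval while [T s] contains no interval of
   length [s], by the Baire category theorem. Closedness is harmless: a closed
   definable family has a single-valued definable selection, obtained by
   successive minimization, that remains closed for small [s], unless there is
   a definable set of scales tending to [0], from which the required finite
   sets can be built directly.

   Let [U] be a closed definable family of subsets of [0, 1]. If the number of
   cells of length [1 / q] in which [U x] has a left endpoint were not
   [O(q ^ (1 / kappa))] uniformly in [x], then the pigeonhole principle would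
   make the slopes [- A / B], for suitable linear forms [A], [B] in finitely
   many left endpoints of [U x], arbitrarily dense in an interval; left
   endpoints at distance at least [1 / b] from each other number at most [b],
   so these slopes form a thin family, a contradiction.

   Sorting the cells of a grid by columns, the partly covered ones are thus few
   in each column, and the fully covered ones are counted on slices, whose
   dimension drops for suitable heights by the Baire category theorem. By
   induction on the dimension, the fibers of dimension [d] meet at most
   [O(q ^ (d + 1 / kappa))] cells, uniformly and for every [kappa]. *)

(** The dense and thin family needs one parameter per scale. If the count fails, then for each [s]
    some [x] has [s]-dense slopes, but a union over all such [x] need not be thin, so [x] has to be
    chosen definably. The choice must also be closed in [s]: the Baire argument fixes a point [t]
    and needs the set of scales [s] with [t] in [T s] to be closed. Minimization provides this: a
    minimum value is lower semicontinuous in [s], so the scales where it oscillates by at least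
    [1 / a] form a closed set without interior; these sets all vanish near [0], or they yield a
    definable set of scales.

    The exponent [1 / kappa] comes from [kappa]-tuples: [L] left endpoints give [L ^ kappa] linear
    combinations in a bounded interval, and once [L ^ kappa] exceeds a large multiple of [q], two of
    them differ by much less than [1 / q]. All constants are uniform in the parameters, because the
    fiber may change with the scale in the Minkowski dimension, and because a fiber of a projection
    is only an increasing union of closed sets, indexed by a bound on the witness. *)

Set Implicit Arguments.
Unset Strict Implicit.
Unset Printing Implicit Defensive.

(** * Definable sets and maps *)

Section Raw.
Variables (R : realType) (RR : expansion R).

Lemma definable_ext m (S T : set 'rV[R]_m) :
  (forall x, S x <-> T x) -> definable RR S -> definable RR T.
Proof.
move=> h; suff -> : S = T by [].
by apply/seteqP; split=> x /h.
Qed.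

Lemma definableC m (S : set 'rV[R]_m) : (0 < m)%N ->
  definable RR S -> definable RR (~` S).
Proof. by move=> m0; case: (definable_algebra RR m0) => _ h _; exact: h. Qed.

Lemma definableU m (S T : set 'rV[R]_m) : (0 < m)%N ->
  definable RR S -> definable RR T -> definable RR (S `|` T).
Proof. by move=> m0; case: (definable_algebra RR m0) => _ _; apply. Qed.

Lemma definableI m (S T : set 'rV[R]_m) : (0 < m)%N ->
  definable RR S -> definable RR T -> definable RR (S `&` T).
Proof.
move=> m0 hS hT; rewrite -(setCK (S `&` T)) setCI.
by apply: definableC => //; apply: definableU => //; apply: definableC.
Qed.

Lemma definable_castmx n n' (e : n = n') (S : set 'rV[R]_n) :
  definable RR S ->
  definable RR [set x : 'rV[R]_n' | S (castmx (erefl 1%N, esym e) x)].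
Proof. by case: _ / e => h; apply: definable_ext h => x /=; rewrite castmx_id. Qed.

Lemma definable_exn m n (T : set 'rV[R]_(m + n)) : (0 < m)%N ->
  definable RR T ->
  definable RR [set x : 'rV[R]_m | exists y : 'rV[R]_n, T (row_mx x y)].
Proof.
elim: n m T => [|n IH] m T m0 hT.
  have := definable_castmx (addn0 m) hT; apply: definable_ext => x /=; split.
    move=> h; exists 0; congr T: h.
    apply/rowP => j; rewrite castmxE /= cast_ord_id.
    case: (splitP j) => k hk; last by case: (k).
    rewrite (_ : j = lshift 0 k) ?row_mxEl; last exact: val_inj.
    by congr (x _ _); apply: val_inj.
  case=> y; congr T.
  apply/rowP => j; rewrite castmxE /= cast_ord_id.
  case: (splitP j) => k hk; last by case: (k).
  rewrite (_ : j = lshift 0 k) ?row_mxEl; last exact: val_inj.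
  by congr (x _ _); apply: val_inj.
have m1 : (0 < m + 1)%N by rewrite addn1.
have h1 := definable_castmx (addnA m 1 n) hT.
have h2 := definable_proj m0 (IH (m + 1)%N _ m1 h1).
apply: definable_ext h2 => x /=; split.
  case=> x' [y hy] <-; exists (row_mx (rsubmx x') y).
  congr T: hy; have := @row_mxA _ 1 m 1 n (lsubmx x') (rsubmx x') y.
  by rewrite /= hsubmxK => ->.
case=> y hy; exists (row_mx x (@lsubmx _ 1 1 n y)); last by rewrite row_mxKl.
exists (@rsubmx _ 1 1 n y); congr T: hy.
by rewrite -(@row_mxA _ 1 m 1 n) (@hsubmxK _ 1 1 n y).
Qed.

Lemma definable_shift m n (S : set 'rV[R]_n) : (0 < n)%N -> definable RR S ->
  definable RR [set z : 'rV[R]_(m + n) | S (rsubmx z)].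
Proof.
move=> n0 hS; elim: m => [|m IH].
  apply: definable_ext hS => x; rewrite /=.
  suff -> : @rsubmx _ 1 0 n x = x by [].
  by apply/rowP => j; rewrite mxE; congr (x _ _); apply: val_inj.
have mn0 : (0 < m + n)%N by rewrite addn_gt0 n0 orbT.
have := definable_prodl mn0 IH; apply: definable_ext => x /=.
suff -> : @rsubmx _ 1 m n (@rsubmx _ 1 1 (m + n) x) = @rsubmx _ 1 m.+1 n x by [].
by apply/rowP => j; rewrite !mxE; congr (x _ _); apply: val_inj.
Qed.

Lemma definable_forall_ord m k (S : 'I_k -> set 'rV[R]_m) : (0 < m)%N ->
  (forall i, definable RR (S i)) -> definable RR [set x | forall i, S i x].
Proof.
move=> m0; elim: k S => [|k IH] S hS.
  case: (definable_algebra RR m0) => h0 _ _.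
  by apply: definable_ext (definableC m0 h0) => x; split=> // _ [].
have := definableI m0 (hS ord0) (IH (fun i => S (lift ord0 i)) (fun i => hS _)).
apply: definable_ext => x /=; split; last by move=> h; split=> [|i]; exact: h.
by case=> h0 h1 i; case: (unliftP ord0 i) => [j|] ->; [exact: h1|exact: h0].
Qed.

Lemma definable_eqi m (i j : 'I_m) :
  definable RR [set x : 'rV[R]_m | x 0 i = x 0 j].
Proof.
case/orP: (leq_total i j) => h; first exact: definable_diag.
by apply: definable_ext (definable_diag RR h) => x /=; split.
Qed.

(** The axioms provide products and projections onto initial coordinates only. A change of
    coordinates appends the new tuple, ties it to the old one by diagonals and projects it away. *)
Lemma definable_reindex m n (f : 'I_n -> 'I_m) (S : set 'rV[R]_n) :
  (0 < m)%N -> (0 < n)%N -> definable RR S ->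
  definable RR [set x : 'rV[R]_m | S (\row_j x 0 (f j))].
Proof.
move=> m0 n0 hS.
have mn0 : (0 < m + n)%N by rewrite addn_gt0 m0.
have h1 := definable_forall_ord mn0
  (fun j : 'I_n => definable_eqi (lshift n (f j)) (rshift m j)).
have h2 := definable_exn m0 (definableI mn0 h1 (definable_shift m n0 hS)).
apply: definable_ext h2 => x /=; split.
  case=> y [hy]; rewrite row_mxKr; congr S.
  by apply/rowP => j; rewrite mxE; have := hy j; rewrite row_mxEl row_mxEr.
move=> h; exists (\row_j x 0 (f j)); split; last by rewrite row_mxKr.
by move=> j /=; rewrite row_mxEl row_mxEr mxE.
Qed.

End Raw.

(** * Definability over types with coordinates *)

Section Charts.
Variable R : realType.

(** Identifies a type with a coordinate space, so that predicates on nested products can be called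
    definable and instance resolution finds their coordinates. *)
Class chart (X : Type) := Chart {
  cdim : nat;
  cto : X -> 'rV[R]_cdim;
  cof : 'rV[R]_cdim -> X;
  ctoK : cancel cto cof;
  cofK : cancel cof cto }.
Arguments cdim X {chart}.

#[global] Instance chart_rV n : chart 'rV[R]_n :=
  @Chart 'rV[R]_n n id id (fun _ => erefl) (fun _ => erefl).

Lemma const_mxK11 : cancel (fun x : R => const_mx x : 'rV[R]_1) (fun z => z 0 0).
Proof. by move=> x; rewrite mxE. Qed.

Lemma const_mx11K : cancel (fun z : 'rV[R]_1 => z 0 0) (fun x : R => const_mx x).
Proof. by move=> z; apply/rowP => j; rewrite mxE !ord1. Qed.

#[global] Instance chart_R : chart R := Chart const_mxK11 const_mx11K.

Section Prod.
Variables (X Y : Type) (cX : chart X) (cY : chart Y).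
Let fwd (p : X * Y) : 'rV[R]_(cdim X + cdim Y) := row_mx (cto p.1) (cto p.2).
Let bwd (z : 'rV[R]_(cdim X + cdim Y)) : X * Y := (cof (lsubmx z), cof (rsubmx z)).

Lemma chart_toK : cancel fwd bwd.
Proof. by case=> x y; rewrite /fwd /bwd /= row_mxKl row_mxKr !ctoK. Qed.

Lemma chart_ofK : cancel bwd fwd.
Proof. by move=> z; rewrite /fwd /bwd /= !cofK hsubmxK. Qed.

#[global] Instance chart_prod : chart (X * Y) := Chart chart_toK chart_ofK.
End Prod.

(* A coordinate map reads each target coordinate off a source coordinate. *)
Definition cmap X Y {cX : chart X} {cY : chart Y} (f : X -> Y) :=
  exists s : 'I_(cdim Y) -> 'I_(cdim X),
    forall x j, cto (f x) 0 j = cto x 0 (s j).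

Lemma cmap_id X {cX : chart X} : cmap (fun x : X => x).
Proof. by exists id. Qed.

Lemma cmap_fst X Y Z {cX : chart X} {cY : chart Y} {cZ : chart Z}
  (f : X -> Y * Z) : cmap f -> cmap (fun x => (f x).1).
Proof.
case=> s hs; exists (fun j => s (lshift _ j)) => x j.
by rewrite -hs /= row_mxEl.
Qed.

Lemma cmap_snd X Y Z {cX : chart X} {cY : chart Y} {cZ : chart Z}
  (f : X -> Y * Z) : cmap f -> cmap (fun x => (f x).2).
Proof.
case=> s hs; exists (fun j => s (rshift _ j)) => x j.
by rewrite -hs /= row_mxEr.
Qed.

Lemma cmap_pair X Y Z {cX : chart X} {cY : chart Y} {cZ : chart Z}
  (f : X -> Y) (g : X -> Z) : cmap f -> cmap g -> cmap (fun x => (f x, g x)).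
Proof.
case=> s hs [t ht].
exists (fun j : 'I_(cdim Y + cdim Z) => match fintype.split j with inl i => s i | inr i => t i end) => x j.
rewrite /= mxE; by case: (fintype.split j) => i.
Qed.

Lemma cmap_entry X n {cX : chart X} (f : X -> 'rV[R]_n) (i : 'I_n) :
  cmap f -> cmap (fun x => f x 0 i).
Proof. by case=> s hs; exists (fun=> s i) => x j; rewrite mxE -hs. Qed.

Lemma cmap_row X n {cX : chart X} (f : 'I_n -> X -> R) :
  (forall i, cmap (f i)) -> cmap (fun x => \row_i f i x).
Proof.
move=> h; have /choice[s hs] : forall i : 'I_n, exists k, forall x,
    f i x = cto x 0 k.
  by move=> i; have [s hs] := h i; exists (s ord0) => x; rewrite -hs mxE.
by exists s => x j; rewrite /= mxE hs.
Qed.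

Variable RR : expansion R.

(** The additional first coordinate is a dummy. It makes the ambient dimension positive even if
    [cdim X = 0], where [definable] carries no information. *)
Definition def X {cX : chart X} (P : X -> Prop) : Prop :=
  definable RR [set z : 'rV[R]_(1 + cdim X) | P (cof (rsubmx z))].

Lemma def_ext X {cX : chart X} (P Q : X -> Prop) :
  (forall x, P x <-> Q x) -> def P -> def Q.
Proof. by move=> h; apply: definable_ext => z; exact: h. Qed.

Lemma defP n (P : 'rV[R]_n -> Prop) : (0 < n)%N ->
  def P <-> definable RR [set x | P x].
Proof.
move=> n0; split; last exact: (definable_shift 1 n0).
have h1 : (0 < 1 + n)%N by [].
move=> h.
(* The dummy coordinate is filled with a copy of the first coordinate. *)
have /definable_ext := definable_reindex
  (fun j : 'I_(1 + n) => match fintype.split j with inl _ => Ordinal n0 | inr k => k end)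
  n0 h1 h; apply => x /=.
suff -> : @rsubmx _ 1 1 n (\row_j x 0 match fintype.split j with
   | inl _ => Ordinal n0 | inr k => k end) = x by [].
apply/rowP => j; rewrite mxE mxE; case: splitP => k.
  by case: k => -[].
by move=> [] /val_inj ->.
Qed.

Lemma def_and X {cX : chart X} (P Q : X -> Prop) :
  def P -> def Q -> def (fun x => P x /\ Q x).
Proof. exact: definableI. Qed.

Lemma def_or X {cX : chart X} (P Q : X -> Prop) :
  def P -> def Q -> def (fun x => P x \/ Q x).
Proof. exact: definableU. Qed.

Lemma def_not X {cX : chart X} (P : X -> Prop) : def P -> def (fun x => ~ P x).
Proof. exact: definableC. Qed.

Lemma def_impl X {cX : chart X} (P Q : X -> Prop) :
  def P -> def Q -> def (fun x => P x -> Q x).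
Proof.
move=> hP hQ; apply: def_ext (def_or (def_not hP) hQ) => x; split.
  by case.
by case: (pselect (P x)) => h; [move=> /(_ h); right|left].
Qed.

Lemma def_forall_ord X {cX : chart X} k (P : 'I_k -> X -> Prop) :
  (forall i, def (P i)) -> def (fun x => forall i, P i x).
Proof. by move=> h; apply: (@definable_forall_ord _ _ _ k (fun i => _)). Qed.

Lemma def_exists_ord X {cX : chart X} k (P : 'I_k -> X -> Prop) :
  (forall i, def (P i)) -> def (fun x => exists i, P i x).
Proof.
move=> h; have := def_not (def_forall_ord (fun i => def_not (h i))).
apply: def_ext => x; split; last by case=> i hi /(_ i).
by move=> /existsNP[i /contrapT hi]; exists i.
Qed.

Lemma def_cmap X Y {cX : chart X} {cY : chart Y} (f : X -> Y) (Q : Y -> Prop) :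
  cmap f -> def Q -> def (fun x => Q (f x)).
Proof.
case=> s hs hQ.
pose s' (j : 'I_(1 + cdim Y)) : 'I_(1 + cdim X) :=
  match fintype.split j with inl i => lshift _ i | inr i => rshift _ (s i) end.
have := definable_reindex s' isT isT hQ; apply: definable_ext => z /=.
suff -> : cof (rsubmx (\row_j z 0 (s' j))) = f (cof (rsubmx z)) by [].
apply: (can_inj (ctoK (X := Y))); rewrite cofK; apply/rowP => j.
rewrite hs cofK !mxE /s'; case: splitP => k /= hk.
  by case: k hk => -[].
by congr (z _ (rshift _ (s _))); apply: val_inj; case: hk.
Qed.

Lemma def_ex X Y {cX : chart X} {cY : chart Y} (P : X -> Y -> Prop) :
  def (fun p : X * Y => P p.1 p.2) -> def (fun x => exists y, P x y).
Proof.
move=> h; have := @definable_exn _ RR (1 + cdim X) (cdim Y) _ isT h.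
have e : forall (x : 'rV[R]_(1 + cdim X)) (y : 'rV[R]_(cdim Y)),
    @rsubmx _ 1 1 (cdim X + cdim Y) (row_mx x y) =
    row_mx (rsubmx x) y.
  move=> x y; apply/rowP => j; rewrite mxE.
  case: (splitP j) => k hk.
    have -> : j = lshift _ k by apply: val_inj.
    rewrite row_mxEl [RHS]mxE -(row_mxEl x y); congr (row_mx x y _ _).
    exact: val_inj.
  have -> : j = rshift _ k by apply: val_inj.
  rewrite row_mxEr -(row_mxEr x y); congr (row_mx x y _ _).
  exact: val_inj.
apply: definable_ext => z /=; split.
  by case=> y; rewrite e row_mxKl row_mxKr; exists (cof y).
by case=> y hy; exists (cto y); rewrite e row_mxKl row_mxKr ctoK.
Qed.

Lemma def_all X Y {cX : chart X} {cY : chart Y} (P : X -> Y -> Prop) :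
  def (fun p : X * Y => P p.1 p.2) -> def (fun x => forall y, P x y).
Proof.
move=> h; have := def_not (def_ex (P := fun x y => ~ P x y) (def_not h)).
apply: def_ext => x; split; last by move=> hx [y]; apply.
by move=> hx y; apply: contrapT => hy; apply: hx; exists y.
Qed.

Lemma def_eq_coord X {cX : chart X} (i j : 'I_(cdim X)) :
  def (fun x => cto x 0 i = cto x 0 j).
Proof.
have := definable_eqi RR (rshift 1 i) (rshift 1 j); apply: definable_ext => z /=.
by rewrite cofK !mxE.
Qed.

Lemma def_eq_cmap X Y {cX : chart X} {cY : chart Y} (f g : X -> Y) :
  cmap f -> cmap g -> def (fun x => f x = g x).
Proof.
case=> s hs [t ht].
have := def_forall_ord (fun j => def_eq_coord (X := X) (s j) (t j)).
apply: def_ext => x; split=> [h|e j]; last by rewrite -hs -ht e.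
by apply: (can_inj (ctoK (X := Y))); apply/rowP => j; rewrite hs ht.
Qed.

(** A map is definable through its graph; in a composition the intermediate value is then removed by
    an existential quantifier. *)
Definition dmap X Y {cX : chart X} {cY : chart Y} (f : X -> Y) :=
  def (fun p : X * Y => f p.1 = p.2).

Lemma dmap_cmap X Y {cX : chart X} {cY : chart Y} (f : X -> Y) :
  cmap f -> dmap f.
Proof.
move=> h; apply: def_eq_cmap; last exact/cmap_snd/cmap_id.
case: h => s hs; exists (fun j => lshift _ (s j)) => -[x y] j.
by rewrite hs /= row_mxEl.
Qed.

Lemma def_comp X Y {cX : chart X} {cY : chart Y} (f : X -> Y) (Q : Y -> Prop) :
  def Q -> dmap f -> def (fun x => Q (f x)).
Proof.
move=> hQ hf.
have h : def (fun p : X * Y => f p.1 = p.2 /\ Q p.2).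
  by apply: def_and hf _; apply: def_cmap hQ; exact/cmap_snd/cmap_id.
apply: def_ext (def_ex (P := fun x y => f x = y /\ Q y) h) => x; split.
  by case=> y [->].
by exists (f x).
Qed.

Lemma dmap_comp X Y Z {cX : chart X} {cY : chart Y} {cZ : chart Z}
  (g : Y -> Z) (f : X -> Y) : dmap g -> dmap f -> dmap (fun x => g (f x)).
Proof.
move=> hg hf; rewrite /dmap.
have h : def (fun q : (X * Z) * Y => f q.1.1 = q.2 /\ g q.2 = q.1.2).
  apply: def_and.
    apply: (def_cmap (f := fun q : (X * Z) * Y => (q.1.1, q.2)) _ hf).
    apply: cmap_pair; last exact/cmap_snd/cmap_id.
    exact/cmap_fst/cmap_fst/cmap_id.
  apply: (def_cmap (f := fun q : (X * Z) * Y => (q.2, q.1.2)) _ hg).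
  apply: cmap_pair; first exact/cmap_snd/cmap_id.
  exact/cmap_snd/cmap_fst/cmap_id.
apply: def_ext
  (def_ex (P := fun (p : X * Z) y => f p.1 = y /\ g y = p.2) h) => x; split.
  by case=> y [-> ->].
by move=> e; exists (f x.1).
Qed.

Lemma dmap_pair X Y Z {cX : chart X} {cY : chart Y} {cZ : chart Z}
  (f : X -> Y) (g : X -> Z) : dmap f -> dmap g -> dmap (fun x => (f x, g x)).
Proof.
move=> hf hg.
have h : def (fun q : X * (Y * Z) => f q.1 = q.2.1 /\ g q.1 = q.2.2).
  apply: def_and.
    apply: (def_cmap (f := fun q : X * (Y * Z) => (q.1, q.2.1)) _ hf).
    apply: cmap_pair; first exact/cmap_fst/cmap_id.
    exact/cmap_fst/cmap_snd/cmap_id.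
  apply: (def_cmap (f := fun q : X * (Y * Z) => (q.1, q.2.2)) _ hg).
  apply: cmap_pair; first exact/cmap_fst/cmap_id.
  exact/cmap_snd/cmap_snd/cmap_id.
by apply: def_ext h => -[x [y z]] /=; split=> [[-> ->]//|[]].
Qed.

Lemma dmap_id X {cX : chart X} : dmap (fun x : X => x).
Proof. exact/dmap_cmap/cmap_id. Qed.

Lemma dmap_fst X Y Z {cX : chart X} {cY : chart Y} {cZ : chart Z}
  (f : X -> Y * Z) : dmap f -> dmap (fun x => (f x).1).
Proof.
move=> h; apply: (dmap_comp (g := fst)) h.
by apply/dmap_cmap/cmap_fst/cmap_id.
Qed.

Lemma dmap_snd X Y Z {cX : chart X} {cY : chart Y} {cZ : chart Z}
  (f : X -> Y * Z) : dmap f -> dmap (fun x => (f x).2).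
Proof.
move=> h; apply: (dmap_comp (g := snd)) h.
by apply/dmap_cmap/cmap_snd/cmap_id.
Qed.

Lemma dmap_entry X n {cX : chart X} (f : X -> 'rV[R]_n) (i : 'I_n) :
  dmap f -> dmap (fun x => f x 0 i).
Proof.
move=> h; apply: (dmap_comp (g := fun v : 'rV[R]_n => v 0 i)) h.
by apply/dmap_cmap/cmap_entry/cmap_id.
Qed.

Lemma dmap_row X n {cX : chart X} (f : 'I_n -> X -> R) :
  (forall i, dmap (f i)) -> dmap (fun x => \row_i f i x).
Proof.
move=> h.
have h1 : def (fun p : X * 'rV[R]_n => forall i, f i p.1 = p.2 0 i).
  apply: def_forall_ord => i.
  apply: (def_cmap (f := fun p : X * 'rV[R]_n => (p.1, p.2 0 i)) _ (h i)).
  apply: cmap_pair; first exact/cmap_fst/cmap_id.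
  exact/cmap_entry/cmap_snd/cmap_id.
apply: def_ext h1 => -[x y] /=; split=> [hi|<- i]; last by rewrite mxE.
by apply/rowP => i; rewrite mxE.
Qed.

Lemma def_app2 X Y Z {cX : chart X} {cY : chart Y} {cZ : chart Z}
  (P : Y -> Z -> Prop) (f : X -> Y) (g : X -> Z) :
  def (fun p : Y * Z => P p.1 p.2) -> dmap f -> dmap g ->
  def (fun x => P (f x) (g x)).
Proof. by move=> h hf hg; exact: (def_comp h (dmap_pair hf hg)). Qed.

Lemma def_app3 X Y Z W {cX : chart X} {cY : chart Y} {cZ : chart Z}
  {cW : chart W} (P : Y -> Z -> W -> Prop) (f : X -> Y) (g : X -> Z) (k : X -> W) :
  def (fun p : Y * Z * W => P p.1.1 p.1.2 p.2) -> dmap f -> dmap g -> dmap k ->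
  def (fun x => P (f x) (g x) (k x)).
Proof.
by move=> h hf hg hk; exact: (def_comp h (dmap_pair (dmap_pair hf hg) hk)).
Qed.

Lemma def_eq X Y {cX : chart X} {cY : chart Y} (f g : X -> Y) :
  dmap f -> dmap g -> def (fun x => f x = g x).
Proof.
apply: def_app2; apply: def_eq_cmap; first exact/cmap_fst/cmap_id.
exact/cmap_snd/cmap_id.
Qed.

Lemma dmap_cst X {cX : chart X} (c : R) : dmap (fun _ : X => c).
Proof.
have h : def (fun y : R => c = y).
  have := @definable_shift _ RR 1 1 _ isT (definable_const RR c).
  apply: definable_ext => z /=.
  by split => [->|<-].
by apply: (def_cmap (f := snd) _ h); exact/cmap_snd/cmap_id.
Qed.

Lemma def_ternary (S : set 'rV[R]_3) : definable RR S ->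
  def (fun q : R * R * R => S (\row_i nth 0 [:: q.1.1; q.1.2; q.2] i)).
Proof.
move=> hS; have h : def S by apply/defP.
apply: (def_cmap (Q := S) _ h); apply: cmap_row => i.
case: i => -[|[|[|//]]] /= _.
- exact/cmap_fst/cmap_fst/cmap_id.
- exact/cmap_snd/cmap_fst/cmap_id.
- exact/cmap_snd/cmap_id.
Qed.

Lemma dmap_add X {cX : chart X} (f g : X -> R) :
  dmap f -> dmap g -> dmap (fun x => f x + g x).
Proof.
move=> hf hg; apply: (dmap_comp (g := fun p : R * R => p.1 + p.2)
  (f := fun x => (f x, g x))); last exact: dmap_pair.
have := def_ternary (definable_add RR); apply: def_ext => q /=.
by rewrite !mxE.
Qed.

Lemma dmap_mul X {cX : chart X} (f g : X -> R) :
  dmap f -> dmap g -> dmap (fun x => f x * g x).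
Proof.
move=> hf hg; apply: (dmap_comp (g := fun p : R * R => p.1 * p.2)
  (f := fun x => (f x, g x))); last exact: dmap_pair.
have := def_ternary (definable_mul RR); apply: def_ext => q /=.
by rewrite !mxE.
Qed.

Lemma dmap_ext X Y {cX : chart X} {cY : chart Y} (f g : X -> Y) :
  (forall x, f x = g x) -> dmap f -> dmap g.
Proof. by move=> h; apply: def_ext => x; rewrite h. Qed.

Lemma dmap_opp X {cX : chart X} (f : X -> R) : dmap f -> dmap (fun x => - f x).
Proof.
move=> hf; apply: dmap_ext (dmap_mul (dmap_cst (-1)) hf) => x.
by rewrite mulN1r.
Qed.

Lemma dmap_exp X {cX : chart X} (f : X -> R) k :
  dmap f -> dmap (fun x => f x ^+ k).
Proof.
move=> hf; elim: k => [|k IH].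
  by apply: dmap_ext (dmap_cst 1) => x; rewrite expr0.
by apply: dmap_ext (dmap_mul hf IH) => x; rewrite exprS.
Qed.

Lemma dmap_sum X {cX : chart X} k (f : 'I_k -> X -> R) :
  (forall i, dmap (f i)) -> dmap (fun x => \sum_i f i x).
Proof.
elim: k f => [|k IH] f hf.
  by apply: dmap_ext (dmap_cst 0) => x; rewrite big_ord0.
apply: dmap_ext (dmap_add (hf ord0) (IH _ (fun i => hf (lift ord0 i)))) => x.
by rewrite big_ord_recl.
Qed.

(** The order comes from the field structure: [a <= b] iff [b - a] is a square. *)
Lemma def_le X {cX : chart X} (f g : X -> R) :
  dmap f -> dmap g -> def (fun x => f x <= g x).
Proof.
apply: (def_app2 (P := fun a b : R => a <= b)).
have h : def (fun q : R * R * R => q.1.2 = q.1.1 + q.2 ^+ 2).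
  apply: def_eq; first exact/dmap_snd/dmap_fst/dmap_id.
  apply: dmap_add; first exact/dmap_fst/dmap_fst/dmap_id.
  exact/dmap_exp/dmap_snd/dmap_id.
apply: def_ext (def_ex (P := fun (p : R * R) (s : R) => p.2 = p.1 + s ^+ 2) h)
  => -[a b] /=; split.
  by case=> s ->; rewrite lerDl sqr_ge0.
move=> ab; exists (Num.sqrt (b - a)).
by rewrite sqr_sqrtr ?subr_ge0// addrC subrK.
Qed.

Lemma def_lt X {cX : chart X} (f g : X -> R) :
  dmap f -> dmap g -> def (fun x => f x < g x).
Proof.
move=> hf hg; apply: def_ext (def_not (def_le hg hf)) => x.
by rewrite ltNge; split=> /negP.
Qed.

Lemma dmap_norm X {cX : chart X} (f : X -> R) : dmap f -> dmap (fun x => `|f x|).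
Proof.
move=> hf; apply: (dmap_comp (g := fun a : R => `|a|)) hf.
have ha : dmap (fun p : R * R => p.1) by exact/dmap_fst/dmap_id.
have hb : dmap (fun p : R * R => p.2) by exact/dmap_snd/dmap_id.
have h0 : dmap (fun _ : R * R => 0 : R) by exact: dmap_cst.
have := def_or (def_and (def_le h0 ha) (def_eq ha hb))
  (def_and (def_lt ha h0) (def_eq (dmap_opp ha) hb)).
rewrite /dmap; apply: def_ext => -[a b] /=; split.
  by case=> -[ha0 <-]; [rewrite ger0_norm|rewrite ltr0_norm].
by move=> <-; case: ltrP => ha0; [right; rewrite ltr0_norm|left; rewrite ger0_norm].
Qed.

End Charts.

(** Reads definability off the syntax of a formula. Relations and maps that are not field operations
    are looked up among the hypotheses, hence the local [def] and [dmap] facts that are recorded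
    before a call. *)
Ltac dfn_step := cbv beta; lazymatch goal with
  | |- dmap _ (fun _ => ?c) => first [ eassumption | exact (dmap_cst _ c) ]
  | |- dmap _ (fun x => x) => exact (dmap_id _)
  | |- dmap _ (fun x => fst (@?f x)) => refine (dmap_fst (f := f) _)
  | |- dmap _ (fun x => snd (@?f x)) => refine (dmap_snd (f := f) _)
  | |- dmap _ (@fst _ _) => exact (dmap_fst (f := fun x => x) (dmap_id _))
  | |- dmap _ (@snd _ _) => exact (dmap_snd (f := fun x => x) (dmap_id _))
  | |- dmap _ (fun x => (@?f x, @?g x)) => refine (dmap_pair (f := f) (g := g) _ _)
  | |- dmap _ (fun x => GRing.add (@?f x) (@?g x)) =>
      refine (dmap_add (f := f) (g := g) _ _)
  | |- dmap _ (fun x => GRing.mul (@?f x) (@?g x)) =>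
      refine (dmap_mul (f := f) (g := g) _ _)
  | |- dmap _ (fun x => GRing.opp (@?f x)) => refine (dmap_opp (f := f) _)
  | |- dmap _ (fun x => GRing.exp (@?f x) ?k) => refine (dmap_exp (f := f) k _)
  | |- dmap _ (fun x => Num.norm (@?f x)) => refine (dmap_norm (f := f) _)
  | |- dmap _ (fun x => fun_of_matrix (@?f x) _ ?i) =>
      refine (dmap_entry (f := f) i _)
  | |- dmap _ _ => first [ eassumption
      | lazymatch goal with |- dmap _ (fun x => ?h (@?f x)) =>
          refine (dmap_comp (g := h) (f := f) _ _); [ eassumption | ] end
      | refine (dmap_sum _); intro | refine (dmap_row _); intro ]
  | |- def _ (fun x => @?P x /\ @?Q x) => refine (def_and (P := P) (Q := Q) _ _)
  | |- def _ (fun x => @?P x \/ @?Q x) => refine (def_or (P := P) (Q := Q) _ _)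
  | |- def _ (fun x => ~ @?P x) => refine (def_not (P := P) _)
  | |- def _ (fun x => @?P x -> @?Q x) => refine (def_impl (P := P) (Q := Q) _ _)
  | |- def _ (fun x => exists i : ordinal _, @?P x i) =>
      refine (def_exists_ord (P := fun i x => P x i) _); intro
  | |- def _ (fun x => forall i : ordinal _, @?P x i) =>
      refine (def_forall_ord (P := fun i x => P x i) _); intro
  | |- def _ (fun x => exists y, @?P x y) => refine (def_ex (P := P) _)
  | |- def _ (fun x => forall y, @?P x y) => refine (def_all (P := P) _)
  | |- def _ (fun x => is_true (Order.le (@?f x) (@?g x))) =>
      refine (def_le (f := f) (g := g) _ _)
  | |- def _ (fun x => is_true (Order.lt (@?f x) (@?g x))) =>
      refine (def_lt (f := f) (g := g) _ _)
  | |- def _ (fun x => @?f x = @?g x) => refine (def_eq (f := f) (g := g) _ _)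
  | |- def _ _ => first [ eassumption
      | lazymatch goal with |- def _ (fun x => ?P (@?f x) (@?g x) (@?h x)) =>
          refine (def_app3 (P := P) (f := f) (g := g) (k := h) _ _ _ _);
          [ eassumption | | | ] end
      | lazymatch goal with |- def _ (fun x => ?P (@?f x) (@?g x)) =>
          refine (def_app2 (P := P) (f := f) (g := g) _ _ _);
          [ eassumption | | ] end
      | lazymatch goal with |- def _ (fun x => ?P (@?f x)) =>
          refine (def_comp (Q := P) (f := f) _ _); [ eassumption | ] end ]
  end.

Ltac dfn := repeat dfn_step.

(** * Coding the natural numbers *)

Section Hieronymi.
Variable R : realType.

Section Coding.
Variables (F : set R) (M : R -> R).
Hypothesis M0 : forall y, F y -> 0 < M y.
Hypothesis M4 : forall y, F y -> M y <= 4^-1.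
Hypothesis Msep : forall y z, F y -> F z -> y != z ->
  Num.min (M y) (M z) <= `|y - z|.

(** The form in which separation is used: close points cannot both have large gaps. *)
Lemma sep_lt y z r : F y -> F z -> y != z -> `|y - z| < r -> M y < r \/ M z < r.
Proof.
move=> Fy Fz yz; have := Msep Fy Fz yz; rewrite ge_min => /orP[] h1 h2.
  by left; exact: le_lt_trans h2.
by right; exact: le_lt_trans h2.
Qed.

Lemma M_small y : F y -> M y ^+ 2 < M y.
Proof. by move=> Fy; have := M0 Fy; have := M4 Fy; nra. Qed.

Variables (u v : R).
Hypothesis uv : u < v.
Hypothesis Fdense : forall a b, u <= a -> a < b -> b <= v ->
  exists y, [/\ F y, a < y & y < b].

Lemma exists_small (e : R) : 0 < e ->
  exists y, [/\ F y, u < y, y + M y ^+ 2 < v & M y < e].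
Proof.
move=> e0.
(* Of two points of [F] between [u] and [w], one has a small gap; [w] leaves half of the interval
   free, so that [y + M y ^+ 2] stays below [v]. *)
pose w := Num.min (u + e) (u + (v - u) / 2).
have uw : u < w by rewrite lt_min !ltrDl e0 /= divr_gt0// subr_gt0.
have wv : w <= u + (v - u) / 2 by rewrite ge_min lexx orbT.
have we : w <= u + e by rewrite ge_min lexx.
have wv' : w <= v by lra.
have [y1 [Fy1 uy1 y1w]] := Fdense (lexx u) uw wv'.
have y1v : y1 <= v by lra.
have [y2 [Fy2 uy2 y2y1]] := Fdense (lexx u) uy1 y1v.
pose e' := Num.min e ((v - u) / 2).
have d : `|y1 - y2| < e'.
  rewrite ger0_norm; last by lra.
  by rewrite lt_min; apply/andP; split; lra.
have y12 : y1 != y2 by rewrite gt_eqF.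
have e'1 : e' <= e by rewrite ge_min lexx.
have e'2 : e' <= (v - u) / 2 by rewrite ge_min lexx orbT.
case: (sep_lt Fy1 Fy2 y12 d) => h.
  by exists y1; split=> //; [have := M_small Fy1; lra|lra].
by exists y2; split=> //; [have := M_small Fy2; lra|lra].
Qed.

(* Among the points [y] subject to the first three conditions, choose one with
   [M y] above half the supremum. A coarser point [y'] shadowing [y], that is
   [y' < y < y' + M y' ^+ 2], would meet these conditions too, while
   [M y < M y' ^+ 2 <= M y' / 4]. *)
Lemma unshadowed z p : F z -> F p -> z < p -> p < z + M z ^+ 2 ->
  exists y, [/\ F y, z < y <= p, p - y < 2 * M y ^+ 2 &
    forall y', F y' -> z < y' -> y' < y -> M y < M y' -> y - y' >= M y' ^+ 2].
Proof.
move=> Fz Fp zp pz.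
pose S := [set m | exists y, [/\ F y, z < y <= p, p - y < 2 * M y ^+ 2 & m = M y]].
have supS : has_sup S.
  split; last by exists 4^-1 => _ [y [Fy _ _ ->]]; exact: M4.
  by exists (M p), p; split=> //; have := M0 Fp; nra.
have sup0 : 0 < sup S.
  apply: lt_le_trans (M0 Fp) _; apply: ub_le_sup; first by case: supS.
  by exists p; split=> //; have := M0 Fp; nra.
have [_ [y [Fy /andP[zy yp] py ->]]] : exists2 m, S m & sup S / 2 < m.
  have [|m Sm] := @sup_adherent _ S (sup S / 2) _ supS; first by lra.
  by rewrite {1}(splitr (sup S)) addrK; exists m.
move=> hm; exists y; split=> //; first by rewrite zy.
move=> y' Fy' zy' y'y My'; rewrite leNgt; apply/negP => h.
have h1 : M y < M y' ^+ 2.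
  have yy' : y != y' by rewrite gt_eqF.
  have := sep_lt Fy Fy' yy' (r := M y' ^+ 2).
  rewrite ger0_norm; last lra.
  by case=> //; have := M_small Fy'; lra.
have : M y' <= sup S.
  apply: ub_le_sup; first by case: supS.
  exists y'; split=> //; first by rewrite zy' /=; lra.
  have := M4 Fy'; have := M0 Fy'; have := M4 Fy; have := M0 Fy; nra.
have := M4 Fy'; have := M0 Fy'; nra.
Qed.

(** A finite set of points is recovered from a starting point [y0], a range of gaps
    [m < M y <= M y0], and a target [c] that must lie in the window of length [M y ^+ 2] to the
    right of [y]. *)
Definition coded (y0 m c y : R) :=
  [/\ F y, y0 <= y, m < M y, M y <= M y0 & 0 < c - y < M y ^+ 2].

(** One nested choice. With [s = M z ^+ 2] and [K = k.+2], a target [c] near [z + s / K] gives [z] a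
    code [s / (c - z)] near [K]. A finer point [z'] is placed just below [z + s / K]; putting [c]
    into its window fixes the code of [z] and admits no other point with a gap in between. The
    factor [6 * K ^+ 2] arises because [c - z] has error at most [3 * s ^+ 2], which is multiplied
    by [K / (c - z)], where [c - z >= s / (2 * K)]. *)
Lemma coding_step (e : R) (k : nat) y0 z : 0 < e ->
  M y0 ^+ 2 * (6 * (k.+2%:R) ^+ 2) < e -> M y0 ^+ 2 * (6 * (k.+2%:R) ^+ 2) < 1 ->
  F y0 -> F z -> u < y0 <= z -> z + M z ^+ 2 < v -> M z <= M y0 ->
  exists z', [/\ F z', z < z', z' + M z' ^+ 2 < z + M z ^+ 2, M z' < M z &
    forall c, 0 < c - z' < M z' ^+ 2 ->
      [/\ 0 < c - z < M z ^+ 2,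
          `|M z ^+ 2 / (c - z) - k.+2%:R| < e &
          forall y, F y -> y0 <= y -> M z' < M y -> M y <= M z ->
            0 < c - y < M y ^+ 2 -> y = z]].
Proof.
move=> e0 me m1 Fy0 Fz /andP[uy0 y0z] zv mz.
set K := k.+2%:R; have K2 : 2 <= K by rewrite ler_nat.
have Mz0 := M0 Fz; have Mz4 := M4 Fz.
pose s := M z ^+ 2; have s0 : 0 < s by rewrite exprn_gt0.
have s16 : s <= 16^-1 by rewrite /s; nra.
have sK : s * (6 * K ^+ 2) < 1.
  apply: le_lt_trans m1; rewrite ler_pM2r; last by nra.
  by rewrite /s; have := M0 Fy0; nra.
have se : s * (6 * K ^+ 2) < e.
  apply: le_lt_trans me; rewrite ler_pM2r; last by nra.
  by rewrite /s; have := M0 Fy0; nra.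
have K0 : 0 < K by lra.
have [t t0 tK] : exists2 t, 0 < t & t * K = s.
  by exists (s / K); [exact: divr_gt0|rewrite divfK// gt_eqF].
pose c0 := z + t.
have sK1 : t <= s / 2.
  have h : 0 <= t * (K - 2) by apply: mulr_ge0; lra.
  by lra.
have ss : s ^+ 2 * 6 < t.
  rewrite -(ltr_pM2r K0) tK.
  have h : s * (6 * K) < 1.
    apply: le_lt_trans sK; rewrite ler_pM2l// ler_pM2l//; nra.
  have -> : s ^+ 2 * 6 * K = s * (s * (6 * K)) by ring.
  by rewrite gtr_pMr.
have s20 : 0 < s ^+ 2 by exact: exprn_gt0.
have [p [Fp pc pc']] : exists p, [/\ F p, c0 - s ^+ 2 < p & p < c0].
  apply: Fdense; rewrite /c0; first by nra.
    by rewrite ltrBlDr ltrDl exprn_gt0.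
  by move: zv; rewrite -/s => zv; lra.
have zp : z < p by move: pc; rewrite /c0; nra.
have pz : p < z + M z ^+ 2 by rewrite -/s; move: pc'; rewrite /c0; lra.
(* The point [p] itself is not suitable as [z']: a coarser point between [z] and [p] could have the
   target in its window and would be coded as well. *)
have [z' [Fz' /andP[zz' z'p] pz' hz']] := unshadowed Fz Fp zp pz.
have finer y : F y -> z < y -> y < z + s -> M y < s.
  move=> Fy zy ys; have zny : z != y by rewrite lt_eqF.
  have := sep_lt Fz Fy zny (r := s); rewrite distrC ger0_norm; last by lra.
  by case=> //; [lra|rewrite /s; have := M_small Fz; lra].
have Mz's : M z' < s by apply: finer => //; move: pc'; rewrite /c0; lra.
have Mz'0 := M0 Fz'.
have Mz'2 : M z' ^+ 2 < s ^+ 2 by nra.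
exists z'; split=> //.
- by rewrite -/s; move: pc'; rewrite /c0; nra.
- by have := M_small Fz; rewrite -/s; lra.
move=> c /andP[c1 c2].
have cz1 : c - z < t + s ^+ 2 by move: pc'; rewrite /c0; lra.
have cz2 : t - 3 * s ^+ 2 < c - z by move: pc; rewrite /c0; lra.
have cz0 : 0 < c - z by lra.
split.
- by rewrite cz0 -/s /=; nra.
- have -> : s / (c - z) - K = (t - (c - z)) * K / (c - z).
    by rewrite mulrBl tK; field; rewrite gt_eqF.
  rewrite normrM normfV (gtr0_norm cz0) ltr_pdivrMr//.
  rewrite normrM (gtr0_norm K0).
  have hn : `|t - (c - z)| < 3 * s ^+ 2 by rewrite ltr_norml; nra.
  have cz3 : t / 2 <= c - z by nra.
  apply: (@lt_le_trans _ _ (3 * s ^+ 2 * K)); first by rewrite ltr_pM2r//; lra.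
  apply: (@le_trans _ _ (e * (t / 2))); last by rewrite ler_pM2l.
  rewrite -(ler_pM2r K0).
  have -> : e * (t / 2) * K = e * (t * K) / 2 by ring.
  by rewrite tK; nra.
move=> y Fy y0y My1 My2 /andP[y1 y2].
(* A competitor to the left of [z] is too far from [c] for its window; one between [z] and [z'] is
   excluded by the choice of [z']; one beyond [z'] is too close to [z'] for the two gaps. *)
apply/eqP; apply: contraT => yz.
have h1 := M_small Fy.
have h2 := Msep Fy Fz yz.
have h3 : M y <= `|y - z| by move: h2; rewrite min_l.
have [ylz|zly|] := ltrgtP y z.
- by move: h3; rewrite ltr0_norm ?subr_lt0//; lra.
- have ys : y < z + s by nra.
  have [yz'|z'y|e'] := ltrgtP y z'.
  + by have := hz' y Fy zly yz' My1; lra.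
  + have z'ny : z' != y by rewrite lt_eqF.
    have := sep_lt Fz' Fy z'ny (r := M z' ^+ 2); rewrite distrC ger0_norm; last lra.
    by have := M_small Fz'; case; lra.
  + by move: My1; rewrite e' ltxx.
- by move=> e'; move: yz; rewrite e' eqxx.
Qed.

(** The gap at [y0] is so small that all [k] steps meet their smallness conditions. The codes start
    at [2] because every point in the window has a code above [1]: the value [1] would put [c] on
    its boundary. *)
Lemma coding (e : R) (k : nat) : 0 < e -> exists y0 m c : R,
  (forall y, coded y0 m c y -> exists2 i, (i < k)%N & `|M y ^+ 2 / (c - y) - i.+2%:R| < e) /\
  (forall i, (i < k)%N -> exists2 y, coded y0 m c y & `|M y ^+ 2 / (c - y) - i.+2%:R| < e).
Proof.
move=> e0.
pose B : R := 6 * (k.+2%:R) ^+ 2.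
have B1 : 1 <= B.
  have h : 2 <= k.+2%:R :> R by rewrite ler_nat.
  by rewrite /B; nra.
pose d := Num.min (e / B) (B^-1).
have d0 : 0 < d by rewrite lt_min divr_gt0 ?invr_gt0//; lra.
have [y0 [Fy0 uy0 y0v My0]] := exists_small d0.
have My0' : M y0 ^+ 2 < d by have := M_small Fy0; lra.
have h1 : M y0 ^+ 2 * B < e.
  rewrite -ltr_pdivlMr; last lra.
  by apply: lt_le_trans My0' _; rewrite ge_min lexx.
have h2 : M y0 ^+ 2 * B < 1.
  rewrite -ltr_pdivlMr ?div1r; last lra.
  by apply: lt_le_trans My0' _; rewrite ge_min lexx orbT.
(* The claim is made for all targets in the window of the last point [z], which leaves the next step
   free to shrink this window. *)
have : forall j, (j <= k)%N -> exists z, [/\ F z, y0 <= z, z + M z ^+ 2 < v, M z <= M y0 &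
  forall c, 0 < c - z < M z ^+ 2 ->
  (forall y, coded y0 (M z) c y -> exists2 i, (i < j)%N & `|M y ^+ 2 / (c - y) - i.+2%:R| < e) /\
  (forall i, (i < j)%N -> exists2 y, coded y0 (M z) c y & `|M y ^+ 2 / (c - y) - i.+2%:R| < e)].
  elim=> [_|j IH jk].
    by exists y0; split=> // c hc; split=> // y [_ _ h h' _]; lra.
  have [z [Fz y0z zv mz hz]] := IH (ltnW jk).
  have hB : 6 * (j.+2%:R) ^+ 2 <= B :> R.
    rewrite /B ler_pM2l// lerXn2r ?nnegrE ?ler0n// ler_nat.
    by rewrite !ltnS ltnW.
  have [] := @coding_step e j y0 z e0 _ _ Fy0 Fz _ zv mz.
  - by apply: le_lt_trans h1; rewrite ler_pM2l// exprn_gt0// M0.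
  - by apply: le_lt_trans h2; rewrite ler_pM2l// exprn_gt0// M0.
  - by rewrite uy0.
  move=> z' [Fz' zz' z'v mz' hz'].
  exists z'; split=> //; [by lra|by lra|by lra|].
  move=> c hc; have [hc1 hc2 hc3] := hz' c hc.
  have [hI hE] := hz c hc1.
  split.
    move=> y [Fy y0y my my0 hy].
    have [myz|myz] := ltP (M z) (M y).
      have [//|i ij hi] := hI y; exists i => //; exact: ltnW.
    exists j => //; by rewrite (hc3 y).
  move=> i; rewrite ltnS leq_eqVlt => /orP[/eqP ->|ij].
    by exists z.
  have [y [Fy y0y my my0 hy] hi] := hE i ij.
  by exists y => //; split=> //; lra.
move=> /(_ k (leqnn k))[z [Fz y0z zv mz hz]].
exists y0, (M z), (z + M z ^+ 2 / 2); apply: hz.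
by have := M0 Fz; nra.
Qed.

End Coding.
End Hieronymi.

(** * The natural numbers from an increasing family of finite sets *)

Section Naturals.
Variables (R : realType) (RR : expansion R).
Hypothesis hN : ~ defines_nat RR.
Variable G : R -> R -> Prop.
Hypothesis dG : def RR (fun p : R * R => G p.1 p.2).
Hypothesis Gfin : forall a : R, 0 < a -> finite_set [set y | G a y].
Hypothesis Ginc : forall a b y : R, 0 < a -> a <= b -> G a y -> G b y.

Let F : set R := [set y | exists a : R, 0 < a /\ G a y].
(** Bounds from below the distance from [y] to the rest of some member through [y]; small members
    give the best bounds. The cap [1 / 4] keeps the supremum [M y] finite and [M y ^+ 2] below
    [M y]. *)
Let W (y m : R) := 0 < m /\ m <= 4^-1 /\ exists a : R, 0 < a /\ G a y /\
  forall z : R, G a z -> z <> y -> m <= `|y - z|.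
Let M (y : R) := sup [set m | W y m].

Lemma gap_exists y : F y -> exists m, W y m.
Proof.
case=> a [a0 Gy].
have [s hs] : exists s : seq R, [set z | G a z] = [set` s].
  exact/finite_seqP/Gfin.
have : exists m : R, 0 < m /\ forall z, z \in s -> z <> y -> m <= `|y - z|.
  elim: (s) => [|x s' [m [m0 hm]]]; first by exists 1; split=> //.
  have [xy|xy] := eqVneq x y.
    exists m; split=> // z; rewrite inE => /orP[/eqP -> //|]; exact: hm.
  exists (Num.min m `|y - x|); split.
    by rewrite lt_min m0 normr_gt0 subr_eq0 eq_sym.
  move=> z; rewrite inE ge_min => /orP[/eqP ->|zs zy].
    by rewrite lexx orbT.
  by rewrite hm.
case=> m [m0 hm]; exists (Num.min m 4^-1); split.
  by rewrite lt_min m0 invr_gt0 ltr0n.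
split; first by rewrite ge_min lexx orbT.
exists a; split=> //; split=> // z Gz zy; rewrite ge_min hm//.
by have : [set` s] z by rewrite -hs.
Qed.

Lemma gap_sup y : F y -> has_sup [set m | W y m].
Proof.
move=> Fy; split; first by have [m] := gap_exists Fy; exists m.
by exists 4^-1 => m [_ []].
Qed.

Lemma gap_gt0 y : F y -> 0 < M y.
Proof.
move=> Fy; have [m Wm] := gap_exists Fy; have [m0 _] := Wm.
apply: lt_le_trans m0 _; apply: ub_le_sup => //.
by case: (gap_sup Fy).
Qed.

Lemma gap_le4 y : F y -> M y <= 4^-1.
Proof.
move=> Fy; apply: ge_sup; last by move=> m [_ []].
by case: (gap_sup Fy).
Qed.

(** The two gaps are witnessed in members [G a] and [G b]. By monotonicity the larger member
    contains both points, so the bound witnessed there applies to their distance. *)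
Lemma gap_sep y z : F y -> F z -> y != z -> Num.min (M y) (M z) <= `|y - z|.
Proof.
move=> Fy Fz /eqP yz; rewrite leNgt lt_min; apply/negP => /andP[hy hz].
have pick x : F x -> `|y - z| < M x -> exists2 m, W x m & `|y - z| < m.
  move=> Fx hx; have [|m Wm] := @sup_adherent _ _ (M x - `|y - z|) _ (gap_sup Fx).
    by rewrite subr_gt0.
  by rewrite subKr; exists m.
have [m [_ [_ [a [a0 [Ga ha]]]]] hm] := pick y Fy hy.
have [m' [_ [_ [b [b0 [Gb hb]]]]] hm'] := pick z Fz hz.
have [ab|ba] := leP a b.
  have := hb y (Ginc a0 ab Ga) yz; rewrite distrC => h.
  by have := le_lt_trans h hm'; rewrite ltxx.
have := ha z (Ginc b0 (ltW ba) Gb) (nesym yz) => h.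
by have := le_lt_trans h hm; rewrite ltxx.
Qed.

(** The graph of [M] on [F], through the least upper bound property, so that its form shows that it
    is definable. *)
Let Mrel (y m : R) := (exists a : R, 0 < a /\ G a y) /\
  (forall x : R, W y x -> x <= m) /\ (forall x : R, x < m -> exists x' : R, W y x' /\ x < x').

Lemma MrelP y m : Mrel y m <-> F y /\ m = M y.
Proof.
split=> [[Fy [h1 h2]]|[Fy ->]]; split=> //.
  apply/eqP; rewrite eq_le; apply/andP; split.
    rewrite leNgt; apply/negP => /h2[x [Wx]]; rewrite ltNge => /negP; apply.
    by apply: ub_le_sup => //; case: (gap_sup Fy).
  by apply: ge_sup; [case: (gap_sup Fy)|move=> x /h1].
split=> [x Wx|x xM]; first by apply: ub_le_sup => //; case: (gap_sup Fy).
have [|x' Wx'] := @sup_adherent _ _ (M y - x) _ (gap_sup Fy).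
  by rewrite subr_gt0.
by rewrite subKr; exists x'.
Qed.

(** [p] lists [y0], [M y0], [m] and [c] in this order, and the code [g] is given by an equation
    without division. *)
Let Codes (p : R * R * R * R) (g : R) := exists y my : R,
  Mrel y my /\ p.1.1.1 <= y /\ p.1.2 < my /\ my <= p.1.1.2 /\
  0 < p.2 - y /\ p.2 - y < my ^+ 2 /\ g * (p.2 - y) = my ^+ 2.

(** Descent replaces counting: up to [e], each code is [2] or one more than another code. As codes
    exceed [1], passing to predecessors ends near [2], so the code [x + 2] is nearly a natural
    number. *)
Let Nat (x : R) := 0 <= x /\ forall e : R, 0 < e -> exists p : R * R * R * R,
  (forall g : R, Codes p g ->
     `|g - 2| < e \/ exists g' : R, Codes p g' /\ `|g - 1 - g'| < e) /\
  exists g : R, Codes p g /\ `|g - 2 - x| < e.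

Lemma def_Nat : def RR Nat.
Proof.
have dW : def RR (fun p : R * R => W p.1 p.2) by rewrite /W; dfn.
have dM : def RR (fun p : R * R => Mrel p.1 p.2) by rewrite /Mrel; dfn.
have dC : def RR (fun p : R * R * R * R * R => Codes p.1 p.2).
  by rewrite /Codes; dfn.
by rewrite /Nat; dfn.
Qed.

Lemma Codes_gt1 p g : Codes p g -> 1 < g.
Proof.
case=> y [my [_ [_ [_ [_ [h1 [h2 h3]]]]]]].
by rewrite -(ltr_pM2r h1) mul1r h3.
Qed.

Lemma Nat_nat x : Nat x -> exists k : nat, x = k%:R.
Proof.
case=> x0 hx.
have near e : 0 < e -> e <= 4^-1 -> exists i : nat, `|x - i%:R| < e.
  move=> e0 e4; pose n := (Num.truncn (2 * (x + 3))).+1.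
  have xn : 2 * (x + 3) < n%:R.
    have h : 0 <= 2 * (x + 3) by lra.
    by have /andP[] := truncn_itv h.
  pose d := e / n.+2%:R.
  have n2 : 0 < n.+2%:R :> R by rewrite ltr0n.
  have d0 : 0 < d by rewrite divr_gt0.
  have dn : d * n.+2%:R = e by rewrite divfK// gt_eqF.
  have d4 : d <= 4^-1.
    have : 1 <= n.+2%:R :> R by rewrite ler1n.
    by move=> h; nra.
  have [p [hp [g [Cg gx]]]] := hx d d0.
  (* A code drops by more than [1 / 2] at each step, so [2 * h < m] limits the number of steps to
     [m], and the errors add up to at most [m * d]. *)
  have ind m h : Codes p h -> 2 * h < m%:R ->
      exists i : nat, `|h - 2 - i%:R| <= m%:R * d.
    elim: m h => [|m IH] h Ch hm.
      by have := Codes_gt1 Ch; lra.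
    have mS : m.+1%:R = m%:R + 1 :> R by rewrite -natr1.
    have md : 0 <= m%:R * d by rewrite mulr_ge0 ?ler0n// ltW.
    have [h2|[h' [Ch' hh']]] := hp h Ch.
      exists 0%N; rewrite subr0 mS mulrDl mul1r; lra.
    have h'm : 2 * h' < m%:R.
      by move: hh'; rewrite ltr_norml => /andP[]; rewrite mS in hm; lra.
    have [i hi] := IH h' Ch' h'm; exists i.+1.
    rewrite mS mulrDl mul1r -natr1.
    move: hi hh'; rewrite !ler_norml !ltr_norml => /andP[a1 a2] /andP[a3 a4].
    by apply/andP; split; lra.
  have gn : 2 * g < n%:R.
    by move: gx; rewrite ltr_norml => /andP[]; lra.
  have [i] := ind n g Cg gn => hi; exists i.
  have : (n%:R + 1) * d < e.
    by rewrite -dn mulrC ltr_pM2l// -natr1 -natr1; lra.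
  move: hi gx; rewrite ler_norml !ltr_norml => /andP[a1 a2] /andP[a3 a4].
  by move=> h; apply/andP; split; lra.
(* A natural number nearer to [x] than [i] would be a second one within [1 / 4] of [x]; hence [x]
   equals [i]. *)
have h4 : 0 < 4^-1 :> R by rewrite invr_gt0 ltr0n.
have [i hi] := near _ h4 (lexx _).
exists i; apply/eqP; rewrite -subr_eq0 -normr_le0 leNgt; apply/negP => xi.
have [j hj] := near _ xi (ltW hi).
have [ij|ij] := eqVneq i j; first by move: hj; rewrite ij ltxx.
have : 1 <= `|i%:R - j%:R| :> R.
  have [lij|lij|e] := ltngtP i j; last by rewrite e eqxx in ij.
    by rewrite distrC -natrB ?(ltnW lij)// normr_nat ler1n subn_gt0.
  by rewrite -natrB ?(ltnW lij)// normr_nat ler1n subn_gt0.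
have : `|i%:R - j%:R| <= `|x - i%:R| + `|x - j%:R| :> R.
  by rewrite (distrC x i%:R); apply: le_trans (ler_normD _ _); rewrite addrA subrK.
by lra.
Qed.

Variables u v : R.
Hypothesis uv : u < v.
Hypothesis Gdense : forall a b, u <= a -> a < b -> b <= v ->
  exists s y : R, [/\ 0 < s, G s y, a < y & y < b].

Lemma nat_Nat (k : nat) : Nat k%:R.
Proof.
split; first exact: ler0n.
move=> e e0.
have Fd a b : u <= a -> a < b -> b <= v -> exists y, [/\ F y, a < y & y < b].
  move=> h1 h2 h3; have [s [y [s0 Gy ay yb]]] := Gdense h1 h2 h3.
  by exists y; split=> //; exists s.
have e2 : 0 < e / 2 by lra.
have [y0 [m [c [hI hE]]]] :=
  coding gap_gt0 gap_le4 gap_sep uv Fd k.+1 e2.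
have CodesP g : Codes (y0, M y0, m, c) g <->
    exists2 y, coded F M y0 m c y & g = M y ^+ 2 / (c - y).
  split.
    case=> y [my [/MrelP[Fy ->] /= [h1 [h2 [h3 [h4 [h5 h6]]]]]]].
    by exists y; [split=> //; rewrite h4|rewrite -h6 mulfK// gt_eqF].
  case=> y [Fy h1 h2 h3 /andP[h4 h5]] ->; exists y, (M y); split.
    exact/MrelP.
  by rewrite /= divfK// gt_eqF.
exists (y0, M y0, m, c); split.
  move=> g /CodesP[y cy ->]; have [[|i] ik hi] := hI y cy.
    by left; apply: lt_trans hi _; lra.
  right; have [|y' cy' hi'] := hE i; first exact: ltnW.
  exists (M y' ^+ 2 / (c - y')); split; first by apply/CodesP; exists y'.
  rewrite -natr1 in hi.
  move: hi hi'; rewrite !ltr_norml => /andP[a1 a2] /andP[a3 a4].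
  by apply/andP; split; lra.
have [y cy hi] := hE k (ltnSn k).
exists (M y ^+ 2 / (c - y)); split; first by apply/CodesP; exists y.
rewrite -natr1 -natr1 in hi.
move: hi; rewrite !ltr_norml => /andP[a1 a2].
by apply/andP; split; lra.
Qed.

Theorem no_dense_finite_filtration : False.
Proof.
apply: hN; rewrite /defines_nat.
have h := def_Nat; apply/defP => //.
have : def RR (fun x : 'rV[R]_1 => Nat (x 0 0)) by dfn.
apply: def_ext => x; split; first exact: Nat_nat.
by case=> k ->; exact: nat_Nat.
Qed.

End Naturals.

(** * Closed relations *)

Section ClosedRelations.
Variable R : realType.

Section Terms.
Variable T : topologicalType.
Implicit Types f g : T -> R.

Lemma ct_id : continuous (fun x : T => x).
Proof. by move=> x; exact: cvg_id. Qed.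

Lemma ct_cst (U : topologicalType) (c : U) : continuous (fun _ : T => c).
Proof. by move=> x; exact: cvg_cst. Qed.

Lemma ct_comp (U V : topologicalType) (g : U -> V) (f : T -> U) :
  continuous g -> continuous f -> continuous (fun x => g (f x)).
Proof. by move=> hg hf x; apply: continuous_comp; [exact: hf|exact: hg]. Qed.

Lemma ct_fst (U V : topologicalType) (f : T -> U * V) :
  continuous f -> continuous (fun x => (f x).1).
Proof. by apply: ct_comp => -[a b]; exact: cvg_fst. Qed.

Lemma ct_snd (U V : topologicalType) (f : T -> U * V) :
  continuous f -> continuous (fun x => (f x).2).
Proof. by apply: ct_comp => -[a b]; exact: cvg_snd. Qed.

Lemma ct_pair (U V : topologicalType) (f : T -> U) (g : T -> V) :
  continuous f -> continuous g -> continuous (fun x => (f x, g x)).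
Proof. by move=> hf hg x; apply: cvg_pair; [exact: hf|exact: hg]. Qed.

Lemma ct_entry n (f : T -> 'rV[R]_n) (i : 'I_n) :
  continuous f -> continuous (fun x => f x 0 i).
Proof.
move=> hf x; apply: (continuous_comp (g := fun v : 'rV[R]_n => v 0 i)); first exact: hf.
exact: coord_continuous.
Qed.

Lemma ct_row n (f : 'I_n -> T -> R) :
  (forall i, continuous (f i)) -> continuous (fun x => \row_i f i x : 'rV[R]_n).
Proof.
move=> hf x A [B hB sub]; rewrite /= in hB sub.
have : \forall y \near x, forall i, B 0 i (f i y).
  apply: filter_forall => i; apply: (hf i x).
  by have := hB 0 i; rewrite mxE.
apply: filterS => y hy; apply: sub => i j.
by rewrite mxE (ord1 i).
Qed.

Lemma ct_add f g : continuous f -> continuous g -> continuous (fun x => f x + g x).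
Proof. by move=> hf hg x; apply: cvgD; [exact: hf|exact: hg]. Qed.

Lemma ct_mul f g : continuous f -> continuous g -> continuous (fun x => f x * g x).
Proof. by move=> hf hg x; apply: cvgM; [exact: hf|exact: hg]. Qed.

Lemma ct_opp f : continuous f -> continuous (fun x => - f x).
Proof. by move=> hf x; apply: cvgN; exact: hf. Qed.

Lemma ct_norm f : continuous f -> continuous (fun x => `|f x|).
Proof. by move=> hf x; apply: cvg_norm; exact: hf. Qed.

Lemma ct_exp f k : continuous f -> continuous (fun x => f x ^+ k).
Proof.
move=> hf; elim: k => [|k IH].
  by under eq_fun do rewrite expr0; exact: ct_cst.
by under eq_fun do rewrite exprS; exact: ct_mul.
Qed.

Lemma ct_sum k (f : 'I_k -> T -> R) :
  (forall i, continuous (f i)) -> continuous (fun x => \sum_i f i x).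
Proof.
elim: k f => [|k IH] f hf.
  by under eq_fun do rewrite big_ord0; exact: ct_cst.
by under eq_fun do rewrite big_ord_recl; apply: ct_add => //; exact: IH.
Qed.

(** Closedness of a predicate, to be read off a formula. The quantifiers that preserve it are
    arbitrary universal ones and existential ones over a finite or compact range. *)
Definition clo (P : T -> Prop) := closed [set x | P x].

Lemma clo_and P Q : clo P -> clo Q -> clo (fun x => P x /\ Q x).
Proof. exact: closedI. Qed.

Lemma clo_or P Q : clo P -> clo Q -> clo (fun x => P x \/ Q x).
Proof. exact: closedU. Qed.

Lemma clo_true (P : Prop) : clo (fun _ => P).
Proof.
have [p|np] := pselect P.
  by rewrite (_ : (fun=> P) = (fun=> True)); [exact: closedT|apply/funext => x; exact/propext].
by rewrite (_ : (fun=> P) = (fun=> False)); [exact: closed0|apply/funext => x; exact/propext].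
Qed.

Lemma clo_impl (P : Prop) Q : (P -> clo Q) -> clo (fun x => P -> Q x).
Proof.
have [p /(_ p) h|np _] := pselect P.
  by rewrite (_ : (fun x => P -> Q x) = Q)//; apply/funext => x; apply/propext; tauto.
rewrite (_ : (fun x => P -> Q x) = (fun=> True)); first exact: clo_true.
by apply/funext => x; apply/propext; tauto.
Qed.

Lemma clo_all (I : Type) (P : I -> T -> Prop) :
  (forall i, clo (P i)) -> clo (fun x => forall i, P i x).
Proof.
move=> h; rewrite /clo (_ : [set x | _] = \bigcap_i [set x | P i x]).
  by apply: closed_bigI => i _; exact: h.
by apply/seteqP; split => x hx; [move=> i _|move=> i]; exact: hx.
Qed.

Lemma clo_comp (U : topologicalType) (f : T -> U) (Q : U -> Prop) :
  closed [set y | Q y] -> continuous f -> clo (fun x => Q (f x)).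
Proof. by move=> hQ hf; apply: (preimage_closed _ hQ) => x _; exact: hf. Qed.

Lemma clo_le f g : continuous f -> continuous g -> clo (fun x => f x <= g x).
Proof.
move=> hf hg; have h := @closed_ge R 0.
have hc : continuous (fun x => g x + - f x) by apply/ct_add/ct_opp.
have := clo_comp h hc; rewrite /clo; congr closed.
by apply/funext => x /=; rewrite subr_ge0.
Qed.

Lemma clo_eq f g : continuous f -> continuous g -> clo (fun x => f x = g x).
Proof.
move=> hf hg; have := clo_and (clo_le hf hg) (clo_le hg hf).
congr closed; apply/funext => x /=; apply/propext; split=> [[h1 h2]|->//].
by apply/eqP; rewrite eq_le h1.
Qed.

Lemma clo_exord k (P : 'I_k -> T -> Prop) :
  (forall i, clo (P i)) -> clo (fun x => exists i, P i x).
Proof.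
elim: k P => [|k IH] P h.
  rewrite (_ : (fun _ => _) = (fun=> False)); first exact: clo_true.
  by apply/funext => x; apply/propext; split=> // -[[]].
have := clo_or (h ord0) (IH _ (fun i => h (lift ord0 i))).
congr closed; apply/funext => x; apply/propext; split.
  by case=> [|[i]]; [exists ord0|exists (lift ord0 i)].
case=> i; case: (unliftP ord0 i) => [j ->|->]; [right; by exists j|by left].
Qed.

End Terms.

Lemma tube (T U : topologicalType) (K : set U) (P : T * U -> Prop) (t : T) :
  compact K -> (forall u, K u -> \forall q \near (t, u), P q) ->
  \forall t' \near t, forall u, K u -> P (t', u).
Proof.
move=> /compact_near_coveringP cK h.
apply: (cK T (nbhs t) (fun t' u => P (t', u))) => u Ku.
have [[A B] /= [At Bu] sub] := h u Ku.
by exists (B, A) => // -[u' t'] /= [Bu' At']; apply: sub.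
Qed.

Lemma clo_ex_compact (T U : topologicalType) (K : set U) (P : T -> U -> Prop) :
  compact K -> closed [set q : T * U | P q.1 q.2] ->
  clo (fun x => exists u, K u /\ P x u).
Proof.
move=> cK cP; rewrite /clo -openC openE => t /= ht.
have : \forall t' \near t, forall u, K u -> ~ P (t', u).1 (t', u).2.
  apply: (tube (P := fun q => ~ P q.1 q.2) cK) => u Ku.
  have : nbhs (t, u) (~` [set q : T * U | P q.1 q.2]).
    apply: open_nbhs_nbhs; split; first exact: closed_openC.
    by move=> /= Ptu; apply: ht; exists u.
  by [].
by apply: filterS => t' h [u [Ku]]; exact: h.
Qed.

Lemma cube_compact n (a b : R) :
  compact [set v : 'rV[R]_n | forall i, a <= v 0 i /\ v 0 i <= b].
Proof.
have := rV_compact (fun _ : 'I_n => @segment_compact R a b).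
congr compact; apply/seteqP; split => v /= h i.
  by have /= := h i; rewrite in_itv /= => /andP.
by rewrite in_itv /=; exact/andP/h.
Qed.

Lemma Icc_compact (a b : R) : compact [set x : R | a <= x /\ x <= b].
Proof.
have := @segment_compact R a b; congr compact; apply/seteqP.
by split => x /=; rewrite in_itv /= => /andP.
Qed.

End ClosedRelations.

Ltac ct_step := cbv beta; lazymatch goal with
  | |- continuous (fun _ => ?c) => exact: ct_cst
  | |- continuous (fun x => x) => exact: ct_id
  | |- continuous (fun x => fst (@?f x)) => apply: (ct_fst (f := f))
  | |- continuous (fun x => snd (@?f x)) => apply: (ct_snd (f := f))
  | |- continuous (@fst _ _) => move=> ?; exact: cvg_fst
  | |- continuous (@snd _ _) => move=> ?; exact: cvg_snd
  | |- continuous (fun x => (@?f x, @?g x)) => apply: (ct_pair (f := f) (g := g))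
  | |- continuous (fun x => GRing.add (@?f x) (@?g x)) =>
      apply: (ct_add (f := f) (g := g))
  | |- continuous (fun x => GRing.mul (@?f x) (@?g x)) =>
      apply: (ct_mul (f := f) (g := g))
  | |- continuous (fun x => GRing.opp (@?f x)) => apply: (ct_opp (f := f))
  | |- continuous (fun x => GRing.exp (@?f x) ?k) => apply: (ct_exp (f := f))
  | |- continuous (fun x => Num.norm (@?f x)) => apply: (ct_norm (f := f))
  | |- continuous (fun x => fun_of_matrix (@?f x) _ ?i) =>
      apply: (ct_entry (f := f))
  | |- continuous _ => first [ eassumption
      | lazymatch goal with |- continuous (fun x => ?h (@?f x)) =>
          apply: (ct_comp (g := h) (f := f)); [ eassumption | ] end
      | apply: ct_sum; intro | apply: ct_row; intro ]
  end.

Ltac clo_step := cbv beta; lazymatch goal with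
  | |- continuous _ => ct_step
  | |- clo (fun x => @?P x /\ @?Q x) => apply: (@clo_and _ P Q)
  | |- clo (fun x => @?P x \/ @?Q x) => apply: (@clo_or _ P Q)
  | |- clo (fun x => ?P -> @?Q x) => apply: (@clo_impl _ P Q); intro
  | |- clo (fun x => exists i : ordinal _, @?P x i) =>
      refine (@clo_exord _ _ (fun i x => P x i) _); intro
  | |- clo (fun x => forall i, @?P x i) =>
      refine (@clo_all _ _ (fun i x => P x i) _); intro
  | |- clo (fun x => is_true (Order.le (@?f x) (@?g x))) =>
      apply: (clo_le (f := f) (g := g))
  | |- clo (fun x => @?f x = @?g x) => apply: (clo_eq (f := f) (g := g))
  | |- clo _ => first [ eassumption | exact: clo_true ]
  end.

Ltac solve_clo := repeat clo_step.

(** * Scales *)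

Section Scales.
Variables (R : realType) (RR : expansion R).
Hypothesis hN : ~ defines_nat RR.

Lemma separated_finite (S : set R) (lo hi d : R) : 0 < d ->
  (forall x : R, S x -> lo <= x /\ x <= hi) ->
  (forall x y : R, S x -> S y -> x < y -> d <= y - x) -> finite_set S.
Proof.
move=> d0 hS hd.
have ind n : finite_set [set x | S x /\ x < lo + n%:R * d].
  elim: n => [|n IH].
    apply: sub_finite_set (finite_set0 R) => x [/hS[h1 _]].
    by rewrite mul0r addr0 ltNge h1.
  pose T := [set x | S x /\ (lo + n%:R * d <= x /\ x < lo + n.+1%:R * d)].
  have fT : finite_set T.
    have [[x [Sx [x1 x2]]]|no] := pselect (exists x, T x).
      apply: sub_finite_set (finite_set1 x) => y [Sy [y1 y2]].
      rewrite -natr1 mulrDl mul1r in x2 y2.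
      have [yx|xy|//] := ltrgtP y x.
        by have := hd y x Sy Sx yx; lra.
      by have := hd x y Sx Sy xy; lra.
    by apply: sub_finite_set (finite_set0 R) => y Ty; apply: no; exists y.
  have := conj IH fT; rewrite -finite_setU; apply: sub_finite_set.
  move=> x [Sx xn]; have [h|h] := ltP x (lo + n%:R * d); first by left.
  by right.
have [h|h] := leP lo hi; last first.
  by apply: sub_finite_set (finite_set0 R) => x /hS[]; lra.
pose n := (Num.truncn ((hi - lo) / d)).+1.
apply: sub_finite_set (ind n) => x Sx; split=> //.
have [x1 x2] := hS x Sx.
have h0 : 0 <= (hi - lo) / d by rewrite divr_ge0 ?subr_ge0// ltW.
have /andP[_] := truncn_itv h0; rewrite -/n ltr_pdivrMr//; lra.
Qed.

(** A definable substitute for a sequence of positive reals decreasing to [0]. *)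
Definition scale_set (D : set R) := [/\ def RR D, forall s, D s -> 0 < s,
  forall d : R, 0 < d -> finite_set [set s | D s /\ d <= s] &
  forall d : R, 0 < d -> exists s, D s /\ s < d].

Lemma closed_gap (Z : set R) z w z' : closed Z -> Z z -> Z z' -> ~ Z w ->
  z < w -> w < z' -> exists a b, [/\ Z a, Z b, z <= a < w, w < b <= z' &
    forall x : R, a < x -> x < b -> ~ Z x].
Proof.
move=> cZ Zz Zz' nZw zw wz'.
pose A := [set x | Z x /\ x <= w]; pose B := [set x | Z x /\ w <= x].
have cA : closed A by apply: closedI => //; exact: closed_le.
have cB : closed B by apply: closedI => //; exact: closed_ge.
have hA : has_sup A by split; [exists z; split=> //; exact: ltW|exists w => x []].
have hB : has_inf B by split; [exists z'; split=> //; exact: ltW|exists w => x []].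
have [Za aw] : A (sup A) by apply: cA; apply: closure_sup; case: hA.
have [Zb bw] : B (inf B).
  apply: cB; rewrite -(opprK (inf B)).
  have : closure (-%R @` B) (sup (-%R @` B)).
    apply: closure_sup; first by case: hB => -[x Bx] _; exists (- x), x.
    by exists (- w) => _ [x [_ wx] <-]; rewrite lerN2.
  have -> : sup (-%R @` B) = - inf B by rewrite /inf opprK.
  move=> h V; rewrite opprK => Vb.
  have [] := h (-%R @^-1` V).
    by have : (-%R : R -> R) y @[y --> - inf B] --> - - inf B; [exact: cvgN|apply; rewrite opprK].
  by move=> _ [[x Bx <-]]; rewrite /= opprK => Vx; exists x.
have aw' : sup A < w by rewrite lt_neqAle aw andbT; apply/eqP => e; rewrite e in Za.
have bw' : w < inf B by rewrite lt_neqAle bw andbT; apply/eqP => e; rewrite -e in Zb.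
exists (sup A), (inf B); split=> //.
- by rewrite aw' andbT; apply: ub_le_sup; [case: hA|split=> //; exact: ltW].
- by rewrite bw' /=; apply: ge_inf; [case: hB|split=> //; exact: ltW].
move=> x ax xb Zx; have [xw|wx] := leP x w.
  have : x <= sup A by apply: ub_le_sup => //; case: hA.
  by rewrite leNgt ax.
have : inf B <= x by apply: ge_inf; [case: hB|split=> //; exact: ltW].
by rewrite leNgt xb.
Qed.

(** The scales are the lengths of the bounded gaps of [Z]. Gaps of length at least [d] are disjoint
    in a bounded interval, so only finitely many exist, while arbitrarily short ones are supplied by
    the hypothesis. *)
Lemma scale_of_gaps (Z : set R) (lo hi : R) : def RR Z -> closed Z ->
  (forall x : R, Z x -> lo <= x /\ x <= hi) ->
  (forall d : R, 0 < d -> exists z w z',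
     [/\ Z z, ~ Z w, Z z', z < w < z' & z' - z < d]) ->
  exists D, scale_set D.
Proof.
move=> dZ cZ bZ hZ.
pose gap (a b : R) := Z a /\ Z b /\ a < b /\ forall x : R, a < x -> x < b -> ~ Z x.
exists [set s : R | exists a b : R, gap a b /\ s = b - a]; split.
- have dg : def RR (fun p : R * R => gap p.1 p.2) by rewrite /gap; dfn.
  by change (def RR (fun s : R => exists a b : R, gap a b /\ s = b - a)); dfn.
- by move=> s [a [b [[_ [_ [ab _]]] ->]]]; rewrite subr_gt0.
- move=> d d0.
  pose L := [set a | exists b, gap a b /\ d <= b - a].
  have fL : finite_set L.
    apply: (@separated_finite _ lo hi d) => //.
      by move=> x [b [[/bZ]]].
    move=> x y [b [[_ [_ [_ hb]]] db]] [b' [[Zy _] _]] xy.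
    have [yb|by'] := ltP y b; first by have := hb y xy yb.
    by lra.
  (* A gap is determined by its left end, so the lengths form the image of the finite set [L]. *)
  have := finite_image (fun a => xget 0 [set s | exists b, gap a b /\ s = b - a]) fL.
  apply: sub_finite_set => s [[a [b [gab sE]]] ds] /=.
  exists a; first by exists b; rewrite -sE.
  apply: xget_unique; first by exists b.
  move=> t [b' [gab' ->]]; rewrite sE; congr (_ - _).
  case: gab => _ [Zb [ab hb]]; case: gab' => _ [Zb' [ab' hb']].
  have [h|h|//] := ltgtP b' b; first by have := hb b' ab' h.
  by have := hb' b ab h.
move=> d d0; have [z [w [z' [Zz Zw Zz' /andP[zw wz'] hd]]]] := hZ d d0.
have [a [b [Za Zb /andP[za aw] /andP[wb bz'] hab]]] := closed_gap cZ Zz Zz' Zw zw wz'.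
exists (b - a); split; last lra.
by exists a, b; split=> //; split=> //; split=> //; split=> //; lra.
Qed.

(** Infinitely many points in a bounded interval come arbitrarily close to each other, and between
    two of them some point is missing. *)
Lemma scale_of_infinite (Z : set R) (lo hi : R) : def RR Z -> closed Z ->
  (forall x : R, Z x -> lo <= x /\ x <= hi) -> ~ finite_set Z ->
  (forall a b : R, lo <= a -> a < b -> b <= hi -> exists w, [/\ a < w, w < b & ~ Z w]) ->
  exists D, scale_set D.
Proof.
move=> dZ cZ bZ iZ nZ; apply: (scale_of_gaps dZ cZ bZ) => d d0.
apply: contrapT => no; apply: iZ; apply: (@separated_finite _ lo hi d) => //.
move=> x y Zx Zy xy; rewrite leNgt; apply/negP => h; apply: no.
have [h1 _] := bZ x Zx; have [_ h2] := bZ y Zy.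
have [w [xw wy Zw]] := nZ x y h1 xy h2.
by exists x, w, y; split=> //; rewrite xw.
Qed.

(** Without scales, the part of [DA a] in [[1 / a, e / 2]] is finite, as an infinite closed set
    without interior has short gaps. These finite sets increase with [a], so their union is nowhere
    dense; if it accumulated at [0], its closure would again have arbitrarily short gaps. *)
Lemma eventually_none (DA : R -> R -> Prop) (e : R) : 0 < e ->
  def RR (fun p : R * R => DA p.1 p.2) ->
  (forall a b x : R, 0 < a -> a <= b -> DA a x -> DA b x) ->
  (forall a, 0 < a -> closed [set x | DA a x]) ->
  (forall a u v : R, 0 < a -> 0 < u -> u < v -> v < e ->
     exists x, [/\ u < x, x < v & ~ DA a x]) ->
  (exists D, scale_set D) \/
  exists2 e' : R, 0 < e' <= e & forall a x : R, 0 < a -> 0 < x -> x < e' -> ~ DA a x.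
Proof.
move=> e0 dDA inc cDA nDA; apply: contrapT => /not_orP[noD noe].
pose G (a x : R) := (1 <= a * x /\ x <= e / 2) /\ DA a x.
have dG : def RR (fun p : R * R => G p.1 p.2) by rewrite /G; dfn.
have Gb (a x : R) : 0 < a -> G a x -> 0 < x /\ x <= e / 2.
  move=> a0 [[h1 h2] _]; split=> //.
  by rewrite -(pmulr_rgt0 _ a0); lra.
have Gn (a u v : R) : 0 < a -> u < v -> exists x, [/\ u < x, x < v & ~ G a x].
  move=> a0 uv.
  have [h|h] := leP v 0.
    exists ((u + v) / 2); split; [lra|lra|].
    by move=> /(Gb _ _ a0)[]; lra.
  have [h'|h'] := leP (e / 2) u.
    exists ((u + v) / 2); split; [lra|lra|].
    by move=> /(Gb _ _ a0)[]; lra.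
  pose u' := Num.max u (Num.min v (e / 2) / 2).
  pose v' := Num.min v (e / 2).
  have v'0 : 0 < v' by rewrite lt_min h /=; lra.
  have u'v' : u' < v'.
    rewrite gt_max; apply/andP; split; first by rewrite lt_min uv h'.
    by rewrite -/v'; lra.
  have u'0 : 0 < u' by rewrite lt_max -/v'; apply/orP; right; lra.
  have v'e : v' < e by rewrite gt_min; apply/orP; right; lra.
  have [x [ux xv hx]] := nDA a u' v' a0 u'0 u'v' v'e.
  exists x; split; last by case.
    by apply: le_lt_trans ux; rewrite le_max lexx.
  by apply: lt_le_trans xv _; rewrite ge_min lexx.
have Gfin (a : R) : 0 < a -> finite_set [set x | G a x].
  move=> a0; apply: contrapT => inf; apply: noD.
  apply: (@scale_of_infinite [set x | G a x] 0 (e / 2)) => //.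
  - by change (def RR (fun x : R => G a x)); dfn.
  - have cD : clo (fun x => DA a x) by exact: cDA.
    by change (clo (fun x => (1 <= a * x /\ x <= e / 2) /\ DA a x)); solve_clo.
  - by move=> x /(Gb _ _ a0)[/ltW].
  - by move=> u v _ uv _; exact: Gn.
have Ginc (a b x : R) : 0 < a -> a <= b -> G a x -> G b x.
  move=> a0 ab Gx; have [x0 _] := Gb _ _ a0 Gx.
  case: Gx => [[h1 h2] h3]; split; last exact: inc h3.
  by split=> //; apply: le_trans h1 _; rewrite ler_pM2r.
have nd (u v : R) : u < v -> exists a b : R, [/\ u <= a, a < b, b <= v &
    forall s x : R, 0 < s -> G s x -> a < x -> x < b -> False].
  move=> uv; apply: contrapT => no.
  apply: (no_dense_finite_filtration hN dG Gfin Ginc uv).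
  move=> a b ua ab bv; apply: contrapT => no'; apply: no.
  exists a, b; split=> // s x s0 Gx ax xb; apply: no'.
  by exists s, x.
(* The closure of the union, in definable form. *)
pose Z (x : R) := forall r : R, 0 < r -> exists a y : R, 0 < a /\ G a y /\
  `|y - x| <= r.
have dZ : def RR Z by rewrite /Z; dfn.
apply: noD; apply: (@scale_of_gaps Z 0 (e / 2)) => //.
- move=> x hx r r0.
  have r2 : 0 < r / 2 by lra.
  have [y [Zy hy]] := hx _ (nbhsx_ballx x _ r2).
  have [a [z [a0 [Gz hz]]]] := Zy (r / 2) r2.
  exists a, z; split=> //; split=> //.
  have -> : z - x = (z - y) + (y - x) by ring.
  apply: le_trans (ler_normD _ _) _.
  by move: hy; rewrite /ball /= distrC => /ltW; lra.
- move=> x Zx; split; rewrite leNgt; apply/negP => hx.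
    have x2 : 0 < - x / 2 by lra.
    have [a [y [a0 [/(Gb _ _ a0)[y0 _]]]]] := Zx _ x2.
    by rewrite ler_norml => /andP[]; lra.
  have x2 : 0 < (x - e / 2) / 2 by lra.
  have [a [y [a0 [/(Gb _ _ a0)[_ y0]]]]] := Zx _ x2.
  by rewrite ler_norml => /andP[]; lra.
have pick d : 0 < d -> exists2 z, 0 < z < d & Z z.
  move=> d0; apply: contrapT => no; apply: noe.
  exists (Num.min d (e / 2)).
    rewrite lt_min d0 /= ge_min; apply/andP; split; first lra.
    by apply/orP; right; lra.
  move=> a x a0 x0; rewrite lt_min => /andP[xd xe] Dx; apply: no.
  exists x; first by rewrite x0.
  (* By monotonicity in [a], the condition [1 <= a * x] can be met by enlarging [a]. *)
  move=> r r0; exists (Num.max a x^-1), x.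
  have h : a <= Num.max a x^-1 by rewrite le_max lexx.
  split; first by rewrite lt_max a0.
  split; last by rewrite subrr normr0 ltW.
  split; last exact: inc Dx.
  split; last lra.
  by rewrite -(mulVf (lt0r_neq0 x0)) ler_pM2r// le_max lexx orbT.
move=> d d0; have [z' /andP[z'0 z'd] Zz'] := pick d d0.
have [z /andP[z0 zz'] Zz] := pick z' z'0.
have [a [b [za ab bz' hab]]] := nd z z' zz'.
exists z, ((a + b) / 2), z'; split=> //; last lra.
  move=> Zw; have ab2 : 0 < (b - a) / 4 by lra.
  have [s [x [s0 [Gx hx]]]] := Zw _ ab2.
  by move: hx; rewrite ler_norml => /andP[h1 h2]; apply: (hab s x) => //; lra.
by apply/andP; split; lra.
Qed.

End Scales.

(** * Closed definable selections *)

Section Selection.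
Variables (R : realType) (RR : expansion R).
Hypothesis hN : ~ defines_nat RR.

(** By Baire, [g] is bounded above on some nonempty open set [V]. Near a point where [g] almost
    reaches its supremum over [V], lower semicontinuity keeps all values above [sup - d / 2]. *)
Lemma lsc_small_osc (g : R -> R) (a b d : R) : a < b -> 0 < d ->
  (forall x l : R, a < x -> x < b -> l < g x -> \forall y \near x, l < g y) ->
  exists x, a < x /\ x < b /\ exists r : R, 0 < r /\
    forall y z : R, `|y - x| <= r -> `|z - x| <= r -> g y < g z + d.
Proof.
move=> ab d0 lsc.
pose a' := a + (b - a) / 3; pose b' := a + (b - a) / 3 * 2.
have a'b' : a' < b' by rewrite /a' /b'; lra.
have aa' : a < a' by rewrite /a'; lra.
have b'b : b' < b by rewrite /b'; lra.
(* The points where [g] exceeds [n], with the outside of [[a', b']] added so that Baire can be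
   applied on the line. *)
pose O (n : nat) : set R :=
  [set y | y < a'] `|` [set y | b' < y] `|` [set y | a < y /\ y < b /\ n%:R < g y].
have oO n : open (O n).
  apply: openU; first by apply: openU; [exact: open_lt|exact: open_gt].
  rewrite openE => y /= [ay [yb yn]]; rewrite /interior.
  have h1 : nbhs y [set z | a < z] by apply: open_nbhs_nbhs; split=> //; exact: open_gt.
  have h2 : nbhs y [set z | z < b] by apply: open_nbhs_nbhs; split=> //; exact: open_lt.
  move: h1 h2 (lsc y _ ay yb yn); apply: filterS3 => z az zb zn.
  by split.
have [n [V [[v Vv] [oV VO]]]] : exists n (V : set R), V !=set0 /\ open V /\
    forall y, V y -> ~ O n y.
  apply: contrapT => no.
  have dO n : dense (O n).
    move=> V V0 oV; apply: contrapT => h; apply: no; exists n, V.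
    by split=> //; split=> // y Vy Oy; apply: h; exists y.
  have ho : (`]a', b'[%classic : set R) !=set0.
    by exists ((a' + b') / 2); rewrite /= in_itv /=; apply/andP; split; lra.
  have oab : open (`]a', b'[%classic : set R) by exact: interval_open.
  have [y [/= yab hy]] := Baire (fun n => conj (oO n) (dO n)) ho oab.
  move: yab; rewrite in_itv /= => /andP[y1 y2].
  have := hy (Num.truncn `|g y|).+1 I; case=> [[/=|/=]|[_ [_]]]; [lra|lra|].
  have /andP[_ h] := truncn_itv (normr_ge0 (g y)).
  by have := ler_norm (g y); lra.
have Vab y : V y -> a' <= y /\ y <= b' /\ g y <= n%:R.
  move=> Vy; have h := VO y Vy.
  have y1 : a' <= y by rewrite leNgt; apply/negP => hy; apply: h; left; left.
  have y2 : y <= b' by rewrite leNgt; apply/negP => hy; apply: h; left; right.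
  split=> //; split=> //; rewrite leNgt; apply/negP => hy; apply: h; right.
  by split; [lra|split=> //; lra].
pose S := [set g y | y in V].
have supS : has_sup S.
  by split; [exists (g v), v|exists n%:R => _ [y /Vab[_ [_ h]] <-]].
have [|_ [x Vx <-] hx] := @sup_adherent _ S (d / 2) _ supS; first by lra.
have [x1 [x2 _]] := Vab x Vx.
have h1 := lsc x _ (lt_le_trans aa' x1) (le_lt_trans x2 b'b) hx.
have h2 : nbhs x V by apply: open_nbhs_nbhs.
have /nbhs_ballP[r /= r0 hr] : nbhs x (V `&` [set y | sup S - d / 2 < g y]).
  exact: filterI.
exists x; split; first lra.
split; first lra.
exists (r / 2); split; first lra.
have B y : `|y - x| <= r / 2 -> ball x r y by rewrite /ball /= distrC; lra.
move=> y z /B/hr[Vy _] /B/hr[_ /= hz].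
have : g y <= sup S by apply: ub_le_sup; [case: supS|exists y].
by lra.
Qed.

Definition coercive p (h : 'rV[R]_p -> R) :=
  exists B : R, forall (x : 'rV[R]_p) l, `|x 0 l| <= h x + B.

(** Closed over [0 < s < e] only: nothing is required in the limit [s = 0], which is where these
    families degenerate. *)
Definition relclosed p (e : R) (X : R -> 'rV[R]_p -> Prop) :=
  forall s x, 0 < s -> s < e ->
    closure [set q : R * 'rV[R]_p | X q.1 q.2] (s, x) -> X s x.

(** Prevents [x] from escaping to infinity as [s] varies, so that quantifying over [x] preserves
    closedness. *)
Definition locbdd p (e : R) (X : R -> 'rV[R]_p -> Prop) :=
  forall s : R, 0 < s -> s < e -> exists B : R, exists r : R, 0 < r /\
    forall (t : R) x, `|t - s| <= r -> 0 < t -> t < e -> X t x ->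
      forall l, `|x 0 l| <= B.

Definition fibers_ok p (X : R -> 'rV[R]_p -> Prop) :=
  forall s : R, 0 < s -> s < 1 -> closed [set x | X s x] /\ exists x, X s x.

Definition argmin p (h : 'rV[R]_p -> R) (X : R -> 'rV[R]_p -> Prop) s x :=
  X s x /\ forall x', X s x' -> h x <= h x'.

Section Refine.
Variables (p : nat) (X : R -> 'rV[R]_p -> Prop) (h : 'rV[R]_p -> R).
Hypothesis dX : def RR (fun q : R * 'rV[R]_p => X q.1 q.2).
Hypothesis dh : dmap RR h.
Hypothesis ch : continuous h.
Hypothesis coh : coercive h.
Hypothesis fX : fibers_ok X.

Lemma def_argmin : def RR (fun q : R * 'rV[R]_p => argmin h X q.1 q.2).
Proof.
by rewrite /argmin; dfn.
Qed.

Lemma argmin_ex s : 0 < s -> s < 1 -> exists x, argmin h X s x.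
Proof.
move=> s0 s1; have [cX [x0 Xx0]] := fX s0 s1; have [B hB] := coh.
pose b := h x0 + B.
pose A := [set x | X s x] `&` [set x | forall i, - b <= x 0 i /\ x 0 i <= b].
have cA : compact A.
  by rewrite /A setIC; apply: compact_closedI; [exact: cube_compact|exact: cX].
have A0 : A !=set0.
  by exists x0; split=> // i; have := hB x0 i; rewrite ler_norml => /andP.
have [x /set_mem[Xx _] hx] := compact_EVT_min A0 cA (continuous_subspaceT ch).
exists x; split=> // x' Xx'; have [|hlt] := leP (h x') (h x0); last first.
  apply: le_trans (ltW hlt); apply: hx; apply/mem_set; split=> // i.
  by have := hB x0 i; rewrite ler_norml => /andP.
move=> hle; apply: hx; apply/mem_set; split=> // i.
have := hB x' i => hi; apply/andP; rewrite -ler_norml.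
by apply: le_trans hi _; rewrite lerD2r.
Qed.

Lemma fibers_argmin : fibers_ok (argmin h X).
Proof.
move=> s s0 s1; split; last exact: argmin_ex.
have [cX _] := fX s0 s1.
have c1 : clo (fun x => X s x) by exact: cX.
by change (clo (fun x => X s x /\ forall x', X s x' -> h x <= h x')); solve_clo.
Qed.

(** The minimum [g s] is lower semicontinuous because [X] is closed and [h] coercive. The scales
    where [g] oscillates by at least [1 / a] form a closed set without interior; unless there is a
    scale set, all of them disappear below some [e']. There [g] is continuous, so limits of
    minimizers are minimizers, and coercivity bounds the minimizers locally. *)
Lemma refine_closed (e : R) : 0 < e -> e <= 1 -> relclosed e X ->
  (exists D, scale_set RR D) \/ exists e' : R, 0 < e' /\ e' <= e /\
    relclosed e' (argmin h X) /\ locbdd e' (argmin h X).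
Proof.
move=> e0 e1 rX; have [B hB] := coh.
have /choice[xs hxs] : forall s : R, exists x, 0 < s -> s < 1 -> argmin h X s x.
  move=> s; have [[s0 s1]|ns] := pselect (0 < s /\ s < 1).
    by have [x] := argmin_ex s0 s1; exists x.
  by exists 0 => s0 s1; exfalso; apply: ns.
pose g s := h (xs s).
have gE s x : 0 < s -> s < 1 -> argmin h X s x -> h x = g s.
  move=> s0 s1 [Xx hx]; have [Xg hg] := hxs s s0 s1.
  by apply/eqP; rewrite eq_le hx//= hg.
have lsc (s l : R) : 0 < s -> s < e -> l < g s -> \forall t \near s, l < g t.
  move=> s0 se ls.
  pose b := l + B.
  pose K := [set x : 'rV[R]_p | forall i, - b <= x 0 i /\ x 0 i <= b].
  have : \forall t \near s, forall x, K x -> ~ (X t x /\ h x <= l).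
    apply: (tube (P := fun q : R * 'rV[R]_p => ~ (X q.1 q.2 /\ h q.2 <= l))
      (@cube_compact R p (- b) b)) => x _.
    have [Xsx|nX] := pselect (X s x).
      have hx : l < h x.
        have [Xg hg] := hxs s s0 (lt_le_trans se e1).
        by apply: lt_le_trans ls _; exact: hg.
      have hs2 : continuous (fun q : R * 'rV[R]_p => h q.2).
        by apply: (ct_comp ch); apply: ct_snd; exact: ct_id.
      have : nbhs (s, x) [set q : R * 'rV[R]_p | l < h q.2].
        apply: (hs2 (s, x) [set y | l < y]).
        by apply: open_nbhs_nbhs; split=> //; exact: open_gt.
      by apply: filterS => q /= lq [_]; rewrite leNgt lq.
    have nc : ~ closure [set q : R * 'rV[R]_p | X q.1 q.2] (s, x).
      by move=> /(rX s x s0 se).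
    have oC : open (~` closure [set q : R * 'rV[R]_p | X q.1 q.2]).
      by apply: closed_openC; exact: closed_closure.
    have : nbhs (s, x) (~` closure [set q : R * 'rV[R]_p | X q.1 q.2]).
      exact: open_nbhs_nbhs.
    by apply: filterS => q nq [Xq _]; apply: nq; exact: subset_closure.
  have h1 : nbhs s [set t : R | 0 < t] by apply: open_nbhs_nbhs; split=> //; exact: open_gt.
  have h2 : nbhs s [set t : R | t < 1].
    by apply: open_nbhs_nbhs; split; [exact: open_lt|exact: lt_le_trans e1].
  move: h1 h2; apply: filterS3 => t t0 t1 ht.
  rewrite ltNge; apply/negP => gl.
  have [Xg _] := hxs t t0 t1.
  apply: (ht (xs t)); last by split.
  move=> i; apply/andP; rewrite -ler_norml.
  by apply: le_trans (hB _ _) _; rewrite lerD2r.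
(* Oscillation is expressed by minimizers instead of [g], so that it is definable along with
   [argmin]. *)
pose DA (a s : R) := forall r : R, 0 < r -> exists q : (R * 'rV[R]_p) * (R * 'rV[R]_p),
  (`|q.1.1 - s| <= r /\ `|q.2.1 - s| <= r) /\ (0 < q.1.1 /\ q.1.1 < e) /\
  (0 < q.2.1 /\ q.2.1 < e) /\ argmin h X q.1.1 q.1.2 /\ argmin h X q.2.1 q.2.2 /\
  1 <= a * (h q.1.2 - h q.2.2).
have dDA : def RR (fun q : R * R => DA q.1 q.2).
  have da := def_argmin.
  by rewrite /DA; dfn.
have DAg (a s : R) : 0 < a -> DA a s -> forall r : R, 0 < r ->
    exists t u : R, [/\ `|t - s| <= r, `|u - s| <= r, 0 < t < e, 0 < u < e &
      g u + a^-1 <= g t].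
  move=> a0 + r r0; move=> /(_ r r0)[[[t x] [u y]] /= [[h1 h2] [[h3 h4] [[h5 h6] [m1 [m2 h7]]]]]].
  exists t, u; split; rewrite ?h3 ?h5//.
  rewrite -(gE _ _ h3 _ m1) ?(lt_le_trans h4)// -(gE _ _ h5 _ m2) ?(lt_le_trans h6)//.
  rewrite addrC -lerBrDr -(ler_pM2l a0) mulfV ?gt_eqF//.
case: (@eventually_none R RR hN DA e e0 dDA) => [||||[e' /andP[e'0 e'e] hDA]].
- move=> a b s a0 ab hs r r0; have [q [h1 [h2 [h3 [h4 [h5 h6]]]]]] := hs r r0.
  have d0 : 0 < h q.1.2 - h q.2.2 by rewrite -(pmulr_rgt0 _ a0); lra.
  exists q; do 5 (split=> //); apply: le_trans h6 _.
  by rewrite ler_pM2r.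
- move=> a a0 s hs r r0; have r2 : 0 < r / 2 by lra.
  have [t [ht bt]] := hs _ (nbhsx_ballx s _ r2).
  have [q [[h1 h2] hq]] := ht (r / 2) r2; exists q; split=> //.
  have tri (w : R) : `|w - t| <= r / 2 -> `|w - s| <= r.
    move=> hw; have -> : w - s = (w - t) + (t - s) by ring.
    apply: le_trans (ler_normD _ _) _.
    by move: bt; rewrite /ball /= distrC; lra.
  by split; exact: tri.
- move=> a u v a0 u0 uv ve.
  have ai : 0 < a^-1 by rewrite invr_gt0.
  have [|x [ux [xv [r [r0 hr]]]]] := @lsc_small_osc g u v a^-1 uv ai.
    by move=> x l ux xv; apply: lsc; lra.
  exists x; split=> // hx.
  have [t [w [h1 h2 _ _ h3]]] := DAg a x a0 hx r r0.
  by have := hr t w h1 h2; lra.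
- by left.
right; exists e'; split=> //; split=> //.
(* Absence of oscillation yields upper semicontinuity of [g]. *)
have low (a s : R) : 0 < a -> 0 < s -> s < e' -> exists r : R, 0 < r /\
    forall t : R, `|t - s| <= r -> 0 < t -> t < e -> g t < g s + a^-1.
  move=> a0 s0 se; apply: contrapT => no; apply: (hDA a s a0 s0 se) => r r0.
  apply: contrapT => no'; apply: no; exists r; split=> // t tr t0 te.
  rewrite ltNge; apply/negP => hge; apply: no'.
  have se' : s < e by lra.
  exists ((t, xs t), (s, xs s)) => /=.
  split; first by rewrite subrr normr0 tr ltW.
  do 2 (split=> //).
  have m1 := hxs t t0 (lt_le_trans te e1).
  have m2 := hxs s s0 (lt_le_trans se' e1).
  do 2 (split=> //).
  by rewrite -(mulfV (lt0r_neq0 a0)) ler_pM2l// -/(g t) -/(g s); lra.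
split.
  move=> s x s0 se' hcl.
  have se : s < e by lra.
  have Xsx : X s x.
    apply: (rX s x s0 se); apply: closure_subset hcl => q.
    by case.
  split=> // x' Xx'; rewrite leNgt; apply/negP => hlt.
  have s1 : s < 1 by lra.
  have gx' : g s <= h x' by have [_ hg] := hxs s s0 s1; exact: hg.
  pose d := h x - g s; have d0 : 0 < d by rewrite /d; lra.
  have a0 : 0 < 2 / d by rewrite divr_gt0.
  have [r [r0 hr]] := low (2 / d) s a0 s0 se'.
  have hs2 : continuous (fun q : R * 'rV[R]_p => h q.2).
    by apply: (ct_comp ch); apply: ct_snd; exact: ct_id.
  have hs1 : continuous (fun q : R * 'rV[R]_p => q.1).
    by apply: ct_fst; exact: ct_id.
  have n1 : nbhs (s, x) [set q : R * 'rV[R]_p | h x - d / 2 < h q.2].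
    apply: (hs2 (s, x) [set y | h x - d / 2 < y]).
    by apply: open_nbhs_nbhs; split; [exact: open_gt|rewrite /=; lra].
  have n2 : nbhs (s, x) [set q : R * 'rV[R]_p | ball s (Num.min r (Num.min s (e - s))) q.1].
    apply: (hs1 (s, x) (ball s _)); apply: nbhsx_ballx.
    by rewrite !lt_min r0 s0 /=; lra.
  have [[t y] [/= mty [hy bt]]] := hcl _ (filterI n1 n2).
  rewrite /= in hy bt.
  move: bt; rewrite /ball /= distrC !lt_min => /and3P[b1 b2 b3].
  have t0 : 0 < t by move: b2; rewrite ltr_norml => /andP[]; lra.
  have te : t < e by move: b3; rewrite ltr_norml => /andP[]; lra.
  have := hr t (ltW b1) t0 te.
  rewrite -(gE t y t0 (lt_le_trans te e1) mty) invf_div.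
  by move: hy; rewrite /d; lra.
move=> s s0 se'; have [r [r0 hr]] := low 1 s ltr01 s0 se'.
exists (g s + 1 + B), r; split=> // t x tr t0 te' mtx l.
have te : t < e by lra.
have := hr t tr t0 te; rewrite invr1 -(gE t x t0 (lt_le_trans te e1) mtx).
by have := hB x l; lra.
Qed.

End Refine.
End Selection.

(** * Thin families *)

Section ThinFamilies.
Variables (R : realType) (RR : expansion R).
Hypothesis hN : ~ defines_nat RR.

Section Iterate.
Variable p : nat.

(* Minimizing these coercive functions in turn isolates one point: on a set
   where [probe p] is constant, [probe i] differs from the [i]-th coordinate
   by a constant. *)
Definition probe (i : nat) (x : 'rV[R]_p) : R :=
  \sum_l x 0 l ^+ 2 + (if insub i is Some l then x 0 l else 0).

Lemma def_probe i : dmap RR (probe i).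
Proof. by rewrite /probe; case: insub => [l|]; dfn. Qed.

Lemma continuous_probe i : continuous (probe i).
Proof. by rewrite /probe; case: insub => [l|]; repeat ct_step. Qed.

Lemma coercive_probe i : coercive (probe i).
Proof.
exists 1 => x l.
have sq k : x 0 k ^+ 2 <= \sum_l x 0 l ^+ 2.
  by rewrite (bigD1 k)//= lerDl sumr_ge0// => j _; exact: sqr_ge0.
have h1 := sq l; have n1 := normr_ge0 (x 0 l).
have e1 : `|x 0 l| ^+ 2 = x 0 l ^+ 2 by rewrite real_normK// num_real.
rewrite /probe; case: insub => [k|]; last by nra.
have h2 := sq k; have n2 := normr_ge0 (x 0 k).
have e2 : `|x 0 k| ^+ 2 = x 0 k ^+ 2 by rewrite real_normK// num_real.
have h3 : - `|x 0 k| <= x 0 k by rewrite lerNl; have := ler_norm (- x 0 k); rewrite normrN.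
have : 0 <= (`|x 0 l| - 1) ^+ 2 + (`|x 0 k| - 1) ^+ 2 by rewrite addr_ge0 ?sqr_ge0.
by rewrite !sqrrB1 e1 e2; lra.
Qed.

(** Each round makes one more probe constant on the fibers, preserves the earlier ones and shrinks
    [e] at most. Local boundedness results from minimizing, hence is claimed for [0 < k] only. *)
Lemma selection (X : R -> 'rV[R]_p -> Prop) :
  def RR (fun q : R * 'rV[R]_p => X q.1 q.2) -> fibers_ok X -> relclosed 1 X ->
  exists Y : R -> 'rV[R]_p -> Prop,
    [/\ def RR (fun q : R * 'rV[R]_p => Y q.1 q.2),
        forall s x, Y s x -> X s x,
        forall s : R, 0 < s -> s < 1 -> exists x, Y s x,
        forall (s : R) x y, Y s x -> Y s y -> x = y &
        (exists D, scale_set RR D) \/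
        exists e : R, [/\ 0 < e, e <= 1, relclosed e Y & locbdd e Y]].
Proof.
move=> dX fX rX.
have : forall k, exists Y : R -> 'rV[R]_p -> Prop,
    [/\ def RR (fun q : R * 'rV[R]_p => Y q.1 q.2),
        forall s x, Y s x -> X s x, fibers_ok Y,
        forall i, (i < k)%N -> forall (s : R) x y, Y s x -> Y s y ->
          probe i x = probe i y &
        (exists D, scale_set RR D) \/
        exists e : R, [/\ 0 < e, e <= 1, relclosed e Y & (0 < k)%N -> locbdd e Y]].
  elim=> [|k [Y [dY YX fY cY st]]].
    by exists X; split=> //; right; exists 1; split.
  exists (argmin (probe k) Y); split.
  - exact: def_argmin (def_probe k).
  - by move=> s x [/YX].
  - by apply: fibers_argmin => //; [exact: continuous_probe|exact: coercive_probe].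
  - move=> i; rewrite ltnS leq_eqVlt => /orP[/eqP -> s x y [Yx hx] [Yy hy]|ik s x y [Yx _] [Yy _]].
      by apply/eqP; rewrite eq_le hx// hy.
    exact: (cY i ik s).
  case: st => [?|[e [e0 e1 rY _]]]; first by left.
  have [hD|[e' [e'0 [e'e [r b]]]]] := refine_closed hN dY (def_probe k)
    (@continuous_probe k) (@coercive_probe k) fY e0 e1 rY; first by left.
  by right; exists e'; split=> //; exact: le_trans e1.
move=> /(_ p.+1)[Y [dY YX fY cY st]].
exists Y; split=> //.
- by move=> s s0 s1; have [] := fY s s0 s1.
- move=> s x y Yx Yy; apply/rowP => l.
  have := cY l (ltnW (ltn_ord l)) s x y Yx Yy.
  have := cY p (ltnSn p) s x y Yx Yy.
  (* [p] is out of range for [insub], so [probe p] is the plain sum of squares, and removing it from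
     [probe l] leaves the coordinate [l]. *)
  rewrite /probe valK insubF ?ltnn// !addr0 => ->.
  by move/addrI.
by case: st => [?|[e [e0 e1 r b]]]; [left|right; exists e; split=> //; exact: b].
Qed.

End Iterate.

(** * Dense families without long intervals *)

Section Thin.
Variables (T : R -> R -> Prop) (u v : R).
Hypothesis uv : u < v.
Hypothesis dT : def RR (fun q : R * R => T q.1 q.2).
Hypothesis cT : forall s : R, 0 < s -> s < 1 -> closed [set t | T s t].
Hypothesis denseT : forall s t : R, 0 < s -> s < 1 -> u <= t -> t <= v ->
  exists t' r : R, [/\ `|t - t'| <= s, 0 < r & forall z : R, `|z - t'| <= r -> T s z].
Hypothesis thinT : forall s t : R, 0 < s -> s < 1 -> u <= t -> t + s <= v ->
  exists z : R, [/\ t <= z, z <= t + s & ~ T s z].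
Hypothesis stT : (exists D, scale_set RR D) \/
  exists e : R, [/\ 0 < e, e <= 1 &
    forall s t, 0 < s -> s < e ->
      closure [set q : R * R | T q.1 q.2] (s, t) -> T s t].

(** By Baire, some point [y] lies in [T s] for arbitrarily small [s] and is missed by [T s] for
    arbitrarily small [s]. The scales [s] with [y] in [T s] then have arbitrarily short gaps. *)
Lemma thin_scale : exists D, scale_set RR D.
Proof.
have huv : u < v by [].
case: stT => [//|[e [e0 e1 rT]]].
have [E e_lt small] : exists2 E : nat -> R,
    forall n, [/\ 0 < E n, E n < e & E n <= e / 2] &
    forall d : R, 0 < d -> exists n, E n < d.
  exists (fun n => e / n.+2%:R) => [n|d d0].
    split; first by rewrite divr_gt0.
      by rewrite gtr_pMr// invf_lt1// ltr1n.
    by rewrite ler_pM2l// lef_pV2 ?posrE// ler_nat.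
  exists (Num.truncn (e / d)).
  have ed : 0 <= e / d by rewrite divr_ge0// ltW.
  have /andP[_ h] := truncn_itv ed.
  rewrite ltr_pdivrMr// mulrC -ltr_pdivrMr//.
  by apply: lt_trans h _; rewrite ltr_nat.
(* [W n] collects the points interior to some [T s] with [s < E n], and [N n] those missed by some
   such [T s]. Both are open; with the outside of [[u, v]] added, they are dense in the line. *)
pose W (n : nat) : set R := [set y : R | exists s r : R, 0 < s /\ s < E n /\
  0 < r /\ forall z : R, `|z - y| <= r -> T s z].
pose N (n : nat) : set R := [set y : R | exists s : R, 0 < s /\ s < E n /\ ~ T s y].
pose uvC : set R := [set y : R | y < u] `|` [set y : R | v < y].
have oC : open uvC by apply: openU; [exact: open_lt|exact: open_gt].
have oW n : open (W n `|` uvC).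
  apply: openU => //; rewrite openE => y [s [r [s0 [sn [r0 h]]]]].
  apply/nbhs_ballP; exists (r / 2) => /=; first lra.
  move=> z; rewrite /ball /= => yz; exists s, (r / 2); split=> //; split=> //.
  split; first lra.
  move=> w wz; apply: h; have -> : w - y = (w - z) - (y - z) by ring.
  by apply: le_trans (ler_normB _ _) _; lra.
have oN n : open (N n `|` uvC).
  apply: openU => //; rewrite openE => y [s [s0 [sn nT]]].
  have s1 : s < 1 by have [_ h _] := e_lt n; exact: lt_le_trans (lt_trans sn h) e1.
  have : nbhs y (~` [set t | T s t]).
    by apply: open_nbhs_nbhs; split=> //; exact: closed_openC (cT s0 s1).
  by apply: filterS => z nTz; exists s.
have sub (O : set R) : O !=set0 -> open O ->
    (exists x, (O `&` uvC) x) \/ exists a b : R, [/\ u <= a, a < b, b <= v &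
      forall x, a < x -> x < b -> O x].
  move=> [x Ox] oO.
  have [xu|ux] := ltP x u; first by left; exists x; split=> //; left.
  have [xv|vx] := ltP v x; first by left; exists x; split=> //; right.
  right; have /nbhs_ballP[r /= r0 hr] : nbhs x O by apply: open_nbhs_nbhs.
  exists (Num.max u (x - r)), (Num.min v (x + r)); split.
  - by rewrite le_max lexx.
  - by rewrite gt_max !lt_min uv /=; apply/andP; split; [lra|apply/andP; split; lra].
  - by rewrite ge_min lexx.
  move=> y; rewrite gt_max lt_min => /andP[_ h1] /andP[_ h2].
  by apply: hr; rewrite /ball /= ltr_norml; apply/andP; split; lra.
have dW n : dense (W n `|` uvC).
  move=> O O0 oO; case: (sub O O0 oO) => [[x [Ox ux]]|[a [b [ua ab bv hab]]]].
    by exists x; split=> //; right.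
  have [n0 n1 _] := e_lt n.
  pose s := Num.min ((b - a) / 4) (E n / 2).
  have s0 : 0 < s by rewrite lt_min; apply/andP; split; lra.
  have s1 : s <= E n / 2 by rewrite ge_min lexx orbT.
  have s2 : s <= (b - a) / 4 by rewrite ge_min lexx.
  have [||||t' [r [h1 r0 h2]]] := denseT (s := s) (t := (a + b) / 2); try lra.
  exists t'; split.
    by move: h1; rewrite ler_norml => /andP[h3 h4]; apply: hab; lra.
  by left; exists s, r; split=> //; split; first lra.
have dN n : dense (N n `|` uvC).
  move=> O O0 oO; case: (sub O O0 oO) => [[x [Ox ux]]|[a [b [ua ab bv hab]]]].
    by exists x; split=> //; right.
  have [n0 n1 _] := e_lt n.
  pose s := Num.min ((b - a) / 4) (E n / 2).
  have s0 : 0 < s by rewrite lt_min; apply/andP; split; lra.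
  have s1 : s <= E n / 2 by rewrite ge_min lexx orbT.
  have s2 : s <= (b - a) / 4 by rewrite ge_min lexx.
  have [||||z [h1 h2 nT]] := thinT (s := s) (t := (a + b) / 2); try lra.
  exists z; split; first by apply: hab; lra.
  by left; exists s; split=> //; split; first lra.
pose O n := if odd n then W n./2 `|` uvC else N n./2 `|` uvC.
have hO n : open (O n) /\ dense (O n) by rewrite /O; case: (odd n); split.
have ouv : open (`]u, v[%classic : set R) by exact: interval_open.
have ouv0 : (`]u, v[%classic : set R) !=set0.
  have h1 : u < (u + v) / 2 by lra.
  have h2 : (u + v) / 2 < v by lra.
  by exists ((u + v) / 2); rewrite /= in_itv /= h1.
have [y [/= yuv hy]] := Baire hO ouv0 ouv.
move: yuv; rewrite in_itv /= => /andP[uy yv].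
have hW n : exists s : R, 0 < s /\ s < E n /\ T s y.
  have := hy n.*2.+1 I; rewrite /O /= odd_double /= uphalf_double.
  case=> [[s [r [s0 [sn [r0 h]]]]]|[/=|/=]]; [|lra|lra].
  by exists s; split=> //; split=> //; apply: h; rewrite subrr normr0 ltW.
have hNn n : exists s : R, 0 < s /\ s < E n /\ ~ T s y.
  have := hy n.*2 I; rewrite /O odd_double doubleK.
  by case=> [//|[/=|/=]]; lra.
(* The limit [0] is adjoined and the scales are cut at [e / 2], since [T] is known to be closed only
   over [0 < s < e]. *)
pose Z : set R := [set s | s = 0 \/ ((0 <= s /\ s <= e / 2) /\ (T s y /\ s <> 0))].
apply: (@scale_of_gaps R RR Z 0 (e / 2)).
- change (def RR (fun s : R => s = 0 \/ ((0 <= s /\ s <= e / 2) /\ (T s y /\ s <> 0)))).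
  by dfn.
- move=> s cZ.
  have s0 : 0 <= s.
    rewrite leNgt; apply/negP => sn.
    have s1 : 0 < - s by lra.
    have [t [[->|[[t0 _] _]]]] := cZ _ (nbhsx_ballx s _ s1).
      by rewrite /ball /= subr0 ltr0_norm ?ltxx//; lra.
    by rewrite /ball /= ltr_norml => /andP[]; lra.
  have [->|sn0] := eqVneq s 0; first by left.
  have sp : 0 < s by rewrite lt_neqAle eq_sym sn0.
  have se : s <= e / 2.
    rewrite leNgt; apply/negP => sn.
    have s1 : 0 < s - e / 2 by lra.
    have [t [[->|[[_ t0] _]]]] := cZ _ (nbhsx_ballx s _ s1).
      by rewrite /ball /= subr0 ger0_norm//; lra.
    by rewrite /ball /= ltr_norml => /andP[]; lra.
  right; split=> //; split; last exact/eqP.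
  apply: rT => //; first lra.
  move=> B [[B1 B2] [/= hB1 hB2] sB].
  have h1 : nbhs s [set t : R | 0 < t] by apply: open_nbhs_nbhs; split=> //; exact: open_gt.
  have [t [[t0|[_ [Tt _]]] [B1t]]] := cZ _ (filterI hB1 h1).
    by rewrite /= t0 ltxx.
  move=> _; exists (t, y); split=> //; apply: sB; split=> //=.
  exact: nbhs_singleton hB2.
- by move=> s [->|[//]]; split; lra.
move=> d d0.
have pickT (c : R) : 0 < c -> exists s : R, [/\ 0 < s, s < c & Z s].
  move=> c0; have [n hn] := small _ c0; have [s [s0 [sn Ts]]] := hW n.
  have [_ h h'] := e_lt n.
  exists s; split=> //; first lra.
  right; split; first by split; lra.
  by split=> // s00; rewrite s00 ltxx in s0.
have pickN (c : R) : 0 < c -> exists s : R, [/\ 0 < s, s < c & ~ Z s].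
  move=> c0; have [n hn] := small _ c0; have [s [s0 [sn Ts]]] := hNn n.
  exists s; split=> //; first lra.
  by case=> [s00|[_ [//]]]; rewrite s00 ltxx in s0.
have [z' [z'0 z'd Zz']] := pickT d d0.
have [w [w0 wz' nZ]] := pickN z' z'0.
have [z [z0 zw Zz]] := pickT w w0.
by exists z, w, z'; split=> //; [rewrite zw|lra].
Qed.

(** A scale set [D] makes the forbidden filtration explicit: [G a] consists of the points of [T s],
    for [s >= 1 / a] in [D], followed by a gap of length at least [1 / a]. Few scales occur, and for
    each the points are [1 / a]-separated, so [G a] is finite. The union is dense, as near any place
    [T s] has both points and missing points at distance of order [s]. *)
Lemma thin_false : False.
Proof.
have huv : u < v by [].
have [D [dD D0 fD sD]] := thin_scale.
pose G (a t : R) := (u <= t /\ t <= v) /\ exists s : R,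
  (D s /\ (1 <= a * s /\ s < 1)) /\
  T s t /\ forall z : R, t < z -> a * (z - t) < 1 -> ~ T s z.
have dD' : def RR (fun s : R => D s) by exact: dD.
have dG : def RR (fun q : R * R => G q.1 q.2) by rewrite /G; dfn.
apply: (no_dense_finite_filtration hN dG _ _ uv).
- move=> a a0.
  have ai : 0 < a^-1 by rewrite invr_gt0.
  apply: (@sub_finite_set _ _ (\bigcup_(s in [set s | D s /\ a^-1 <= s])
    [set t | (u <= t /\ t <= v) /\ (T s t /\ forall z : R, t < z -> a * (z - t) < 1 -> ~ T s z)])).
    move=> t [tuv [s [[Ds [h1 h2]] h3]]]; exists s; last by split.
    by split=> //; rewrite -(ler_pM2l a0) mulfV// gt_eqF.
  apply: bigcup_finite; first exact: fD.
  move=> s _; apply: (@separated_finite R _ u v a^-1) => //.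
    by move=> t [].
  move=> t z [_ [_ ht]] [_ [Tz _]] tz; rewrite leNgt; apply/negP => h.
  by apply: (ht z tz) => //; rewrite -ltr_pdivlMl// mulr1.
- move=> a b t a0 ab [tuv [s [[Ds [h1 h2]] [h3 h4]]]]; split=> //.
  have s0 := D0 s Ds.
  exists s; split; first (split=> //; split=> //).
    by apply: le_trans h1 _; rewrite ler_pM2r.
  split=> // z tz hz; apply: h4 => //; apply: le_lt_trans hz.
  by rewrite ler_pM2r// subr_gt0.
move=> a b ua ab bv.
pose d := Num.min 1 ((b - a) / 8).
have d0 : 0 < d by rewrite lt_min ltr01 /=; lra.
have d1 : d <= 1 by rewrite ge_min lexx.
have d2 : d <= (b - a) / 8 by rewrite ge_min lexx orbT.
have [s [Ds sd]] := sD d d0.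
have s0 := D0 s Ds.
have s1 : s < 1 by lra.
have [||t' [r [h1 r0 h2]]] := denseT (s := s) (t := (a + b) / 2) s0 s1; [lra|lra|].
move: h1; rewrite ler_norml => /andP[h3 h4].
have [||w [w1 w2 nTw]] := thinT (s := s) (t := t') s0 s1; [lra|lra|].
have Tt' : T s t' by apply: h2; rewrite subrr normr0 ltW.
have t'w : t' < w by rewrite lt_neqAle w1 andbT; apply/eqP => e; rewrite e in Tt'.
have [||z' [r' [h1' r'0 h2']]] := denseT (s := s) (t := t' + 3 * s) s0 s1; [lra|lra|].
move: h1'; rewrite ler_norml => /andP[h3' h4'].
have Tz' : T s z' by apply: h2'; rewrite subrr normr0 ltW.
have wz' : w < z' by lra.
have [x [y [Tx Ty /andP[x1 x2] /andP[y1 y2] hxy]]] :=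
  closed_gap (cT s0 s1) Tt' Tz' nTw t'w wz'.
(* Large enough for both the scale [s] and the gap that follows [x]. *)
pose A := Num.max s^-1 (y - x)^-1.
have yx : 0 < y - x by lra.
have A0 : 0 < A by rewrite lt_max invr_gt0 s0.
exists A, x; split=> //; [|lra|lra].
split; first by split; lra.
exists s; split; first (split=> //; split=> //).
  by rewrite -(mulVf (lt0r_neq0 s0)) ler_pM2r// le_max lexx.
split=> // z xz hz; apply: hxy => //.
have : (y - x)^-1 * (z - x) < 1.
  apply: le_lt_trans hz; rewrite ler_pM2r ?subr_gt0//.
  by rewrite le_max lexx orbT.
by rewrite ltr_pdivrMl// mulr1; lra.
Qed.

End Thin.
End ThinFamilies.

(** * Left endpoints *)

Section LeftEnds.
Variables (R : realType) (RR : expansion R).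
Hypothesis hN : ~ defines_nat RR.
Variables (m : nat) (U : 'rV[R]_m -> R -> Prop).
Hypothesis dU : def RR (fun q : 'rV[R]_m * R => U q.1 q.2).
Hypothesis cU : closed [set q : 'rV[R]_m * R | U q.1 q.2].
Hypothesis U01 : forall x (y : R), U x y -> 0 <= y /\ y <= 1.

(** The left end of a gap of [U x], not of a component. *)
Definition leftend x (u : R) :=
  U x u /\ exists g : R, 0 < g /\ forall w : R, u < w -> w < u + g -> ~ U x w.

Lemma cloU (T : topologicalType) (f : T -> 'rV[R]_m) (g : T -> R) :
  continuous f -> continuous g -> clo (fun q => U (f q) (g q)).
Proof.
move=> hf hg.
apply: (clo_comp (Q := fun q : 'rV[R]_m * R => U q.1 q.2) (f := fun q => (f q, g q))) => //.
exact: ct_pair.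
Qed.

Lemma dist_le1 (x y : R) :
  0 <= x -> x <= 1 -> 0 <= y -> y <= 1 -> `|x - y| <= 1.
Proof. by move=> x0 x1 y0 y1; rewrite ler_norml; apply/andP; split; lra. Qed.

Lemma eventually_ord n (Q : 'I_n -> R -> Prop) :
  (forall j, exists b0 : R, forall b, b0 <= b -> Q j b) ->
  exists b0 : R, forall b, b0 <= b -> forall j, Q j b.
Proof.
elim: n Q => [|n IH] Q h; first by exists 0 => b _ [].
have [b0 h0] := h ord0; have [b1 h1] := IH _ (fun j => h (lift ord0 j)).
exists (Num.max b0 b1) => b; rewrite ge_max => /andP[hb0 hb1] j.
by case: (unliftP ord0 j) => [i ->|->]; [exact: h1|exact: h0].
Qed.

(** By compactness, a closed interval missed by [U x] keeps a positive distance from the whole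
    closed set [U], parameters included. *)
Lemma far_from_compact x (w1 w2 : R) : (forall w, w1 <= w -> w <= w2 -> ~ U x w) ->
  exists e0 : R, forall e : R, e0 <= e -> forall w, w1 <= w -> w <= w2 ->
    forall x' w', U x' w' -> 1 <= e * `|w - w'| \/ exists j, 1 <= e * `|x 0 j - x' 0 j|.
Proof.
move=> hw.
have : \forall q \near (x, 0 : R), forall w, w1 <= w /\ w <= w2 -> ~ U q.1 (w + q.2).
  apply: (tube (P := fun p : ('rV[R]_m * R) * R => ~ U p.1.1 (p.2 + p.1.2))
    (K := [set w | w1 <= w /\ w <= w2])).
    exact: Icc_compact.
  move=> w [h1 h2].
  have c : closed [set p : ('rV[R]_m * R) * R | U p.1.1 (p.2 + p.1.2)].
    by apply: cloU; repeat ct_step.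
  have : nbhs ((x, 0 : R), w) (~` [set p : ('rV[R]_m * R) * R | U p.1.1 (p.2 + p.1.2)]).
    apply: open_nbhs_nbhs; split; first exact: closed_openC.
    by rewrite /= addr0; exact: hw.
  by [].
move=> /nbhs_ballP[r /= r0 hr].
exists r^-1 => e re w h1 h2 x' w' Ux'.
have e0 : 0 < e by apply: lt_le_trans re; rewrite invr_gt0.
have er (z : R) : r <= z -> 1 <= e * z.
  move=> rz; apply: (@le_trans _ _ (e * r)); last by rewrite ler_pM2l.
  by rewrite -(mulVf (lt0r_neq0 r0)) ler_pM2r.
apply: contrapT => /not_orP[n1 n2].
have hB : ball (x, 0 : R) r (x', w' - w).
  split=> /=.
    split=> // i j; rewrite (ord1 i) /ball /=.
    by rewrite ltNge; apply/negP => h; apply: n2; exists j; exact: er.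
  rewrite /ball /= sub0r normrN distrC ltNge.
  by apply/negP => h; apply: n1; exact: er.
by apply: (hr _ hB w) => //=; rewrite addrC subrK.
Qed.

(** * Slopes of left endpoints cannot become dense *)

Section Limit.
Variables (k : nat) (i : 'I_k) (t0 : 'rV[R]_k) (r : R).
Hypothesis t01 : forall l, `|t0 0 l| <= 1.
Hypothesis r0 : 0 < r.
Hypothesis r1 : r <= 1.

(** A pair of tuples has slope [- A / B], the root of [A + t * B]. Inequalities multiplied by the
    absolute value of [B] remain closed conditions. *)
Let A (d d' : 'rV[R]_k) : R := \sum_l t0 0 l * (d 0 l - d' 0 l).
Let B (d d' : 'rV[R]_k) : R := d 0 i - d' 0 i.

Hypothesis cover : forall e : R, 0 < e -> exists x, forall t : R, - r <= t -> t <= r ->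
  exists d d' : 'rV[R]_k, (forall l, leftend x (d 0 l) /\ leftend x (d' 0 l)) /\
    B d d' <> 0 /\ `|A d d' + t * B d d'| <= e * `|B d d'|.

(* A parameter [xi] packs [x] with two large reals: left endpoints are required
   to border gaps of length [1 / pb xi], and these gaps, except for a short
   initial part, to stay at distance [1 / pe xi] from the whole of [U]. This
   keeps the conditions on [xi] closed. *)
Let px (xi : 'rV[R]_(m + 2)) : 'rV[R]_m := \row_j xi 0 (lshift 2 j).
Let pb (xi : 'rV[R]_(m + 2)) : R := xi 0 (rshift m 0).
Let pe (xi : 'rV[R]_(m + 2)) : R := xi 0 (rshift m 1).
(** Twice the product of the losses in [thin]: [(3 * b) ^+ (2 * k)] bounds the number of cell
    patterns of two [k]-tuples, [b] comes from dividing by [B], and [6 * k] from perturbing the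
    tuples. *)
Let c (b : R) : R := 12 * k%:R * b * (3 * b) ^+ (2 * k).

Let dpb : dmap RR pb. Proof. by rewrite /pb; dfn. Qed.
Let dpe : dmap RR pe. Proof. by rewrite /pe; dfn. Qed.
Let dc : dmap RR c. Proof. by rewrite /c; dfn. Qed.
Let cpb : continuous pb. Proof. by rewrite /pb; repeat ct_step. Qed.
Let cpe : continuous pe. Proof. by rewrite /pe; repeat ct_step. Qed.
Let cc : continuous c. Proof. by rewrite /c; repeat ct_step. Qed.

(** The point [(px xi, w)] has sup distance at least [1 / pe xi] from [U]: a closed condition,
    unlike mere absence from [U]. *)
Let far (xi : 'rV[R]_(m + 2)) (w : R) := forall (x' : 'rV[R]_m) (w' : R), U x' w' ->
  1 <= pe xi * `|w - w'| \/ exists j, 1 <= pe xi * `|px xi 0 j - x' 0 j|.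

Let Bd (s : R) (xi : 'rV[R]_(m + 2)) (u : R) := U (px xi) u /\
  exists d : R, (0 <= d /\ d <= 1) /\ (d * c (pb xi) <= s /\
    forall z : R, 0 <= z -> 1 <= pb xi * z \/ far xi (u + d + z)).

Let in01 (u : 'rV[R]_k) := forall l, 0 <= u 0 l /\ u 0 l <= 1.

Let Bds (s : R) xi (u u' : 'rV[R]_k) :=
  (forall l, Bd s xi (u 0 l) /\ Bd s xi (u' 0 l)) /\ 1 <= pb xi * `|B u u'|.

(** Two radii compete: [X] asks for a slope within [s] of every [t], which makes the family dense,
    while [Rl] below keeps the radius [s / c] around the slopes, which makes it thin. *)
Let X (s : R) xi := (1 <= pb xi /\ 0 <= pe xi) /\ forall t : R, - r <= t -> t <= r ->
  exists u, in01 u /\ exists u', in01 u' /\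
    (Bds s xi u u' /\ `|A u u' + t * B u u'| <= s * `|B u u'|).

Let Rl (s : R) xi (t : R) := exists u, in01 u /\ exists u', in01 u' /\
    (Bds s xi u u' /\ `|A u u' + t * B u u'| * c (pb xi) <= s * `|B u u'|).

Let dfar : def RR (fun q : 'rV[R]_(m + 2) * R => far q.1 q.2).
Proof. by rewrite /far; dfn. Qed.

Let dBd : def RR (fun q : R * 'rV[R]_(m + 2) * R => Bd q.1.1 q.1.2 q.2).
Proof. by rewrite /Bd; dfn. Qed.

Let dX : def RR (fun q : R * 'rV[R]_(m + 2) => X q.1 q.2).
Proof. by rewrite /X /in01 /Bds /A /B; dfn. Qed.

Let dRl : def RR (fun q : R * 'rV[R]_(m + 2) * R => Rl q.1.1 q.1.2 q.2).
Proof. by rewrite /Rl /in01 /Bds /A /B; dfn. Qed.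

Let cBd : closed [set q : R * 'rV[R]_(m + 2) * R | Bd q.1.1 q.1.2 q.2].
Proof.
have h (T : topologicalType) (f : T -> 'rV[R]_(m + 2)) (g : T -> R) :
    continuous f -> continuous g -> clo (fun q => far (f q) (g q)).
  by move=> hf hg; rewrite /far; solve_clo.
change (clo (fun q : R * 'rV[R]_(m + 2) * R => Bd q.1.1 q.1.2 q.2)); rewrite /Bd.
clo_step; first by apply: cloU; repeat ct_step.
apply: (clo_ex_compact (K := [set d : R | 0 <= d /\ d <= 1])).
  exact: Icc_compact.
change (clo (fun q : R * 'rV[R]_(m + 2) * R * R => q.2 * c (pb q.1.1.2) <= q.1.1.1 /\
  forall z : R, 0 <= z -> 1 <= pb q.1.1.2 * z \/ far q.1.1.2 (q.1.2 + q.2 + z))).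
by solve_clo; apply: h; repeat ct_step.
Qed.

Let cloBd (T : topologicalType) (f : T -> R) (g : T -> 'rV[R]_(m + 2)) (h : T -> R) :
  continuous f -> continuous g -> continuous h -> clo (fun q => Bd (f q) (g q) (h q)).
Proof.
move=> hf hg hh.
apply: (clo_comp (Q := fun q : R * 'rV[R]_(m + 2) * R => Bd q.1.1 q.1.2 q.2)
   (f := fun q => (f q, g q, h q))) => //.
by repeat ct_step.
Qed.

Let cX : closed [set q : R * 'rV[R]_(m + 2) | X q.1 q.2].
Proof.
change (clo (fun q : R * 'rV[R]_(m + 2) => X q.1 q.2)); rewrite /X.
solve_clo.
apply: (clo_ex_compact (K := in01)); first exact: cube_compact.
apply: (clo_ex_compact (K := in01)); first exact: cube_compact.
change (clo (fun q : R * 'rV[R]_(m + 2) * 'rV[R]_k * 'rV[R]_k =>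
  Bds q.1.1.1 q.1.1.2 q.1.2 q.2 /\
  `|A q.1.2 q.2 + i0 * B q.1.2 q.2| <= q.1.1.1 * `|B q.1.2 q.2|)).
by rewrite /Bds /A /B; solve_clo; apply: cloBd; repeat ct_step.
Qed.

Let cRl : closed [set q : R * 'rV[R]_(m + 2) * R | Rl q.1.1 q.1.2 q.2].
Proof.
apply: (clo_ex_compact (K := in01)); first exact: cube_compact.
apply: (clo_ex_compact (K := in01)); first exact: cube_compact.
change (clo (fun q : R * 'rV[R]_(m + 2) * R * 'rV[R]_k * 'rV[R]_k =>
  Bds q.1.1.1.1 q.1.1.1.2 q.1.2 q.2 /\
  `|A q.1.2 q.2 + q.1.1.2 * B q.1.2 q.2| * c (pb q.1.1.1.2) <=
     q.1.1.1.1 * `|B q.1.2 q.2|)).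
by rewrite /Bds /A /B; solve_clo; apply: cloBd; repeat ct_step.
Qed.

Let k0 : (0 < k)%N. Proof. by case: (k) i => [[]|]. Qed.

Let c12 (b : R) : 1 <= b -> 12 <= c b.
Proof.
move=> b1; have k1 : 1 <= k%:R :> R by rewrite ler1n.
have h : 1 <= (3 * b) ^+ (2 * k) by apply: exprn_ege1; lra.
have h2 : 12 <= 12 * k%:R * b by nra.
by rewrite /c; nra.
Qed.

(** It suffices to serve a net of mesh [s / 4]. Finitely many left endpoints then occur, so a single
    [b] fits all their gaps, and compactness provides a single [e]. *)
Let X_ex (s : R) : 0 < s -> s < 1 -> exists xi, X s xi.
Proof.
move=> s0 s1; have r0' := r0.
have s4 : 0 < s / 4 by lra.
have [x hx] := cover s4.
pose N := (Num.truncn (2 * r / (s / 4))).+1.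
pose tt (j : 'I_N) : R := - r + j%:R * (s / 4).
have net (t : R) : - r <= t -> t <= r -> exists j : 'I_N, `|t - tt j| <= s / 4 /\ tt j <= r.
  move=> t1 t2.
  have h0 : 0 <= (t + r) / (s / 4) by rewrite divr_ge0//; lra.
  have /andP[h1 h2] := truncn_itv h0.
  have jN : (Num.truncn ((t + r) / (s / 4)) < N)%N.
    rewrite /N ltnS; apply: le_truncn; rewrite ler_pM2r ?invr_gt0//; lra.
  exists (Ordinal jN); rewrite /tt /=.
  move: h1 h2; set q := Num.truncn _; rewrite ler_pdivlMr// ltr_pdivrMr// => h1.
  have -> : q.+1%:R = q%:R + 1 :> R by rewrite natr1.
  rewrite mulrDl mul1r => h2.
  by split; [rewrite ler_norml; apply/andP; split; lra|lra].
have tt1 j : - r <= tt j by rewrite /tt lerDl mulr_ge0// ?ler0n// ltW.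
have /choice[dd hdd] : forall j : 'I_N, exists p : 'rV[R]_k * 'rV[R]_k, tt j <= r ->
    (forall l, leftend x (p.1 0 l) /\ leftend x (p.2 0 l)) /\
    B p.1 p.2 <> 0 /\ `|A p.1 p.2 + tt j * B p.1 p.2| <= s / 4 * `|B p.1 p.2|.
  move=> j; have [h|h] := leP (tt j) r; last by exists (0, 0).
  by have [d [d' hd]] := hx _ (tt1 j) h; exists (d, d').
pose gapb (b u : R) := leftend x u -> exists d : R, [/\ 0 < d, d <= 1, d * c b <= s &
    forall w : R, u + d <= w -> w <= u + d + b^-1 -> ~ U x w].
have gapE (u : R) : exists b0 : R, forall b, b0 <= b -> gapb b u.
  have [[Uu [g [g0 hg]]]|nl] := pselect (leftend x u); last first.
    by exists 0 => b _ /nl.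
  exists (Num.max 1 (2 / g)) => b; rewrite ge_max => /andP[b1 gb] _.
  have cb := c12 b1; have cb0 : 0 < c b by lra.
  have b0 : 0 < b by lra.
  have bg : b^-1 <= g / 2.
    by rewrite -[leRHS]invrK invf_div lef_pV2 ?posrE// divr_gt0.
  (* [1 / b] uses at most half of the gap and [d] at most a quarter. *)
  pose d := Num.min (s / c b) (g / 4).
  have d0 : 0 < d by rewrite lt_min !divr_gt0.
  have d1 : d <= s / c b by rewrite ge_min lexx.
  have d2 : d <= g / 4 by rewrite ge_min lexx orbT.
  have d3 : d * c b <= s by rewrite -ler_pdivlMr.
  exists d; split=> //; first by nra.
  by move=> w w1 w2; apply: hg; lra.
have [b0 hb0] : exists b0 : R, forall b, b0 <= b -> forall j : 'I_N,
    (B (dd j).1 (dd j).2 <> 0 -> 1 <= b * `|B (dd j).1 (dd j).2|) /\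
    forall l, gapb b ((dd j).1 0 l) /\ gapb b ((dd j).2 0 l).
  apply: eventually_ord => j.
  have [b1 h1] := eventually_ord (fun l => gapE ((dd j).1 0 l)).
  have [b2 h2] := eventually_ord (fun l => gapE ((dd j).2 0 l)).
  exists (Num.max (`|B (dd j).1 (dd j).2|^-1) (Num.max b1 b2)) => b.
  rewrite !ge_max => /and3P[hb hb1 hb2]; split.
    move=> /eqP; rewrite -normr_gt0 => Bp.
    by rewrite -(mulVf (lt0r_neq0 Bp)) ler_pM2r.
  by move=> l; split; [exact: h1|exact: h2].
pose b := Num.max 1 b0.
have b1 : 1 <= b by rewrite le_max lexx.
have {hb0} hb := hb0 b (_ : b0 <= b).
have {}hb := hb (ltac:(by rewrite le_max lexx orbT)).
have bp : 0 < b by lra.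
pose good (u e : R) := leftend x u -> exists d : R, (0 <= d /\ d <= 1) /\ (d * c b <= s /\
    forall z : R, 0 <= z -> 1 <= b * z \/ forall x' w', U x' w' ->
    1 <= e * `|u + d + z - w'| \/ exists j, 1 <= e * `|x 0 j - x' 0 j|).
have goodE u : gapb b u -> exists e0 : R, forall e, e0 <= e -> good u e.
  move=> hu; have [l|nl] := pselect (leftend x u); last by exists 0 => e _ /nl.
  have [d [d0 d1 dc' hd]] := hu l.
  have [e0 he] := far_from_compact hd.
  exists e0 => e ee _; exists d; split; first by split=> //; exact: ltW.
  split=> // z z0; have [h|h] := leP 1 (b * z); [by left|right].
  apply: he => //; first by lra.
  by rewrite lerD2l -(ler_pM2l bp) mulfV ?gt_eqF// ltW.
have [e0 he0] : exists e0 : R, forall e, e0 <= e -> forall j : 'I_N, forall l,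
    good ((dd j).1 0 l) e /\ good ((dd j).2 0 l) e.
  apply: eventually_ord => j; apply: eventually_ord => l.
  have [_ /(_ l)[g1 g2]] := hb j.
  have [e1 h1] := goodE _ g1; have [e2 h2] := goodE _ g2.
  exists (Num.max e1 e2) => e; rewrite ge_max => /andP[hh1 hh2].
  by split; [exact: h1|exact: h2].
pose e := Num.max 0 e0.
have {he0} he := he0 e (ltac:(by rewrite le_max lexx orbT)).
pose xi : 'rV[R]_(m + 2) := row_mx x (\row_j (if j == 0 :> 'I_2 then b else e)).
have xiE : px xi = x.
  by apply/rowP => j; rewrite mxE row_mxEl.
have xib : pb xi = b by rewrite /pb row_mxEr mxE.
have xie : pe xi = e by rewrite /pe row_mxEr mxE.
exists xi; rewrite /X xib xie; split; first by split=> //; rewrite le_max lexx.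
move=> t t1 t2; have [j [jt jr]] := net t t1 t2.
have [hl [hB hA]] := hdd j jr.
have [hbB _] := hb j.
have l01 u : leftend x u -> 0 <= u /\ u <= 1 by case=> /U01.
have BdE u : good u e -> leftend x u -> Bd s xi u.
  move=> gu lu; rewrite /Bd xib xiE; split; first by case: lu.
  have [d [hd1 [hd2 hd3]]] := gu lu; exists d; split=> //; split=> //.
  move=> z z0; case: (hd3 z z0) => h; [by left|right].
  by rewrite /far xie xiE.
exists (dd j).1; split; first by move=> l; have [/l01] := hl l.
exists (dd j).2; split; first by move=> l; have [_ /l01] := hl l.
split.
  split; last by rewrite xib; exact: hbB.
  move=> l; have [h1 h2] := hl l; have [g1 g2] := he j l.
  by split; exact: BdE.
have -> : A (dd j).1 (dd j).2 + t * B (dd j).1 (dd j).2 =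
  (A (dd j).1 (dd j).2 + tt j * B (dd j).1 (dd j).2) + (t - tt j) * B (dd j).1 (dd j).2.
  by ring.
apply: le_trans (ler_normD _ _) _; rewrite normrM.
have nB := normr_ge0 (B (dd j).1 (dd j).2).
by nra.
Qed.

(** After an initial part of length [d <= s / c], the point [u] is followed by a gap of length
    [1 / b], so a nearby [v] must lie in the initial part. *)
Let Bd_cluster (s : R) xi (u v : R) : 1 <= pb xi -> Bd s xi u -> Bd s xi v ->
  u <= v -> pb xi * (v - u) < 1 -> (v - u) * c (pb xi) <= s.
Proof.
move=> b1 [Uu [d [[d0 _] [ds hd]]]] [Uv _] uv bvu.
have cb := c12 b1.
have [vd|dv] := leP (v - u) d.
  by apply: le_trans ds; rewrite ler_pM2r//; lra.
have h0 : 0 <= v - u - d by lra.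
case: (hd _ h0) => [h|].
  have h' : pb xi * (v - u - d) <= pb xi * (v - u) by rewrite ler_pM2l; lra.
  by have := le_lt_trans (le_trans h h') bvu; rewrite ltxx.
have -> : u + d + (v - u - d) = v by ring.
move=> /(_ _ _ Uv); rewrite subrr normr0 mulr0 => -[|[j]]; first by rewrite ler10.
by rewrite subrr normr0 mulr0 ler10.
Qed.

(** Suppose that [Rl] contains [[t, t + s]] and take [n + 1] points with spacing [s / n]. Each comes
    from a pair of tuples, and for cells of length [1 / (2 * b)] there are at most [n] patterns. Two
    pairs with the same pattern agree up to [s / c] by clustering, which forces their slopes closer
    than the spacing allows. *)
Let thin (s t : R) xi : 0 < s -> s < 1 -> 1 <= pb xi -> - r <= t -> t + s <= r ->
  exists z : R, [/\ t <= z, z <= t + s & ~ Rl s xi z].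
Proof.
move=> s0 s1 b1 tr tsr; apply: contrapT => no.
have r1' := r1; have cb := c12 b1; set b := pb xi in b1 cb *.
pose M := (Num.truncn (2 * b)).+1.
have b20 : 0 <= 2 * b by lra.
have M3 : M%:R <= 3 * b.
  by have /andP[h _] := truncn_itv b20; rewrite /M -natr1; lra.
pose n := (M ^ (2 * k))%N.
have n0 : (0 < n)%N by rewrite expn_gt0.
have n0' : 0 < n%:R :> R by rewrite ltr0n.
have n3 : n%:R <= (3 * b) ^+ (2 * k).
  by rewrite natrX lerXn2r// nnegrE ?ler0n//; lra.
pose z (j : 'I_n.+1) : R := t + j%:R * (s / n%:R).
have zt j : t <= z j /\ z j <= t + s.
  have j0 : 0 <= j%:R :> R by rewrite ler0n.
  have jn : j%:R <= n%:R :> R by rewrite ler_nat -ltnS.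
  have sn : 0 < s / n%:R by rewrite divr_gt0.
  split; first by rewrite lerDl mulr_ge0// ltW.
  by rewrite lerD2l mulrA ler_pdivrMr// mulrC ler_pM2l.
have /choice[uu huu] : forall j, exists p : 'rV[R]_k * 'rV[R]_k, in01 p.1 /\ in01 p.2 /\
    Bds s xi p.1 p.2 /\ `|A p.1 p.2 + z j * B p.1 p.2| * c b <= s * `|B p.1 p.2|.
  move=> j; apply: contrapT => no'; apply: no; exists (z j).
  by have [h1 h2] := zt j; split=> // -[u [hu [u' [hu' h]]]]; apply: no'; exists (u, u').
have cell (u : R) : 0 <= u -> u <= 1 -> (Num.truncn (2 * b * u) < M)%N.
  by move=> u0 u1; rewrite /M ltnS; apply: le_truncn; nra.
pose f (j : 'I_n.+1) : {ffun 'I_k -> 'I_M} * {ffun 'I_k -> 'I_M} :=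
  ([ffun l => inord (Num.truncn (2 * b * (uu j).1 0 l))],
   [ffun l => inord (Num.truncn (2 * b * (uu j).2 0 l))]).
have ninj : ~ injective f.
  move=> /leq_card; rewrite card_ord card_prod !card_ffun !card_ord.
  by rewrite -expnD addnn -mul2n -/n ltnn.
have [j [j' [jj' ff]]] : exists j j', j != j' /\ f j = f j'.
  apply: contrapT => no'; apply: ninj => j j' ff; apply/eqP.
  by apply: contraT => jj'; exfalso; apply: no'; exists j, j'.
pose th := s / c b.
have cb0 : 0 < c b by lra.
have th0 : 0 < th by rewrite divr_gt0.
have thE : th * c b = s by rewrite divfK// gt_eqF.
have close (u v : R) : 0 <= u -> u <= 1 -> 0 <= v -> v <= 1 ->
    Bd s xi u -> Bd s xi v ->
    inord (Num.truncn (2 * b * u)) = inord (Num.truncn (2 * b * v)) :> 'I_M ->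
    `|u - v| <= th.
  move=> u0 u1 v0 v1 Bu Bv /(congr1 val) /=.
  rewrite !inordK ?cell// => e.
  have bu0 : 0 <= 2 * b * u by nra.
  have bv0 : 0 <= 2 * b * v by nra.
  have /andP[p1 p2] := truncn_itv bu0; have /andP[p3 p4] := truncn_itv bv0.
  rewrite -e -natr1 in p3 p4; rewrite -natr1 in p2.
  rewrite /th ler_pdivlMr//.
  have [uv|vu] := leP u v.
    by rewrite distrC ger0_norm ?subr_ge0//; apply: Bd_cluster => //; rewrite -/b; nra.
  rewrite ger0_norm ?subr_ge0 ?(ltW vu)//; apply: Bd_cluster => //; first exact: ltW.
  by rewrite -/b; nra.
have [i1 [i2 [[hb hB] hA]]] := huu j; have [i1' [i2' [[hb' hB'] hA']]] := huu j'.
have e1 l : `|(uu j).1 0 l - (uu j').1 0 l| <= th.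
  have [? ?] := i1 l; have [? ?] := i1' l; have [? _] := hb l; have [? _] := hb' l.
  apply: close => //; have := congr1 (fun p : {ffun 'I_k -> 'I_M} * {ffun 'I_k -> 'I_M} => p.1 l) ff.
  by rewrite /= !ffunE.
have e2 l : `|(uu j).2 0 l - (uu j').2 0 l| <= th.
  have [? ?] := i2 l; have [? ?] := i2' l; have [_ ?] := hb l; have [_ ?] := hb' l.
  apply: close => //; have := congr1 (fun p : {ffun 'I_k -> 'I_M} * {ffun 'I_k -> 'I_M} => p.2 l) ff.
  by rewrite /= !ffunE.
have eB : `|B (uu j').1 (uu j').2 - B (uu j).1 (uu j).2| <= 2 * th.
  rewrite /B; set a1 := _ 0 i; set a2 := _ 0 i; set a3 := _ 0 i; set a4 := _ 0 i.
  have -> : a1 - a2 - (a3 - a4) = (a4 - a2) - (a3 - a1) by ring.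
  apply: le_trans (ler_normB _ _) _; have := e1 i; have := e2 i.
  by rewrite -/a1 -/a2 -/a3 -/a4; lra.
have eA : `|A (uu j').1 (uu j').2 - A (uu j).1 (uu j).2| <= k%:R * (2 * th).
  rewrite /A -sumrB; apply: le_trans (ler_norm_sum _ _ _) _.
  have -> : k%:R * (2 * th) = \sum_(l < k) 2 * th.
    by rewrite sumr_const card_ord mulr_natl.
  apply: ler_sum => l _; rewrite -mulrBr normrM.
  apply: le_trans (ler_piMl (normr_ge0 _) (t01 l)) _.
  set a1 := _ 0 l; set a2 := _ 0 l; set a3 := _ 0 l; set a4 := _ 0 l.
  have -> : a1 - a2 - (a3 - a4) = (a4 - a2) - (a3 - a1) by ring.
  apply: le_trans (ler_normB _ _) _; have := e1 l; have := e2 l.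
  by rewrite -/a1 -/a2 -/a3 -/a4; lra.
have B1 (u u' : 'rV[R]_k) : in01 u -> in01 u' -> `|B u u'| <= 1.
  by move=> /(_ i)[h1 h2] /(_ i)[h3 h4]; exact: dist_le1.
have hBj := B1 _ _ i1 i2; have hBj' := B1 _ _ i1' i2'.
have res (a : R) Bn : `|a| * c b <= s * Bn -> `|a| <= th * Bn.
  by move=> h; rewrite -(ler_pM2r cb0) mulrAC thE.
have {hA} hA := res _ _ hA; have {hA'} hA' := res _ _ hA'.
have zz : s / n%:R <= `|z j - z j'|.
  rewrite /z opprD addrACA subrr add0r -mulrBl normrM (ger0_norm (ltW (divr_gt0 s0 n0'))).
  rewrite ler_peMl ?(ltW (divr_gt0 s0 n0'))//.
  have [lij|lij|e] := ltngtP j j'.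
  - by rewrite distrC -natrB ?(ltnW lij)// normr_nat ler1n subn_gt0.
  - by rewrite -natrB ?(ltnW lij)// normr_nat ler1n subn_gt0.
  - by case/eqP: jj'; exact: val_inj.
have zj' : `|z j'| <= 1.
  have [h1 h2] := zt j'; rewrite ler_norml.
  by rewrite (le_trans h2 (le_trans tsr r1)) (le_trans (le_trans _ tr) h1)// lerN2.
move: hA hA' eA eB hBj hBj' hB.
set B0 := B (uu j).1 (uu j).2; set B0' := B (uu j').1 _.
set A0 := A (uu j).1 _; set A0' := A (uu j').1 _ => hA hA' eA eB hBj hBj' hB.
(* [2 * k] stems from [A], [2] from [B], and [1] from each of the two approximate roots. *)
have main : `|z j - z j'| * `|B0| <= th * (2 * k%:R + 4).
  rewrite -normrM.
  have -> : (z j - z j') * B0 = (A0 + z j * B0) - (A0' + z j' * B0') + (A0' - A0)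
      + z j' * (B0' - B0) by ring.
  apply: le_trans (ler_normD _ _) _; apply: le_trans (lerD (ler_normD _ _) (lexx _)) _.
  apply: le_trans (lerD (lerD (ler_normB _ _) (lexx _)) (lexx _)) _.
  have h1 : `|A0 + z j * B0| <= th.
    by apply: le_trans hA _; rewrite ger_pMr.
  have h2 : `|A0' + z j' * B0'| <= th.
    by apply: le_trans hA' _; rewrite ger_pMr.
  have h3 : `|z j' * (B0' - B0)| <= 2 * th.
    rewrite normrM; apply: le_trans eB; exact: ler_piMl.
  apply: le_trans (lerD (lerD (lerD h1 h2) eA) h3) _.
  by rewrite le_eqVlt; apply/orP; left; apply/eqP; ring.
have k1 : 1 <= k%:R :> R by rewrite ler1n.
have b0 : 0 < b by lra.
have main2 : `|z j - z j'| <= b * (th * (2 * k%:R + 4)).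
  apply: (@le_trans _ _ (b * (`|z j - z j'| * `|B0|))); last by rewrite ler_pM2l.
  by rewrite mulrCA ler_peMr.
have main3 : s / n%:R <= b * (th * (6 * k%:R)).
  apply: le_trans zz (le_trans main2 _).
  rewrite !ler_pM2l// -subr_ge0.
  have -> : 6 * k%:R - (2 * k%:R + 4) = 4 * (k%:R - 1) :> R by ring.
  by rewrite mulr_ge0// subr_ge0.
have : s <= b * (th * (6 * k%:R)) * (3 * b) ^+ (2 * k).
  apply: (@le_trans _ _ (b * (th * (6 * k%:R)) * n%:R)).
    by rewrite -ler_pdivrMr.
  have k_gt0 := lt_le_trans ltr01 k1.
  by rewrite ler_pM2l//; exact: mulr_gt0 b0 (mulr_gt0 th0 (mulr_gt0 (ltr0n _ 6) k_gt0)).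
have -> : b * (th * (6 * k%:R)) * (3 * b) ^+ (2 * k) = th * c b / 2.
  by rewrite /c; field.
by rewrite thE leNgt ltr_pdivrMr// ltr_pMr// ltr1n.
Qed.

Lemma cover_false : False.
Proof.
have r0' := r0.
have fX : fibers_ok X.
  move=> s s0 s1; split; last exact: X_ex.
  have := clo_comp (f := fun xi => (s, xi)) cX; apply.
  by repeat ct_step.
have rX : relclosed 1 X by move=> s x _ _ /cX.
have [Y [dY YX Y0 Yu st]] := selection hN dX fX rX.
pose T (s t : R) := exists xi, Y s xi /\ Rl s xi t.
have dT : def RR (fun q : R * R => T q.1 q.2) by rewrite /T; dfn.
have TE (s : R) xi t : Y s xi -> T s t <-> Rl s xi t.
  by move=> Yx; split=> [[xi' [Yx' h]]|h]; [rewrite (Yu s _ _ Yx Yx')|exists xi].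
have rr : - r < r by lra.
apply: (thin_false hN rr dT).
- move=> s s0 s1; have [xi Yx] := Y0 s s0 s1.
  rewrite (_ : [set t | T s t] = [set t | Rl s xi t]); last first.
    by apply/seteqP; split=> t; rewrite /= (TE s xi t Yx).
  have := clo_comp (f := fun t : R => (s, xi, t)) cRl; apply.
  by repeat ct_step.
- move=> s t s0 s1 t1 t2; have [xi Yx] := Y0 s s0 s1.
  have [[b1 _] hX] := YX _ _ Yx.
  have [u [iu [u' [iu' [hB hA]]]]] := hX t t1 t2.
  have cb := c12 b1.
  have Bp : 0 < `|B u u'|.
    by have [_ h] := hB; rewrite -(pmulr_rgt0 _ (lt_le_trans ltr01 b1)); lra.
  have Bn : B u u' != 0 by rewrite -normr_gt0.
  exists (- A u u' / B u u'), (s / c (pb xi)); split.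
  - rewrite -(ler_pM2r Bp) -normrM mulrBl divfK// opprK addrC.
    by [].
  - by rewrite divr_gt0//; lra.
  move=> z hz; apply/(TE s xi z Yx); exists u; split=> //; exists u'; split=> //.
  split=> //; rewrite -ler_pdivlMr; last lra.
  have -> : A u u' + z * B u u' = (z - (- A u u' / B u u')) * B u u'.
    by rewrite mulrBl divfK// opprK addrC.
  by rewrite normrM mulrAC ler_pM2r.
- move=> s t s0 s1 t1 t2; have [xi Yx] := Y0 s s0 s1.
  have [[b1 _] _] := YX _ _ Yx.
  have [z [h1 h2 h3]] := thin s0 s1 b1 t1 t2.
  by exists z; split=> //; rewrite (TE s xi z Yx).
case: st => [|[e [e0 e1 rY bY]]]; first by left.
right; exists e; split=> // s t s0 se hcl; apply: contrapT => nT.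
(* Near [s] the selected parameters stay in a fixed cube, so compactness removes the quantifier over
   them. *)
have [Bb [rho [rho0 hb]]] := bY s s0 se.
pose K := [set xi : 'rV[R]_(m + 2) | forall l, - Bb <= xi 0 l /\ xi 0 l <= Bb].
have : \forall q \near (s, t), forall xi, K xi -> ~ (Y q.1 xi /\ Rl q.1 xi q.2).
  apply: (tube (P := fun p : (R * R) * 'rV[R]_(m + 2) =>
    ~ (Y p.1.1 p.2 /\ Rl p.1.1 p.2 p.1.2)) (@cube_compact R (m + 2) (- Bb) Bb)) => xi _.
  have [Ysx|nY] := pselect (Y s xi).
    have nR : ~ Rl s xi t by move=> h; apply: nT; exists xi.
    have c1 : closed [set p : (R * R) * 'rV[R]_(m + 2) | Rl p.1.1 p.2 p.1.2].
      have := clo_comp (f := fun p : (R * R) * 'rV[R]_(m + 2) => (p.1.1, p.2, p.1.2)) cRl.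
      by apply; repeat ct_step.
    have : nbhs ((s, t), xi) (~` [set p : (R * R) * 'rV[R]_(m + 2) | Rl p.1.1 p.2 p.1.2]).
      by apply: open_nbhs_nbhs; split=> //; exact: closed_openC.
    by apply: filterS => q nq [].
  have c1 : closed [set p : (R * R) * 'rV[R]_(m + 2) |
      closure [set q : R * 'rV[R]_(m + 2) | Y q.1 q.2] (p.1.1, p.2)].
    have := clo_comp (f := fun p : (R * R) * 'rV[R]_(m + 2) => (p.1.1, p.2))
      (@closed_closure _ [set q : R * 'rV[R]_(m + 2) | Y q.1 q.2]).
    by apply; repeat ct_step.
  have : nbhs ((s, t), xi) (~` [set p : (R * R) * 'rV[R]_(m + 2) |
      closure [set q : R * 'rV[R]_(m + 2) | Y q.1 q.2] (p.1.1, p.2)]).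
    by apply: open_nbhs_nbhs; split; [exact: closed_openC|move=> /= /(rY s xi s0 se)].
  by apply: filterS => q nq [Yq _]; apply: nq; apply: subset_closure.
have hs1 : continuous (fun q : R * R => q.1) by repeat ct_step.
have n2 : nbhs (s, t) [set q : R * R | ball s (Num.min rho (Num.min s (e - s))) q.1].
  apply: (hs1 (s, t) (ball s _)); apply: nbhsx_ballx.
  by rewrite !lt_min rho0 s0 /=; lra.
move=> n1; have [[s' t'] [/= [xi [Yx Rx]] [/= h1]]] := hcl _ (filterI n1 n2).
rewrite /ball /= distrC !lt_min => /and3P[b1 b2 b3].
have t0' : 0 < s' by move: b2; rewrite ltr_norml => /andP[]; lra.
have te : s' < e by move: b3; rewrite ltr_norml => /andP[]; lra.
apply: (h1 xi) => // l; apply/andP; rewrite -ler_norml.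
by apply: (hb s' xi) => //; exact: ltW.
Qed.

End Limit.
End LeftEnds.

(** * Counting left endpoints by pigeonhole *)

Section CountLeftEnds.
Variables (R : realType) (RR : expansion R).
Hypothesis hN : ~ defines_nat RR.
Variables (m : nat) (U : 'rV[R]_m -> R -> Prop).
Hypothesis dU : def RR (fun q : 'rV[R]_m * R => U q.1 q.2).
Hypothesis cU : closed [set q : 'rV[R]_m * R | U q.1 q.2].
Hypothesis U01 : forall x (y : R), U x y -> 0 <= y /\ y <= 1.

(** Sequential compactness at a fixed precision; an unbounded predicate on the indices takes the
    place of a subsequence. *)
Lemma cluster_point (rho : R) (s : nat -> R) (M : nat) : 0 < rho ->
  forall (A : nat -> Prop) (lo : R), (forall N, exists2 j, (N <= j)%N & A j) ->
  (forall j, A j -> lo <= s j /\ s j <= lo + M%:R * rho) ->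
  exists c : R, lo <= c /\ c <= lo + M%:R * rho /\
    forall N, exists2 j, (N <= j)%N & A j /\ `|s j - c| <= rho.
Proof.
move=> rho0; elim: M => [|M IH] A lo uA hs.
  exists lo; rewrite mul0r addr0; split=> //; split=> // N.
  have [j Nj Aj] := uA N; exists j => //; split=> //.
  have [h1 h2] := hs j Aj; rewrite ler_norml; apply/andP; split; lra.
have SM : M.+1%:R * rho = rho + M%:R * rho by rewrite -natr1 mulrDl mul1r addrC.
have [h|h] := pselect (forall N, exists2 j, (N <= j)%N & A j /\ s j <= lo + rho).
  exists lo; split=> //; split; first by rewrite lerDl mulr_ge0// ?ler0n ?ltW.
  move=> N; have [j Nj [Aj hj]] := h N; exists j => //; split=> //.
  by have [h1 _] := hs j Aj; rewrite ler_norml; apply/andP; split; lra.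
have [N0 hN0] : exists N0, forall j, (N0 <= j)%N -> A j -> lo + rho < s j.
  apply: contrapT => no; apply: h => N; apply: contrapT => no'; apply: no.
  exists N => j Nj Aj; rewrite ltNge; apply/negP => hj.
  by apply: no'; exists j.
have [|j [Aj hj]|c [c1 [c2 hc]]] := IH (fun j => A j /\ lo + rho < s j) (lo + rho).
- move=> N; have [j Nj Aj] := uA (maxn N N0).
  move: Nj; rewrite geq_max => /andP[Nj N0j].
  by exists j => //; split=> //; exact: hN0.
- by have [h1 h2] := hs j Aj; rewrite SM in h2; split; lra.
exists c; split; first lra.
split; first by rewrite SM; lra.
by move=> N; have [j Nj [[Aj _] hj]] := hc N; exists j.
Qed.

Lemma ord_argmax n (g : 'I_n.+1 -> R) : exists i, forall l, g l <= g i.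
Proof.
elim: n g => [|n IH] g; first by exists ord0 => l; rewrite (ord1 l).
have [i hi] := IH (fun l => g (lift ord0 l)).
have [h|h] := leP (g ord0) (g (lift ord0 i)).
  by exists (lift ord0 i) => l; case: (unliftP ord0 l) => [j|] ->.
exists ord0 => l; case: (unliftP ord0 l) => [j|] -> //.
exact: le_trans (hi j) (ltW h).
Qed.

Section Cover.
Variable k : nat.

(** The index [i] carries the largest difference, so a change of [t] alters the sum by at most a
    multiple of that difference. *)
Definition covers x (e : R) (i : 'I_k.+1) (t : 'rV[R]_k.+1) :=
  exists d d' : 'rV[R]_k.+1, [/\
    forall l, leftend U x (d 0 l) /\ leftend U x (d' 0 l),
    d 0 i <> d' 0 i,
    forall l, `|d 0 l - d' 0 l| <= `|d 0 i - d' 0 i| &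
    `|\sum_l t 0 l * (d 0 l - d' 0 l)| <= e * `|d 0 i - d' 0 i|].

Let shift (t0 : 'rV[R]_k.+1) (i : 'I_k.+1) (s : R) : 'rV[R]_k.+1 :=
  \row_l (t0 0 l + (if l == i then s else 0)).

Lemma sum_shift t0 i (s : R) (a : 'I_k.+1 -> R) :
  \sum_l shift t0 i s 0 l * a l = \sum_l t0 0 l * a l + s * a i.
Proof.
transitivity (\sum_l (t0 0 l * a l + (if l == i then s else 0) * a l)).
  by apply: eq_bigr => l _; rewrite mxE mulrDl.
rewrite big_split /=; congr (_ + _).
rewrite (bigD1 i)//= eqxx big1 ?addr0// => l /negbTE ->.
by rewrite mul0r.
Qed.

(* Induction on the set [J] of indices that still occur near [t0]. *)
Lemma no_covers (xs : nat -> 'rV[R]_m) :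
  (forall j (t : 'rV[R]_k.+1), (forall l, `|t 0 l| <= 1) -> exists i, covers (xs j) (j.+1%:R^-1) i t) ->
  False.
Proof.
move=> hx.
have ind n : forall (J : {set 'I_k.+1}) (A : nat -> Prop) (t0 : 'rV[R]_k.+1) (r : R),
    #|J| = n -> 0 < r -> (forall l, `|t0 0 l| + r <= 1) ->
    (forall N, exists2 j, (N <= j)%N & A j) ->
    (forall j, A j -> forall t : 'rV[R]_k.+1, (forall l, `|t 0 l - t0 0 l| <= r) ->
       forall i, i \notin J -> ~ covers (xs j) (j.+1%:R^-1) i t) -> False.
  elim: n => [|n IH] J A t0 r cJ r0 ht uA hA.
    have [j _ Aj] := uA 0%N.
    have [|i hi] := hx j t0.
      by move=> l; have := ht l; lra.
    apply: (hA j Aj t0 _ i _ hi); last by rewrite (cards0_eq cJ) inE.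
    by move=> l; rewrite subrr normr0 ltW.
  have [i iJ] : exists i, i \in J by apply/card_gt0P; rewrite cJ.
  (* Either [i] serves a whole segment in direction [i] at every precision, which [cover_false]
     excludes, or at some precision [e] it fails at one point for each [j]. These points cluster,
     and near the cluster point [i] no longer occurs for large [j]. *)
  have [hgood|hbad] := pselect (forall e : R, 0 < e -> exists j,
     forall s : R, - (r / 2) <= s -> s <= r / 2 -> covers (xs j) e i (shift t0 i s)).
    have r2 : 0 < r / 2 by lra.
    apply: (cover_false (i := i) (t0 := t0) (r := r / 2) hN dU cU U01) => //.
    - by move=> l; have := ht l; lra.
    - by have := ht i; have := normr_ge0 (t0 0 i); lra.
    move=> e e0; have [j hj] := hgood e e0; exists (xs j) => s s1 s2.
    have [d [d' [h1 h2 h3 h4]]] := hj s s1 s2.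
    exists d, d'; split=> //; split; first by move=> /eqP; rewrite subr_eq0 => /eqP.
    by rewrite -(sum_shift t0 i s (fun l => d 0 l - d' 0 l)).
  have [e [e0 he]] : exists e : R, 0 < e /\ forall j, exists s : R,
      [/\ - (r / 2) <= s, s <= r / 2 & ~ covers (xs j) e i (shift t0 i s)].
    apply: contrapT => no; apply: hbad => e e0; apply: contrapT => no'; apply: no.
    exists e; split=> // j; apply: contrapT => no''; apply: no'; exists j => s s1 s2.
    by apply: contrapT => nc; apply: no''; exists s.
  have [s hs] := choice he.
  pose K : R := k.+1%:R; have K0 : 0 < K by rewrite ltr0n.
  (* [r / 4] keeps the new ball in the old one, as [r / 2 + 2 * rho <= r]; [e / (4 * K)] limits the
     effect of moving [t] by [2 * rho] to [e / 2]. *)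
  pose rho := Num.min (r / 4) (e / (4 * K)).
  have K4 : 0 < 4 * K by lra.
  have rho0 : 0 < rho by rewrite lt_min !divr_gt0.
  have rho1 : rho <= r / 4 by rewrite ge_min lexx.
  have rho2 : rho * (4 * K) <= e by rewrite -ler_pdivlMr// ge_min lexx orbT.
  pose M := (Num.truncn (r / rho)).+1.
  have hM : r <= M%:R * rho /\ M%:R * rho <= r + rho.
    have h0 : 0 <= r / rho by rewrite divr_ge0// ltW.
    have /andP[] := truncn_itv h0; rewrite ler_pdivlMr// ltr_pdivrMr// => h1 h2.
    split; first exact: ltW.
    by rewrite /M -natr1 mulrDl mul1r lerD2r.
  pose A' j := A j /\ j.+1%:R^-1 <= e / 2.
  have uA' N : exists2 j, (N <= j)%N & A' j.
    have [j] := uA (maxn N (Num.truncn (2 / e))); rewrite geq_max => /andP[Nj ej] Aj.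
    exists j => //; split=> //.
    have h0 : 0 <= 2 / e by rewrite divr_ge0// ltW.
    have /andP[_ h] := truncn_itv h0.
    rewrite -[leRHS]invrK invf_div lef_pV2 ?posrE ?ltr0n ?divr_gt0//.
    by apply: le_trans (ltW h) _; rewrite ler_nat.
  have [|c [c1 [c2 hc]]] := cluster_point (s := s) (M := M) rho0 (lo := - (r / 2)) uA'.
    by move=> j _; have [h1 h2 _] := hs j; split; lra.
  have cr : `|c| <= r / 2 + rho by rewrite ler_norml; apply/andP; split; lra.
  have hsh l : `|shift t0 i c 0 l - t0 0 l| <= r / 2 + rho.
    rewrite mxE addrAC subrr add0r; case: eqP => _ //.
    by rewrite normr0; lra.
  apply: (IH (J :\ i) (fun j => A' j /\ `|s j - c| <= rho) (shift t0 i c) rho) => //.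
  - by apply/eqP; rewrite -eqSS -cJ (cardsD1 i J) iJ.
  - move=> l; have := ht l; have := hsh l.
    have := ler_normD (shift t0 i c 0 l - t0 0 l) (t0 0 l); rewrite subrK.
    by lra.
  move=> j [[Aj ej] sj] t htt i'; rewrite !inE negb_and negbK => /orP[/eqP -> cov|i'J].
    have [_ _] := hs j; apply; have [d [d' [h1 h2 h3 h4]]] := cov.
    exists d, d'; split=> //.
    pose a l := d 0 l - d' 0 l.
    have -> : \sum_l shift t0 i (s j) 0 l * (d 0 l - d' 0 l) =
       \sum_l t 0 l * a l + \sum_l (shift t0 i (s j) 0 l - t 0 l) * a l.
      by rewrite -big_split /=; apply: eq_bigr => l _; rewrite /a; ring.
    apply: le_trans (ler_normD _ _) _.
    have hh : `|\sum_l (shift t0 i (s j) 0 l - t 0 l) * a l| <= K * (2 * rho * `|a i|).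
      apply: le_trans (ler_norm_sum _ _ _) _.
      have -> : K * (2 * rho * `|a i|) = \sum_(l < k.+1) (2 * rho * `|a i|).
        by rewrite sumr_const card_ord /K mulr_natl.
      apply: ler_sum => l _; rewrite normrM; apply: ler_pM => //; last exact: h3.
      have -> : shift t0 i (s j) 0 l - t 0 l =
          (shift t0 i (s j) 0 l - shift t0 i c 0 l) - (t 0 l - shift t0 i c 0 l) by ring.
      apply: le_trans (ler_normB _ _) _; have := htt l.
      have : `|shift t0 i (s j) 0 l - shift t0 i c 0 l| <= rho.
        rewrite !mxE opprD addrACA subrr add0r; case: eqP => _ //.
        by rewrite subrr normr0 ltW.
      by lra.
    have na : 0 <= `|a i| by [].
    have e1 : j.+1%:R^-1 * `|a i| <= e / 2 * `|a i| by rewrite ler_wpM2r.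
    have e2 : rho * (4 * K) * `|a i| <= e * `|a i| by rewrite ler_wpM2r.
    have {}h4 : `|\sum_l t 0 l * a l| <= j.+1%:R^-1 * `|a i| by exact: h4.
    rewrite -[d 0 i - d' 0 i]/(a i).
    move: h4 hh e1 e2; set N := `|a i|; set w := j.+1%:R^-1; rewrite /w.
    move: (_ * N) => w1 h4 hh e1 e2; lra.
  apply: (hA j Aj) => // l.
  have -> : t 0 l - t0 0 l = (t 0 l - shift t0 i c 0 l) + (shift t0 i c 0 l - t0 0 l) by ring.
  apply: le_trans (ler_normD _ _) _; have := htt l; have := hsh l.
  by lra.
apply: (ind _ [set: 'I_k.+1]%SET (fun=> True) 0 (1 / 2) erefl) => //.
- by move=> l; rewrite mxE normr0; lra.
- by move=> N; exists N.
- by move=> j _ t _ i; rewrite inE.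
Qed.

End Cover.

(** A left endpoint lies between [u] and [w]; the condition is stated in the form that partly
    covered cells satisfy directly. *)
Definition Lcell x (q i : nat) := exists u w : R,
  [/\ i%:R / q%:R <= u, u < w, w <= i.+1%:R / q%:R, U x u & ~ U x w].

Definition lcount x q := #|[set i : 'I_q | `[< Lcell x q i >]]%SET|.

Lemma Lcell_leftend x q i : Lcell x q i -> exists a : R,
  [/\ leftend U x a, i%:R / q%:R <= a & a <= i.+1%:R / q%:R].
Proof.
case=> u [w [iu uw wi Uu nUw]].
pose A := [set y : R | U x y /\ y <= w].
have cA : closed A.
  have c1 : clo (fun y : R => U x y) by apply: (cloU cU); repeat ct_step.
  by change (clo (fun y : R => U x y /\ y <= w)); solve_clo.
have uA : has_ubound A by exists w => y [].
have [Ua aw] : A (sup A).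
  by apply: cA; apply: closure_sup => //; exists u; split=> //; exact: ltW.
have ua : u <= sup A by apply: ub_le_sup => //; split=> //; exact: ltW.
have aw' : sup A < w by rewrite lt_neqAle aw andbT; apply/eqP => e; rewrite e in Ua.
exists (sup A); split; [|lra|lra].
split=> //; exists (w - sup A); split; first by rewrite subr_gt0.
move=> y ay yw Uy; have : y <= sup A by apply: ub_le_sup => //; split=> //; lra.
by rewrite leNgt ay.
Qed.

(** The sums over [k.+1]-tuples of left endpoints lie in [[- K, K]], which has [O(q)] bins of length
    [e / q]. Two different tuples in one bin have sums that differ by less than [e / q], while some
    entries differ by at least [1 / q]. *)
Lemma many_Lcells_cover (k : nat) (e : R) : 0 < e -> exists C, forall x q,
  (C * q < lcount x q ^ k.+1)%N ->
  forall t : 'rV[R]_k.+1, (forall l, `|t 0 l| <= 1) -> exists i, covers x e i t.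
Proof.
move=> e0; pose K : R := k.+1%:R; have K0 : 0 < K by rewrite ltr0n.
pose T := Num.truncn (2 * K / e).
exists (2 ^ k.+1 * T.+2)%N => x q hC t ht.
have q0 : (0 < q)%N.
  case: (posnP q) => // q0; move: hC; rewrite q0 muln0.
  have -> : lcount x 0 = 0%N by apply: eq_card0 => -[].
  by rewrite exp0n.
have q0' : 0 < q%:R :> R by rewrite ltr0n.
pose L : {set 'I_q} := [set i : 'I_q | `[< Lcell x q i >]]%SET.
have /choice[d hd] : forall i : 'I_q, exists a : R, i \in L ->
    [/\ leftend U x a, i%:R / q%:R <= a & a <= i.+1%:R / q%:R].
  move=> i; have [iL|] := boolP (i \in L); last by exists 0.
  by move: iL; rewrite inE => /asboolP/Lcell_leftend[a ha]; exists a.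
(* Cells of one parity are not adjacent, so their left endpoints are at least [1 / q] apart. Halving
   the set costs the factor [2 ^ k.+1]. *)
pose S p : {set 'I_q} := [set i in L | odd i == p]%SET.
have [p hp] : exists p, (#|L| <= 2 * #|S p|)%N.
  have -> : L = S true :|: S false.
    by apply/setP => i; rewrite !inE -andb_orr; case: (odd i); rewrite andbT.
  have h := leq_card_setU (S true) (S false).
  have [h'|h'] := leqP #|S true| #|S false|; [exists false|exists true];
    by apply: leq_trans h _; rewrite mul2n -addnn ?leq_add2r ?leq_add2l// ltnW.
have SL i : i \in S p -> i \in L by rewrite inE => /andP[].
have hS : (T.+2 * q < #|S p| ^ k.+1)%N.
  rewrite -(@ltn_pmul2l (2 ^ k.+1)) ?expn_gt0// -expnMn mulnA.
  by apply: leq_trans hC _; rewrite leq_exp2r.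
pose F (f : {ffun 'I_k.+1 -> 'I_q}) := \sum_l t 0 l * d (f l).
pose beta := e / q%:R; have beta0 : 0 < beta by rewrite divr_gt0.
have FK (f : {ffun 'I_k.+1 -> 'I_q}) : f \in ffun_on (S p) -> `|F f| <= K.
  move=> /ffun_onP hf; apply: le_trans (ler_norm_sum _ _ _) _.
  have -> : K = \sum_(l < k.+1) 1 by rewrite sumr_const card_ord.
  apply: ler_sum => l _; rewrite normrM; apply: mulr_ile1 => //.
  have [[/U01[h1 h2] _] _ _] := hd _ (SL _ (hf l)).
  by rewrite ger0_norm.
have hMb : (Num.truncn (2 * K / beta) < T.+2 * q)%N.
  have h0 : 0 <= 2 * K / e by rewrite divr_ge0//; lra.
  have h1 : 0 <= 2 * K / beta by rewrite divr_ge0//; lra.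
  have /andP[_ hT] := truncn_itv h0; have /andP[hB _] := truncn_itv h1.
  rewrite -(ltr_nat R); apply: le_lt_trans hB _.
  rewrite /beta invf_div mulrA mulrAC natrM ltr_pM2r//.
  by apply: lt_trans hT _; rewrite ltr_nat.
pose n := (T.+2 * q).-1.
have n1 : n.+1 = (T.+2 * q)%N by rewrite prednK// muln_gt0.
pose g (f : {ffun 'I_k.+1 -> 'I_q}) : 'I_n.+1 := inord (Num.truncn ((F f + K) / beta)).
have [f [f' [fS f'S ff' gg]]] : exists f f' : {ffun 'I_k.+1 -> 'I_q},
    [/\ f \in ffun_on (S p), f' \in ffun_on (S p),
    f != f' & g f = g f'].
  apply: contrapT => no.
  have inj : {in ffun_on (S p) &, injective g}.
    move=> f f' fS f'S gg; apply/eqP; apply: contraT => ff'.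
    by exfalso; apply: no; exists f, f'.
  have := leq_card_in _ _ inj; rewrite card_ffun_on card_ord card_ord n1.
  by rewrite leqNgt hS.
have bin (f0 : {ffun 'I_k.+1 -> 'I_q}) : f0 \in ffun_on (S p) ->
    (Num.truncn ((F f0 + K) / beta) < n.+1)%N /\ 0 <= (F f0 + K) / beta.
  move=> /FK; rewrite ler_norml => /andP[h1 h2]; split.
    rewrite n1; apply: leq_ltn_trans hMb; apply: le_truncn.
    by rewrite ler_pM2r ?invr_gt0//; lra.
  by rewrite divr_ge0//; lra.
have FF : `|F f - F f'| < beta.
  have [b1 b2] := bin _ fS; have [b3 b4] := bin _ f'S.
  move: gg => /(congr1 val) /=; rewrite !inordK// => ee.
  have /andP[p1 p2] := truncn_itv b2; have /andP[p3 p4] := truncn_itv b4.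
  rewrite -ee -natr1 in p3 p4; rewrite -natr1 in p2.
  move: p1 p2 p3 p4; rewrite !ler_pdivlMr// !ltr_pdivrMr// !mulrDl mul1r => p1 p2 p3 p4.
  by rewrite ltr_norml; apply/andP; split; lra.
have [l0 hl0] : exists l0, f l0 != f' l0.
  apply: contrapT => no; move/eqP: ff'; apply; apply/ffunP => l; apply/eqP.
  by apply: contraT => h; exfalso; apply: no; exists l.
have [i hi] := ord_argmax (fun l => `|d (f l) - d (f' l)|).
have far (a b : 'I_q) : a \in S p -> b \in S p -> (a < b)%N -> q%:R^-1 <= d b - d a.
  move=> aS bS ab; have [_ _ h1] := hd _ (SL _ aS); have [_ h2 _] := hd _ (SL _ bS).
  have a2b : (a.+2 <= b)%N.
    move: aS bS; rewrite !inE => /andP[_ /eqP oa] /andP[_ /eqP ob].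
    rewrite ltn_neqAle ab andbT; apply/eqP => e1.
    by move: ob; rewrite -e1 /= oa; case: (p).
  have : a.+2%:R / q%:R <= b%:R / q%:R :> R.
    by rewrite ler_pM2r ?invr_gt0// ler_nat.
  move: h1; rewrite -(natr1 a.+1) -(natr1 a) !mulrDl !mul1r; lra.
have /ffun_onP fS' := fS; have /ffun_onP f'S' := f'S.
have hq : q%:R^-1 <= `|d (f i) - d (f' i)|.
  apply: le_trans (hi l0).
  have fl := fS' l0; have f'l := f'S' l0.
  have [h|h|h] := ltngtP (f l0) (f' l0).
  - by rewrite distrC; apply: le_trans (far _ _ fl f'l h) (ler_norm _).
  - by apply: le_trans (far _ _ f'l fl h) (ler_norm _).
  - by case/eqP: hl0; exact: val_inj.
have qi : 0 < q%:R^-1 :> R by rewrite invr_gt0.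
exists i, (\row_l d (f l)), (\row_l d (f' l)); split.
- move=> l; rewrite !mxE; split.
    by have [] := hd _ (SL _ (fS' l)).
  by have [] := hd _ (SL _ (f'S' l)).
- move=> ee; move: hq; rewrite !mxE in ee; rewrite ee subrr normr0.
  by rewrite leNgt qi.
- by move=> l; rewrite !mxE.
rewrite (_ : \sum_l _ = F f - F f'); last first.
  by rewrite /F -sumrB; apply: eq_bigr => l _; rewrite !mxE mulrBr.
apply: le_trans (ltW FF) _; by rewrite !mxE /beta ler_pM2l.
Qed.

Theorem lcount_bound (kappa : nat) :
  exists C, forall x q, (0 < q)%N -> (lcount x q ^ kappa <= C * q)%N.
Proof.
case: kappa => [|k]; first by exists 1%N => x q q0; rewrite expn0 mul1n.
apply: contrapT => no.
have /choice[xs hxs] : forall j : nat, exists x, forall t : 'rV[R]_k.+1,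
    (forall l, `|t 0 l| <= 1) -> exists i, covers x (j.+1%:R^-1) i t.
  move=> j; have e0 : 0 < j.+1%:R^-1 :> R by rewrite invr_gt0 ltr0n.
  have [C hC] := many_Lcells_cover k e0.
  apply: contrapT => no'; apply: no; exists C => x q q0; rewrite leqNgt.
  by apply/negP => /hC h; apply: no'; exists x.
exact: (no_covers hxs).
Qed.

End CountLeftEnds.

(** * Counting grid cells *)

Section Grid.
Variable R : realType.

Lemma baire_interval (T : countType) (Z : T -> R -> Prop) (a b : R) : a < b ->
  (forall t, closed [set v | Z t v]) ->
  (forall v : R, a <= v -> v <= b -> exists t, Z t v) ->
  exists t (c d : R), [/\ a <= c, c < d, d <= b & forall v : R, c <= v -> v <= d -> Z t v].
Proof.
move=> ab cZ hZ; apply: contrapT => no.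
(* Numbers that encode no index get the whole line, which is harmless in an intersection. *)
pose O (n : nat) : set R := match unpickle n with
  | Some t => ~` [set v | Z t v] | None => setT end.
have hO n : open (O n `|` ([set v : R | v < a] `|` [set v : R | b < v])) /\
    dense (O n `|` ([set v : R | v < a] `|` [set v : R | b < v])).
  split.
    apply: openU; last by apply: openU; [exact: open_lt|exact: open_gt].
    by rewrite /O; case: unpickle => [t|]; [exact: closed_openC|exact: openT].
  move=> V [v Vv] oV; apply: contrapT => nV.
  have [vab|nvab] := pselect (a <= v /\ v <= b); last first.
    apply: nV; exists v; split=> //; right.
    have [h|h] := ltP v a; first by left.
    by right; rewrite /= ltNge; apply/negP => h'; apply: nvab.
  case: vab => av vb.
  have hV w : V w -> [/\ a <= w, w <= b & ~ O n w].
    move=> Vw; split.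
    - by rewrite leNgt; apply/negP => h; apply: nV; exists w; split=> //; right; left.
    - by rewrite leNgt; apply/negP => h; apply: nV; exists w; split=> //; right; right.
    - by move=> h; apply: nV; exists w; split=> //; left.
  have /nbhs_ballP[r /= r0 hr] : nbhs v V by apply: open_nbhs_nbhs.
  have hr' (w : R) : v - r / 2 <= w -> w <= v + r / 2 -> V w.
    move=> h1 h2; apply: hr; rewrite /ball /= ltr_norml; apply/andP; split; lra.
  move: hV; rewrite /O; case: unpickle => [t|] hV; last by have [_ _ []] := hV v Vv.
  apply: no; exists t, (v - r / 2), (v + r / 2); split.
  - by have [|h _ _] := hV (v - r / 2); first by apply: hr'; lra.
  - lra.
  - by have [|_ h _] := hV (v + r / 2); first by apply: hr'; lra.
  move=> w h1 h2; have [_ _] := hV w (hr' w h1 h2).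
  by move=> /= /contrapT.
have oab : open (`]a, b[%classic : set R) by exact: interval_open.
have h1 : a < (a + b) / 2 by lra.
have h2 : (a + b) / 2 < b by lra.
have oab0 : (`]a, b[%classic : set R) !=set0.
  by exists ((a + b) / 2); rewrite /= in_itv /= h1.
have [y [/= yab hy]] := Baire hO oab0 oab.
move: yab; rewrite in_itv /= => /andP[ay yb].
have [t Zt] := hZ y (ltW ay) (ltW yb).
have := hy (pickle t) I; rewrite /O pickleK.
by case=> [/(_ Zt)|[/=|/=]]; [|lra|lra].
Qed.

Definition cons_mx n (v : R) (u : 'rV[R]_n) : 'rV[R]_n.+1 :=
  \row_j (if unlift ord0 j is Some l then u 0 l else v).

Lemma cons_mx0 n v (u : 'rV[R]_n) : cons_mx v u 0 ord0 = v.
Proof. by rewrite mxE unlift_none. Qed.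

Lemma cons_mxS n v (u : 'rV[R]_n) l : cons_mx v u 0 (lift ord0 l) = u 0 l.
Proof. by rewrite mxE liftK. Qed.

Definition tail_mx n (y : 'rV[R]_n.+1) : 'rV[R]_n := \row_l y 0 (lift ord0 l).

Lemma cons_tail n (y : 'rV[R]_n.+1) : cons_mx (y 0 ord0) (tail_mx y) = y.
Proof.
apply/rowP => j; case: (unliftP ord0 j) => [l|] ->; last by rewrite cons_mx0.
by rewrite cons_mxS mxE.
Qed.

(** The projection to the coordinates in [I] has interior. Full vectors [z] stand for their
    restrictions to [I], which avoids spaces indexed by a set. *)
Definition hasbox n (S : 'rV[R]_n -> Prop) (I : {set 'I_n}) :=
  exists (a : 'rV[R]_n) (rho : R), 0 < rho /\
    forall z : 'rV[R]_n, (forall j, j \in I -> `|z 0 j - a 0 j| <= rho) ->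
      exists y, S y /\ forall j, j \in I -> y 0 j = z 0 j.

(** This means dimension less than [D], since a box in more coordinates projects to one in [D] of
    them; [nobox 0] means empty. *)
Definition nobox n (D : nat) (S : 'rV[R]_n -> Prop) :=
  forall I : {set 'I_n}, #|I| = D -> ~ hasbox S I.

Definition hits n q (S : 'rV[R]_n -> Prop) (c : {ffun 'I_n -> 'I_q}) :=
  exists y, S y /\ forall j, (c j)%:R / q%:R <= y 0 j /\ y 0 j <= (c j).+1%:R / q%:R.

Definition grid_count n q (S : 'rV[R]_n -> Prop) :=
  #|[set c : {ffun 'I_n -> 'I_q} | `[< hits S c >]]%SET|.

Lemma nobox0 n (S : 'rV[R]_n -> Prop) y : nobox 0 S -> ~ S y.
Proof.
move=> h Sy; apply: (h finset.set0 (cards0 _)).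
by exists 0, 1; split=> // z _; exists y; split=> // j; rewrite inE.
Qed.

Lemma grid_count0 n q (S : 'rV[R]_n -> Prop) : nobox 0 S -> grid_count q S = 0%N.
Proof.
move=> h; apply: eq_card0 => c; rewrite inE; apply/asboolP => -[y [Sy _]].
exact: (nobox0 h Sy).
Qed.

Lemma nobox_tail n D (S : 'rV[R]_n.+1 -> Prop) (S' : 'rV[R]_n -> Prop) :
  (forall u, S' u -> exists v, S (cons_mx v u)) -> nobox D S -> nobox D S'.
Proof.
move=> hS h I cI [a [rho [rho0 ha]]].
apply: (h (lift ord0 @: I)%SET).
  by rewrite card_imset//; exact: lift_inj.
exists (cons_mx 0 a), rho; split=> // z hz.
have [|u [S'u hu]] := ha (tail_mx z).
  move=> j jI; rewrite mxE -(cons_mxS 0 a); apply: hz.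
  by apply: imset_f.
have [v Sv] := hS u S'u; exists (cons_mx v u); split=> // j /imsetP[l lI ->].
by rewrite cons_mxS hu// mxE.
Qed.

(** If every slice over [[a, b]] had a [D]-box, countably many rational boxes would account for all
    heights. The heights belonging to one box form a closed set, by compactness of the cube, so by
    Baire one box serves an interval of heights and becomes a [D.+1]-box. *)
Lemma nobox_slice n D (S : 'rV[R]_n.+1 -> Prop) (a b : R) : a < b ->
  closed [set y | S y] -> (forall y, S y -> forall j, 0 <= y 0 j /\ y 0 j <= 1) ->
  nobox D.+1 S ->
  exists v : R, [/\ a <= v, v <= b & nobox D (fun u => S (cons_mx v u))].
Proof.
move=> ab cS S01 h; apply: contrapT => no.
pose T : countType := ({ffun 'I_n -> bool} * ({ffun 'I_n -> rat} * nat))%type.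
pose K := [set u : 'rV[R]_n | forall l, 0 <= u 0 l /\ u 0 l <= 1].
pose Z (t : T) (v : R) := #|[set l | t.1 l]%SET| = D /\
  forall z : 'rV[R]_n, (forall l, t.1 l -> `|z 0 l - ratr (t.2.1 l)| <= t.2.2.+1%:R^-1) ->
    exists u : 'rV[R]_n, K u /\
      (S (cons_mx v u) /\ forall l, t.1 l -> u 0 l = z 0 l).
have [||t [c [d [ac cd db hZ]]]] := @baire_interval T Z a b ab.
- move=> t; change (clo (fun v : R => Z t v)); rewrite /Z; solve_clo; first exact: clo_true.
  apply: (clo_ex_compact (K := K)).
    exact: cube_compact.
  have cc : clo (fun q : R * 'rV[R]_n => S (cons_mx q.1 q.2)).
    apply: (clo_comp (Q := S) (f := fun q : R * 'rV[R]_n => cons_mx q.1 q.2)) => //.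
    rewrite /cons_mx; apply: ct_row => j; case: (unlift ord0 j) => [l|]; repeat ct_step.
  change (clo (fun q : R * 'rV[R]_n => S (cons_mx q.1 q.2) /\
    forall l, t.1 l -> q.2 0 l = i 0 l)).
  by solve_clo.
- move=> v av vb; apply: contrapT => nZ; apply: no; exists v; split=> // I cI.
  move=> [x [rho [rho0 hx]]]; apply: nZ.
  (* A box of radius [e] around a rational center within [e] of [x] fits into radius [rho] if
     [2 * e <= rho]. *)
  have [k hk] : exists k : nat, 2 * k.+1%:R^-1 <= rho.
    exists (Num.truncn (2 / rho)).
    have h0 : 0 <= 2 / rho by rewrite divr_ge0// ltW.
    have /andP[_ hh] := truncn_itv h0.
    rewrite ler_pdivrMr ?ltr0n// mulrC -ler_pdivrMr//; exact: ltW.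
  have [e ee] : exists e : R, e = k.+1%:R^-1 by exists (k.+1%:R^-1).
  have k0 : 0 < e by rewrite ee invr_gt0 ltr0n.
  rewrite -ee in hk.
  have /choice[w hw] : forall l, exists w : rat, `|x 0 l - ratr w| <= e.
    move=> l; have lt : x 0 l - e < x 0 l + e by lra.
    have [w] := rat_in_itvoo lt; rewrite in_itv /= => /andP[w1 w2]; exists w.
    by rewrite ler_norml; apply/andP; split; lra.
  exists ([ffun l => l \in I], ([ffun l => w l], k)); split=> /=.
    by rewrite -cI; congr #|pred_of_set _|; apply/setP => l; rewrite inE ffunE.
  rewrite -ee => z hz; have [|u [Su hu]] := hx z.
    move=> l lI; have := hz l; rewrite !ffunE => /(_ lI) h1.
    have -> : z 0 l - x 0 l = (z 0 l - ratr (w l)) - (x 0 l - ratr (w l)) by ring.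
    by apply: le_trans (ler_normB _ _) _; have := hw l; lra.
  exists u; split.
    by move=> l; rewrite -(cons_mxS v u); exact: S01.
  by split=> // l; rewrite ffunE; exact: hu.
have [cD _] := hZ c (lexx _) (ltW cd).
pose I : {set 'I_n} := [set l | t.1 l]%SET.
apply: (h (ord0 |: (lift ord0 @: I))%SET).
  rewrite cardsU1 card_imset; last exact: lift_inj.
  rewrite cD; suff -> : (ord0 : 'I_n.+1) \notin (lift ord0 @: I)%SET by [].
  by apply/imsetP => -[l _] /eqP; rewrite eq_liftF.
pose rho := Num.min ((d - c) / 2) (t.2.2.+1%:R^-1).
have rho1 : rho <= (d - c) / 2 by rewrite ge_min lexx.
have rho2 : rho <= t.2.2.+1%:R^-1 by rewrite ge_min lexx orbT.
exists (cons_mx ((c + d) / 2) (\row_l ratr (t.2.1 l))), rho; split.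
  by rewrite lt_min invr_gt0 ltr0n andbT; lra.
move=> z hz.
have := hz ord0 (setU11 _ _); rewrite cons_mx0 ler_norml => /andP[z1 z2].
have [||_ /(_ (tail_mx z))[|u [_ [Su hu]]]] := hZ (z 0 ord0); [lra|lra| |].
  move=> l tl; have /hz : lift ord0 l \in (ord0 |: (lift ord0 @: I))%SET.
    by rewrite !inE; apply/orP; right; apply: imset_f; rewrite inE.
  by rewrite cons_mxS !mxE => h1; apply: le_trans rho2.
exists (cons_mx (z 0 ord0) u); split=> // j; rewrite !inE => /orP[/eqP ->|].
  by rewrite cons_mx0.
by move=> /imsetP[l]; rewrite inE => tl ->; rewrite cons_mxS hu// mxE.
Qed.

End Grid.

(** * Induction on the number of coordinates *)

Section CountBound.
Variables (R : realType) (RR : expansion R).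
Hypothesis hN : ~ defines_nat RR.

Lemma card_pairs (T T' : finType) (A : {set T * T'}) (K : nat) :
  (forall t, #|[set u | (t, u) \in A]%SET| <= K)%N ->
  (#|A| <= #|[set p.1 | p in A]%SET| * K)%N.
Proof.
move=> hK; rewrite -sum1_card.
rewrite (partition_big (fun p : T * T' => p.1) (mem [set p.1 | p in A]%SET)); last first.
  by move=> p pA; apply: imset_f.
rewrite -sum_nat_const; apply: leq_sum => t _.
apply: leq_trans (hK t); rewrite sum1dep_card.
rewrite -(card_imset _ (f := fun u : T' => (t, u))); last by move=> u u' [].
apply: subset_leq_card; apply/fintype.subsetP => -[t' u]; rewrite inE => /andP[pA /eqP /= <-].
by apply: imset_f; rewrite inE.
Qed.

Lemma expn_leq_sum (x y k : nat) : ((x + y) ^ k <= 2 ^ k * (x ^ k + y ^ k))%N.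
Proof.
have [xy|yx] := leqP x y.
  apply: (@leq_trans ((2 * y) ^ k)); first by case: k => // k; rewrite leq_exp2r// mul2n -addnn leq_add2r.
  by rewrite expnMn leq_mul2l leq_addl orbT.
apply: (@leq_trans ((2 * x) ^ k)).
  by case: k => // k; rewrite leq_exp2r// mul2n -addnn leq_add2l ltnW.
by rewrite expnMn leq_mul2l leq_addr orbT.
Qed.

Lemma sqrn_le (X Y M : nat) : (X ^ 2 <= M * Y ^ 2)%N -> (X <= M * Y)%N.
Proof.
move=> h; rewrite -(@leq_exp2r X (M * Y) 2)//; apply: leq_trans h _.
rewrite expnMn leq_mul2r; apply/orP; right.
by case: (M) => // M'; rewrite expnS expn1 leq_pmulr.
Qed.

(** Each factor loses [q ^ (1 / (2 * k))], together [q ^ (1 / k)]: the bounds for the exponent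
    [2 * k] are multiplied and a square root is taken. *)
Lemma column_bound (a b q k D A B : nat) :
  (a ^ (2 * k) * q ^ (2 * k) <= A * q ^ (D * (2 * k) + 1))%N ->
  (b ^ (2 * k) <= B * q)%N -> ((a * b) ^ k * q ^ k <= A * B * q ^ (D * k + 1))%N.
Proof.
move=> h1 h2; apply: sqrn_le.
have -> : ((q ^ (D * k + 1)) ^ 2 = q ^ (D * (2 * k) + 1) * q)%N.
  by rewrite -expnSr -expnM; congr (_ ^ _)%N; lia.
rewrite mulnACA; apply: leq_trans (leq_mul h1 h2).
have e x : (x ^ (2 * k) = (x ^ k) ^ 2)%N by rewrite -expnM mulnC.
by rewrite !e !expnMn mulnAC.
Qed.

Let Lcells (W : R -> Prop) (q : nat) : nat := lcount (fun _ : 'rV[R]_0 => W) 0 q.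

(* The cells of the grid met by [S] are sorted by columns: in a column, the
   cells that are only partly covered by the projection of [S] to the axis are
   few, and the completely covered ones are counted along a suitable slice of
   [S] at each height. *)
Lemma grid_count_step n q (S : 'rV[R]_n.+1 -> Prop) (PS : 'rV[R]_n -> Prop)
  (V : {ffun 'I_n -> 'I_q} -> R -> Prop) (K1 K2 : nat) : (0 < q)%N ->
  (forall v u, S (cons_mx v u) -> PS u) ->
  (forall c v, V c v <-> exists u, S (cons_mx v u) /\
     forall j, (c j)%:R / q%:R <= u 0 j /\ u 0 j <= (c j).+1%:R / q%:R) ->
  (forall c, (Lcells (V c) q + Lcells (fun v => V c (1 - v)%R) q <= K1)%N) ->
  (forall j : 'I_q, exists v : R, [/\ j%:R / q%:R <= v, v <= j.+1%:R / q%:R &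
     (grid_count q (fun u => S (cons_mx v u)) <= K2)%N]) ->
  (grid_count q S <= grid_count q PS * K1 + q * K2)%N.
Proof.
move=> q0 hPS hV hK1 hK2.
have q0' : 0 < q%:R :> R by rewrite ltr0n.
pose tl (c : {ffun 'I_n.+1 -> 'I_q}) : {ffun 'I_n -> 'I_q} := [ffun l => c (lift ord0 l)].
have tl_inj c c' : tl c = tl c' -> c ord0 = c' ord0 -> c = c'.
  move=> e1 e2; apply/ffunP => j; case: (unliftP ord0 j) => [l|] -> //.
  by have := congr1 (fun f : {ffun 'I_n -> 'I_q} => f l) e1; rewrite !ffunE.
pose full (c : {ffun 'I_n -> 'I_q}) (j : 'I_q) := forall v : R,
  j%:R / q%:R <= v -> v <= j.+1%:R / q%:R -> V c v.
pose H : {set {ffun 'I_n.+1 -> 'I_q}} := [set c | `[< hits S c >]]%SET.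
pose F : {set {ffun 'I_n.+1 -> 'I_q}} := [set c | `[< full (tl c) (c ord0) >]]%SET.
have hitV c : c \in H -> exists v : R, [/\ (c ord0)%:R / q%:R <= v,
    v <= (c ord0).+1%:R / q%:R, V (tl c) v & hits PS (tl c)].
  rewrite inE => /asboolP[y [Sy hy]]; exists (y 0 ord0).
  have [h1 h2] := hy ord0.
  have Sy' : S (cons_mx (y 0 ord0) (tail_mx y)) by rewrite cons_tail.
  have ht j : (tl c j)%:R / q%:R <= tail_mx y 0 j /\ tail_mx y 0 j <= (tl c j).+1%:R / q%:R.
    by rewrite mxE ffunE; exact: hy.
  split=> //; first by apply/hV; exists (tail_mx y).
  by exists (tail_mx y); split=> //; exact: hPS Sy'.
have -> : grid_count q S = (#|H :\: F| + #|H :&: F|)%N by rewrite addnC cardsID.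
apply: leq_add.
  pose phi c := (tl c, c ord0).
  have phi_inj : injective phi by move=> c c' [e1 e2]; exact: tl_inj.
  rewrite -(card_imset _ phi_inj).
  apply: leq_trans (card_pairs (K := K1) _) _.
    move=> c; apply: leq_trans (hK1 c).
    pose Lc (W : R -> Prop) : {set 'I_q} :=
      [set i : 'I_q | `[< Lcell (fun _ : 'rV[R]_0 => W) 0 q i >]]%SET.
    have -> : Lcells (fun v => V c (1 - v)) q =
        #|[set rev_ord i | i in Lc (fun v => V c (1 - v)%R)]%SET|.
      by rewrite card_imset//; exact: rev_ord_inj.
    apply: leq_trans (leq_card_setU _ _); apply: subset_leq_card; apply/fintype.subsetP => j.
    rewrite inE => /imsetP[c0]; rewrite !inE => /andP[nF c0H] [ce je].
    have [v [v1 v2 Vv _]] : exists v : R, [/\ (c0 ord0)%:R / q%:R <= v,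
        v <= (c0 ord0).+1%:R / q%:R, V (tl c0) v & hits PS (tl c0)].
      by apply: hitV; rewrite inE.
    have [w [w1 w2 nVw]] : exists w : R, [/\ j%:R / q%:R <= w, w <= j.+1%:R / q%:R & ~ V c w].
      apply: contrapT => no; move: nF => /asboolP; apply => w w1 w2.
      by apply: contrapT => nV; apply: no; exists w; rewrite ce je.
    rewrite -ce -je in v1 v2 Vv.
    (* A missing height above a covered one marks a cell with a left endpoint; a missing height
       below it does so after the reflection [v -> 1 - v], which reverses the cells. *)
    have [vw|wv|e] := ltrgtP v w; last by rewrite e in Vv.
      apply/orP; left; apply/asboolP; exists v, w; split=> //.
    apply/orP; right; apply/imsetP; exists (rev_ord j); last by rewrite rev_ordK.
    rewrite inE; apply/asboolP; exists (1 - v), (1 - w).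
    have jq : (j < q)%N by [].
    have r1 : (rev_ord j)%:R / q%:R = 1 - j.+1%:R / q%:R :> R.
      by rewrite /= natrB// mulrBl divff// gt_eqF.
    have r2 : (rev_ord j).+1%:R / q%:R = 1 - j%:R / q%:R :> R.
      by rewrite /= subnSK// natrB ?(ltnW jq)// mulrBl divff// gt_eqF.
    rewrite r1 r2 !subKr; split=> //; lra.
  rewrite leq_mul2r; apply/orP; right.
  apply: subset_leq_card; apply/fintype.subsetP => c /imsetP[p /imsetP[c0]].
  rewrite !inE => /andP[_ c0H] -> ->.
  have [v [_ _ _ h]] : exists v : R, [/\ (c0 ord0)%:R / q%:R <= v,
      v <= (c0 ord0).+1%:R / q%:R, V (tl c0) v & hits PS (tl c0)].
    by apply: hitV; rewrite inE.
  exact: h.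
pose psi (c : {ffun 'I_n.+1 -> 'I_q}) := (c ord0, tl c).
have psi_inj : injective psi by move=> c c' [e1 e2]; exact: tl_inj.
rewrite -(card_imset _ psi_inj).
apply: leq_trans (card_pairs (K := K2) _) _.
  move=> j; have [v [v1 v2 hv]] := hK2 j; apply: leq_trans hv.
  apply: subset_leq_card; apply/fintype.subsetP => c; rewrite inE => /imsetP[c0].
  rewrite !inE => /andP[_ /asboolP hf] [je ce].
  have := hf v; rewrite -ce -je => /(_ v1 v2) /hV[u [Su hu]].
  by exists u.
rewrite leq_mul2r; apply/orP; right.
by apply: leq_trans (max_card _) _; rewrite card_ord.
Qed.

(** As [nobox D] means dimension at most [D - 1], the count has exponent [D - 1 + 1 / kappa].
    Placing [q ^ kappa] on the left avoids the subtraction, and powers avoid roots. *)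
Theorem grid_count_bound n : forall m (P : 'rV[R]_m -> 'rV[R]_n -> Prop),
  def RR (fun p : 'rV[R]_m * 'rV[R]_n => P p.1 p.2) ->
  closed [set p : 'rV[R]_m * 'rV[R]_n | P p.1 p.2] ->
  (forall x y, P x y -> forall j, 0 <= y 0 j /\ y 0 j <= 1) ->
  forall D kappa, exists C, forall x q, (0 < q)%N -> nobox D (P x) ->
    (grid_count q (P x) ^ kappa * q ^ kappa <= C * q ^ (D * kappa + 1))%N.
Proof.
elim: n => [|n IH] m P dP cP P01 D kappa.
  exists 1%N => x q q0 hx; rewrite mul1n; case: D hx => [|D] hx.
    rewrite grid_count0//; case: kappa => [|k]; first by rewrite !expn0 expn1.
    by rewrite exp0n// mul0n.
  have h : (grid_count q (P x) <= 1)%N.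
    by apply: leq_trans (max_card _) _; rewrite card_ffun !card_ord expn0.
  apply: (@leq_trans (1 * q ^ kappa)).
    rewrite leq_mul2r; apply/orP; right.
    by rewrite -(exp1n kappa); case: kappa => // k; rewrite leq_exp2r.
  by rewrite mul1n leq_pexp2l// mulSn -addnA leq_addr.
case: D => [|D].
  exists 1%N => x q q0 hx; rewrite mul1n grid_count0//.
  by case: kappa => [|k]; rewrite ?expn0 ?expn1// exp0n// mul0n.
pose K := [set u : 'rV[R]_n | forall j, 0 <= u 0 j /\ u 0 j <= 1].
pose P1 x (u : 'rV[R]_n) := exists v : R, (0 <= v /\ v <= 1) /\ P x (cons_mx v u).
pose px (z : 'rV[R]_(m + 1)) : 'rV[R]_m := \row_j z 0 (lshift 1 j).
(* The height of a slice becomes a parameter, so one constant serves all slices. *)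
pose P2 (z : 'rV[R]_(m + 1)) (u : 'rV[R]_n) := P (px z) (cons_mx (z 0 (rshift m 0)) u).
pose pz (z : 'rV[R]_(m + (n + 1))) : 'rV[R]_m := \row_j z 0 (lshift (n + 1) j).
(* The heights of [P x] over a box whose corner and side are parameters, so that the bound on left
   endpoints is uniform over all cells and all [q]. *)
pose U (z : 'rV[R]_(m + (n + 1))) (v : R) := exists u : 'rV[R]_n, K u /\
  ((forall j, z 0 (rshift m (lshift 1 j)) <= u 0 j /\
     u 0 j <= z 0 (rshift m (lshift 1 j)) + z 0 (rshift m (rshift n 0))) /\
   P (pz z) (cons_mx v u)).
pose U' (z : 'rV[R]_(m + (n + 1))) (v : R) := U z (1 - v).
have ccons : continuous (fun p : R * 'rV[R]_n => cons_mx p.1 p.2).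
  by rewrite /cons_mx; apply: ct_row => j; case: (unlift ord0 j) => [l|]; repeat ct_step.
have cPc (X : topologicalType) (f : X -> 'rV[R]_m) (g : X -> R) (h : X -> 'rV[R]_n) :
    continuous f -> continuous g -> continuous h -> clo (fun x => P (f x) (cons_mx (g x) (h x))).
  move=> df dg dh.
  apply: (clo_comp (Q := fun p : 'rV[R]_m * 'rV[R]_n.+1 => P p.1 p.2)
    (f := fun x => (f x, cons_mx (g x) (h x)))) => //.
  apply: ct_pair => //.
  apply: (ct_comp (g := fun p : R * 'rV[R]_n => cons_mx p.1 p.2) (f := fun x => (g x, h x))) => //.
  exact: ct_pair.
have [C1 hC1] : exists C, forall x q, (0 < q)%N -> nobox D.+1 (P1 x) ->
    (grid_count q (P1 x) ^ (2 * kappa) * q ^ (2 * kappa) <= C * q ^ (D.+1 * (2 * kappa) + 1))%N.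
  apply: IH.
  - by rewrite /P1; dfn; case: (unlift _ _) => [l|]; dfn.
  - apply: (clo_ex_compact (K := [set v : R | 0 <= v /\ v <= 1])).
      exact: Icc_compact.
    by apply: cPc; repeat ct_step.
  - move=> x u [v [_ /P01 h]] j; rewrite -(cons_mxS v u); exact: h.
have [C2 hC2] : exists C, forall z q, (0 < q)%N -> nobox D (P2 z) ->
    (grid_count q (P2 z) ^ kappa * q ^ kappa <= C * q ^ (D * kappa + 1))%N.
  apply: IH.
  - by rewrite /P2 /px; dfn; case: (unlift _ _) => [l|]; dfn.
  - by apply: cPc; rewrite /px; repeat ct_step.
  - move=> z u /P01 h j; rewrite -(cons_mxS (z 0 (rshift m 0)) u); exact: h.
have dU : def RR (fun p : 'rV[R]_(m + (n + 1)) * R => U p.1 p.2).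
  have dK : def RR (fun u : 'rV[R]_n => K u).
    by change (def RR (fun u : 'rV[R]_n => forall j, 0 <= u 0 j /\ u 0 j <= 1)); dfn.
  by rewrite /U /pz; dfn; case: (unlift _ _) => [l|]; dfn.
have cU : closed [set p : 'rV[R]_(m + (n + 1)) * R | U p.1 p.2].
  apply: (clo_ex_compact (K := K)); first exact: cube_compact.
  change (clo (fun q : 'rV[R]_(m + (n + 1)) * R * 'rV[R]_n =>
    (forall j, q.1.1 0 (rshift m (lshift 1 j)) <= q.2 0 j /\
      q.2 0 j <= q.1.1 0 (rshift m (lshift 1 j)) + q.1.1 0 (rshift m (rshift n 0))) /\
    P (pz q.1.1) (cons_mx q.1.2 q.2))).
  by solve_clo; apply: cPc; rewrite /pz; repeat ct_step.
have U01 z (v : R) : U z v -> 0 <= v /\ v <= 1.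
  case=> u [_ [_ /P01 /(_ ord0)]]; by rewrite cons_mx0.
have [C3 hC3] := lcount_bound hN dU cU U01 (2 * kappa).
have [C4 hC4] : exists C, forall x q, (0 < q)%N -> (lcount U' x q ^ (2 * kappa) <= C * q)%N.
  apply: (lcount_bound hN).
  - by rewrite /U'; dfn.
  - apply: (clo_comp (Q := fun p : 'rV[R]_(m + (n + 1)) * R => U p.1 p.2)
      (f := fun p : 'rV[R]_(m + (n + 1)) * R => (p.1, 1 - p.2))) => //.
    by repeat ct_step.
  - by move=> z v /U01[h1 h2]; split; lra.
exists (2 ^ kappa * ((C1 * (2 ^ (2 * kappa) * (C3 + C4))) + C2))%N => x q q0 hx.
have q0' : 0 < q%:R :> R by rewrite ltr0n.
pose zc (c : {ffun 'I_n -> 'I_q}) : 'rV[R]_(m + (n + 1)) :=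
  row_mx x (row_mx (\row_j ((c j)%:R / q%:R)) (const_mx (q%:R^-1))).
have zcE c : pz (zc c) = x by apply/rowP => j; rewrite mxE row_mxEl.
have UE c v : U (zc c) v <-> exists u, P x (cons_mx v u) /\
     forall j, (c j)%:R / q%:R <= u 0 j /\ u 0 j <= (c j).+1%:R / q%:R.
  have e1 j : zc c 0 (rshift m (lshift 1 j)) = (c j)%:R / q%:R.
    by rewrite row_mxEr row_mxEl mxE.
  have e2 : zc c 0 (rshift m (rshift n 0)) = q%:R^-1.
    by rewrite row_mxEr row_mxEr mxE.
  have e3 j : (c j).+1%:R / q%:R = (c j)%:R / q%:R + q%:R^-1 :> R.
    by rewrite -natr1 mulrDl mul1r.
  rewrite /U zcE e2; split.
    by case=> u [_ [hu Pu]]; exists u; split=> // j; rewrite e3 -e1.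
  case=> u [Pu hu]; exists u; split.
    by move=> j; rewrite -(cons_mxS v u); exact: (P01 _ _ Pu).
  by split=> // j; rewrite e1 -e3.
pose K1 := \max_(c : {ffun 'I_n -> 'I_q}) (lcount U (zc c) q + lcount U' (zc c) q)%N.
have cq : (0 < #|{ffun 'I_n -> 'I_q}|)%N by rewrite card_ffun !card_ord expn_gt0 q0.
have [c1 K1E] : {c | K1 = (lcount U (zc c) q + lcount U' (zc c) q)%N}.
  exact: bigop.eq_bigmax.
have hK1 : (K1 ^ (2 * kappa) <= 2 ^ (2 * kappa) * (C3 + C4) * q)%N.
  rewrite K1E; apply: leq_trans (expn_leq_sum _ _ _) _.
  rewrite -mulnA leq_mul2l; apply/orP; right.
  by rewrite mulnDl leq_add ?hC3 ?hC4.
have cPx : closed [set y | P x y].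
  apply: (clo_comp (Q := fun p : 'rV[R]_m * 'rV[R]_n.+1 => P p.1 p.2) (f := fun y => (x, y))) => //.
  by repeat ct_step.
have /choice[vv hvv] : forall j : 'I_q, exists v : R, [/\ j%:R / q%:R <= v,
    v <= j.+1%:R / q%:R & nobox D (fun u => P x (cons_mx v u))].
  move=> j; apply: nobox_slice => //; last by move=> y; exact: P01.
  by rewrite ltr_pM2r ?invr_gt0// ltr_nat.
pose K2 := \max_(j < q) grid_count q (fun u => P x (cons_mx (vv j) u)).
have cq' : (0 < #|'I_q|)%N by rewrite card_ord.
have [j2 K2E] : {j | K2 = grid_count q (fun u => P x (cons_mx (vv j) u))}.
  exact: bigop.eq_bigmax.
have hK2 : (K2 ^ kappa * q ^ kappa <= C2 * q ^ (D * kappa + 1))%N.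
  have [_ _ nb] := hvv j2.
  have := hC2 (row_mx x (const_mx (vv j2))) q q0.
  rewrite /P2 (_ : px _ = x); last by apply/rowP => j; rewrite mxE row_mxEl.
  by rewrite row_mxEr mxE K2E; apply.
have hP1 : nobox D.+1 (P1 x).
  by apply: nobox_tail hx => u [v [_ h]]; exists v.
have := @grid_count_step n q (P x) (P1 x) (fun c => U (zc c)) K1 K2 q0.
move=> /(_ _ UE _ _) step.
have {}step : (grid_count q (P x) <= grid_count q (P1 x) * K1 + q * K2)%N.
  apply: step.
  - move=> v u h; exists v; split=> //; have := P01 _ _ h ord0; by rewrite cons_mx0.
  - move=> c; exact: (leq_bigmax c).
  - move=> j; have [h1 h2 _] := hvv j; exists (vv j); split=> //.
    exact: (leq_bigmax j).
apply: (@leq_trans ((grid_count q (P1 x) * K1 + q * K2) ^ kappa * q ^ kappa)).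
  by rewrite leq_mul2r; apply/orP; right; case: (kappa) => // k; rewrite leq_exp2r.
apply: (@leq_trans (2 ^ kappa * ((grid_count q (P1 x) * K1) ^ kappa + (q * K2) ^ kappa) * q ^ kappa)).
  by rewrite leq_mul2r expn_leq_sum orbT.
rewrite -!mulnA leq_mul2l; apply/orP; right.
rewrite !mulnDl; apply: leq_add.
  exact: column_bound (hC1 x q q0 hP1) hK1.
rewrite expnMn -mulnA.
apply: (@leq_trans (q ^ kappa * (C2 * q ^ (D * kappa + 1)))).
  by rewrite leq_mul2l hK2 orbT.
by rewrite mulnCA -expnD mulSn addnA.
Qed.

End CountBound.

(** * Nets in the fibers *)

Section SupNorm.
Variables (R : realType) (n : nat).
Implicit Types x : 'rV[R]_n.

Lemma rV_norm_lt x (r : R) : 0 < r -> `|x| < r <-> forall j, `|x 0 j| < r.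
Proof.
move=> r0; have -> : (`|x| < r : Prop) = ball (0 : 'rV[R]_n) r x.
  by rewrite -ball_normE /ball_ /= sub0r normrN.
split=> [[_ h] j|h].
  by have := h 0 j; rewrite /ball /= mxE sub0r normrN.
by split=> // i j; rewrite /ball /= mxE sub0r normrN ord1.
Qed.

Lemma entry_le_norm x j : `|x 0 j| <= `|x|.
Proof.
rewrite leNgt; apply/negP => h.
have r0 : 0 < `|x 0 j| by apply: le_lt_trans h.
by have /(_ j) := (rV_norm_lt x r0).1 h; rewrite ltxx.
Qed.

End SupNorm.

Section BoundedFamily.
Variables (R : realType) (RR : expansion R).
Variables (m n N : nat) (hmn : (m <= n)%N).
Variables (F : set 'rV[R]_N) (lam : 'I_n -> 'I_N) (K : R).

Definition joined (x : 'rV[R]_m) (y : 'rV[R]_(n - m)) (i : 'I_n) : R :=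
  match fintype.split (cast_ord (esym (subnKC hmn)) i) with
  | inl a => x 0 a
  | inr b => y 0 b
  end.

Lemma fiberE x y :
  fiber hmn (coord_proj lam @` F) x y <->
  exists w : 'rV[R]_N, F w /\ forall i, w 0 (lam i) = joined x y i.
Proof.
have e i : castmx (erefl 1%N, subnKC hmn) (row_mx x y) 0 i = joined x y i.
  by rewrite castmxE mxE /joined; case: fintype.split => a; rewrite cast_ord_id.
split=> [[w Fw wE]|[w [Fw wE]]].
  by exists w; split=> // i; rewrite -e -wE mxE.
by exists w => //; apply/rowP => i; rewrite e -wE mxE.
Qed.

(** From the unit cube, where cells are counted, to the cube of side [2 * K] that contains the
    fibers. *)
Definition unscaled (y : 'rV[R]_(n - m)) : 'rV[R]_(n - m) :=
  \row_b (2 * K * y 0 b - K).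

(* The additional parameter [z 0 ord0] is a bound on the witness [w], which is
   scaled to the unit cube: this makes the family closed. *)
Definition fiber_family (z : 'rV[R]_m.+1) (y : 'rV[R]_(n - m)) : Prop :=
  (forall j, 0 <= y 0 j /\ y 0 j <= 1) /\
  exists w : 'rV[R]_N, (forall l, -1 <= w 0 l /\ w 0 l <= 1) /\
    (F (\row_l (z 0 ord0 * w 0 l)) /\
     forall i, z 0 ord0 * w 0 (lam i) = joined (tail_mx z) (unscaled y) i).

Hypothesis N0 : (0 < N)%N.

Lemma fiber_family_def : definable RR F ->
  def RR (fun p : 'rV[R]_m.+1 * 'rV[R]_(n - m) => fiber_family p.1 p.2).
Proof.
move=> dF; have dF' : def RR F by apply/defP.
rewrite /fiber_family /joined /unscaled /tail_mx; dfn.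
by case: fintype.split => a; dfn.
Qed.

Lemma fiber_family_closed : closed F ->
  closed [set p : 'rV[R]_m.+1 * 'rV[R]_(n - m) | fiber_family p.1 p.2].
Proof.
move=> cF.
change (clo (fun p : 'rV[R]_m.+1 * 'rV[R]_(n - m) => fiber_family p.1 p.2)).
rewrite /fiber_family; apply: clo_and; first by solve_clo.
apply: (clo_ex_compact (K := [set w : 'rV[R]_N | forall l, -1 <= w 0 l /\ w 0 l <= 1])).
  exact: cube_compact.
rewrite /joined /unscaled /tail_mx.
apply: clo_and.
  apply: (clo_comp (Q := F)
    (f := fun p : ('rV[R]_m.+1 * 'rV[R]_(n - m)) * 'rV[R]_N =>
       \row_l (p.1.1 0 ord0 * p.2 0 l))) => //.
  by repeat ct_step.
solve_clo.
by case: fintype.split => a; repeat ct_step.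
Qed.

Lemma fiber_family_sub (x : 'rV[R]_m) (kappa : R) y :
  fiber_family (cons_mx kappa x) y ->
  fiber hmn (coord_proj lam @` F) x (unscaled y).
Proof.
move=> [_ [w [_ [Fw wE]]]]; apply/fiberE.
rewrite cons_mx0 in Fw wE.
exists (\row_l (kappa * w 0 l)); split=> // i.
rewrite mxE wE /joined; case: fintype.split => // a.
by rewrite mxE cons_mxS.
Qed.

(** A point belongs to the family for all large bounds on the witness, so finitely many points of a
    fiber can share one bound. *)
Lemma fiber_familyI (x : 'rV[R]_m) (y : 'rV[R]_(n - m)) : 0 < K ->
  (forall b, - K <= y 0 b /\ y 0 b <= K) ->
  fiber hmn (coord_proj lam @` F) x y ->
  exists B : R, forall kappa, B <= kappa ->
    fiber_family (cons_mx kappa x) (\row_b ((y 0 b + K) / (2 * K))).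
Proof.
move=> K0 hy /fiberE[w [Fw wE]].
exists (1 + `|w|) => kappa hk.
have k0 : 0 < kappa by apply: lt_le_trans hk; rewrite ltr_pwDl.
have K2 : 0 < 2 * K by lra.
split.
  move=> b; rewrite mxE; have [h1 h2] := hy b.
  by split; [apply: divr_ge0|rewrite ler_pdivrMr//]; lra.
exists (\row_l (w 0 l / kappa)); rewrite cons_mx0; split.
  move=> l; rewrite mxE; apply/andP; rewrite -ler_norml normrM normfV.
  rewrite (gtr0_norm k0) ler_pdivrMr// mul1r.
  by have := entry_le_norm w l; lra.
have wk l : kappa * (w 0 l / kappa) = w 0 l by rewrite mulrC divfK// gt_eqF.
split.
  by rewrite (_ : \row_l _ = w)//; apply/rowP => l; rewrite !mxE wk.
move=> i; rewrite mxE wk wE /joined; case: fintype.split => a.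
  by rewrite mxE cons_mxS.
by rewrite !mxE; field; rewrite gt_eqF.
Qed.

End BoundedFamily.

(** * Boxes, projections and separated points *)

Section ProjDim.
Variable R : realType.

(** Links boxes, indexed by sets of coordinates, to the increasing maps in [proj_dim]. *)
Lemma increasing_enum n (I : {set 'I_n}) :
  exists lam : 'I_#|I| -> 'I_n, strictly_increasing lam /\ forall k, lam k \in I.
Proof.
exists (fun k => enum_val k); split; last by move=> k; exact: enum_valP.
move=> i j ij.
have srt : sorted (fun a b : 'I_n => (a < b)%N) (enum I).
  rewrite /enum_mem; apply: sorted_filter; first by move=> a b c; apply: ltn_trans.
  rewrite -enumT.
  have := iota_ltn_sorted 0 n; rewrite -val_enum_ord sorted_map.
  by [].
rewrite (enum_val_nth (enum_val i)) (enum_val_nth (enum_val i) j).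
have tr : transitive (fun a b : 'I_n => (a < b)%N) by move=> a b c; apply: ltn_trans.
by apply: (sorted_ltn_nth tr _ srt) => //; rewrite inE -cardE ltn_ord.
Qed.

Lemma hasbox_proj_dim n (S : set 'rV[R]_n) (I : {set 'I_n}) :
  hasbox S I -> ((#|I|%:R : R)%:E <= proj_dim S)%E.
Proof.
move=> [a [rho [rho0 h]]]; apply: ereal_sup_ubound; exists #|I| => //.
have [lam [inc lamI]] := increasing_enum I; exists lam; split=> //.
have inj : injective lam.
  move=> i j e; apply: val_inj; case: (ltngtP i j) => // /inc; rewrite e ltnn//.
exists (coord_proj lam a); apply/nbhs_ballP; exists rho => //= z [_ hz].
pose z' : 'rV[R]_n := \row_j (if [pick k | lam k == j] is Some k then z 0 k else a 0 j).
have [|y [Sy yz]] := h z'.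
  move=> j _; rewrite mxE; case: pickP => [k /eqP <-|_]; last by rewrite subrr normr0 ltW.
  by have := hz 0 k; rewrite /ball /= mxE distrC => /ltW.
exists y => //; apply/rowP => k; rewrite mxE yz// mxE.
case: pickP => [k' /eqP /inj ->|/(_ k)] //; by rewrite eqxx.
Qed.

Lemma hasbox_scale n (S S' : set 'rV[R]_n) (I : {set 'I_n}) (c b : R) : 0 < c ->
  (forall y, S y -> S' (\row_j (c * y 0 j - b))) -> hasbox S I -> hasbox S' I.
Proof.
move=> c0 hS [a [rho [rho0 h]]].
exists (\row_j (c * a 0 j - b)), (c * rho); split; first exact: mulr_gt0.
move=> z hz; have [|y [Sy yz]] := h (\row_j ((z 0 j + b) / c)).
  move=> j jI; have := hz j jI; rewrite !mxE.
  have -> : z 0 j - (c * a 0 j - b) = c * ((z 0 j + b) / c - a 0 j).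
    by field; rewrite gt_eqF.
  by rewrite normrM (gtr0_norm c0) ler_pM2l.
exists (\row_j (c * y 0 j - b)); split; first exact: hS.
by move=> j jI; rewrite mxE yz// mxE; field; rewrite gt_eqF.
Qed.

Lemma cell_exists (q : nat) (t : R) : (0 < q)%N -> 0 <= t -> t <= 1 ->
  exists k : 'I_q, k%:R / q%:R <= t /\ t <= k.+1%:R / q%:R.
Proof.
move=> q0 t0 t1; have q0' : 0 < q%:R :> R by rewrite ltr0n.
have h0 : 0 <= t * q%:R by apply: mulr_ge0 => //; exact: ltW.
have /andP[h1 h2] := truncn_itv h0.
have [kq|qk] := ltnP (Num.truncn (t * q%:R)) q.
  by exists (Ordinal kq); rewrite ler_pdivrMr// ler_pdivlMr//=; split=> //; exact: ltW.
(* The remaining case is [t = 1], which belongs to the last closed cell. *)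
have q1 : (q.-1 < q)%N by rewrite prednK.
have tq : t * q%:R = q%:R.
  apply/eqP; rewrite eq_le; apply/andP; split.
    by rewrite -[leRHS]mul1r ler_pM2r.
  by apply: le_trans h1; rewrite ler_nat.
exists (Ordinal q1); rewrite ler_pdivrMr// ler_pdivlMr//= tq prednK//; split=> //.
by rewrite ler_nat leq_pred.
Qed.

(** Points in a common cell are at distance at most [1 / q < e], so separated points lie in
    different cells. *)
Lemma separated_grid_count n q (S : 'rV[R]_n -> Prop) k (x : 'I_k -> 'rV[R]_n) (e : R) :
  (0 < q)%N -> q%:R^-1 < e ->
  (forall i, S (x i)) -> (forall i j, 0 <= x i 0 j /\ x i 0 j <= 1) ->
  (forall i j, i != j -> e <= `|x i - x j|) -> (k <= grid_count q S)%N.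
Proof.
move=> q0 qe Sx x01 sep.
have /choice[c hc] : forall i, exists c : {ffun 'I_n -> 'I_q}, forall j,
    (c j)%:R / q%:R <= x i 0 j /\ x i 0 j <= (c j).+1%:R / q%:R.
  move=> i; have /choice[c hc] : forall j, exists c : 'I_q,
      c%:R / q%:R <= x i 0 j /\ x i 0 j <= c.+1%:R / q%:R.
    by move=> j; have [h1 h2] := x01 i j; exact: cell_exists.
  by exists [ffun j => c j] => j; rewrite ffunE.
have e0 : 0 < e by apply: lt_trans qe; rewrite invr_gt0 ltr0n.
have inj : injective c.
  move=> i j cij; apply/eqP; apply: contrapT => /negP /sep; apply/negP.
  rewrite -ltNge; apply/rV_norm_lt => // l; rewrite !mxE.
  have [h1 h2] := hc i l; have [h3 h4] := hc j l.
  rewrite cij in h1 h2; rewrite -natr1 mulrDl mul1r in h2 h4.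
  by rewrite ltr_norml; apply/andP; split; lra.
rewrite -[k]card_ord -cardsT -(card_imset _ inj); apply: subset_leq_card.
apply/fintype.subsetP => _ /imsetP[i _ ->]; rewrite inE; apply/asboolP.
by exists (x i).
Qed.

End ProjDim.

(** * From cell counts to the upper Minkowski dimension *)

Section Final.
Variables (R : realType) (RR : expansion R).
Hypothesis hN : ~ defines_nat RR.

Lemma fiber_separated_bound (m n N : nat) (hmn : (m <= n)%N) (F : set 'rV[R]_N)
    (lam : 'I_n -> 'I_N) (K : R) (d kappa : nat) : (0 < N)%N -> definable RR F -> closed F ->
  0 < K -> (forall x y, fiber hmn (coord_proj lam @` F) x y ->
    forall b, - K <= y 0 b /\ y 0 b <= K) ->
  exists C : nat, forall x,
    proj_dim (fiber hmn (coord_proj lam @` F) x) = (d%:R : R)%:E ->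
    forall (r : R) q k (y : 'I_k -> 'rV[R]_(n - m)), (0 < q)%N -> 2 * K < r * q%:R ->
      (forall i, fiber hmn (coord_proj lam @` F) x (y i)) ->
      (forall i j, i != j -> r <= `|y i - y j|) ->
      (k ^ kappa <= C * q ^ (d * kappa + 1))%N.
Proof.
move=> N0 dF cF K0 hK.
have [C hC] := grid_count_bound hN (fiber_family_def hmn lam K N0 dF)
  (fiber_family_closed (hmn := hmn) (lam := lam) (K := K) cF) (fun _ _ h => h.1) d.+1 kappa.
exists C => x dx r q k y q0 rq Fy sep.
have K2 : 0 < 2 * K by lra.
have q0' : 0 < q%:R :> R by rewrite ltr0n.
have r0 : 0 < r.
  by rewrite -(pmulr_lgt0 r q0'); apply: lt_trans rq.
pose u i := \row_b ((y i 0 b + K) / (2 * K)).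
have /choice[B hB] : forall i, exists B : R, forall c, B <= c ->
    fiber_family hmn F lam K (cons_mx c x) (u i).
  by move=> i; apply: fiber_familyI => //; exact: hK (Fy i).
(* A bound on the witnesses of all the points at once; it depends on the points, but [C] does not
   depend on it. *)
pose c := \sum_i `|B i|.
have Bc i : B i <= c.
  apply: le_trans (ler_norm _) _; rewrite /c (bigD1 i)//= lerDl.
  by apply: sumr_ge0.
have nb : nobox d.+1 (fiber_family hmn F lam K (cons_mx c x)).
  move=> I cI hb.
  have := hasbox_proj_dim (hasbox_scale K2 (@fiber_family_sub _ _ _ _ hmn F lam K x c) hb).
  by rewrite cI dx lee_fin ler_nat ltnn.
have kq : (k <= grid_count q (fiber_family hmn F lam K (cons_mx c x)))%N.
  apply: (separated_grid_count (x := u) (e := r / (2 * K))) => //.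
  - by rewrite ltr_pdivlMr// mulrC ltr_pdivrMr.
  - by move=> i; apply: hB.
  - by move=> i; have [] := hB i _ (Bc i).
  move=> i j /sep; rewrite ler_pdivrMr//.
  suff -> : `|y i - y j| = `|u i - u j| * (2 * K) by [].
  rewrite mulrC -[X in X * `|_|](gtr0_norm K2) -normrZ; congr `|_|; apply/rowP => b.
  by rewrite !mxE; field; rewrite gt_eqF.
have := hC (cons_mx c x) q q0 nb.
have -> : (d.+1 * kappa + 1 = (d * kappa + 1) + kappa)%N by rewrite mulSn -addnA addnC.
rewrite expnD mulnA leq_pmul2r ?expn_gt0 ?q0// => h.
apply: leq_trans h; by case: (kappa) => // l; rewrite leq_exp2r.
Qed.

Lemma net_ge0 n (r : R) (S : set 'rV[R]_n) : (0 <= net r S)%E.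
Proof.
apply: ereal_sup_ubound; exists 0%N => //; exists (fun _ => 0).
by split=> [[]|[]].
Qed.

(** A grid with [q <= (2 * K + 1) / r] cells per side separates the net; taking logarithms leaves a
    bound linear in [- ln r], with [M] independent of the fiber and of [r]. *)
Lemma fiber_net_bound (m n N : nat) (hmn : (m <= n)%N) (F : set 'rV[R]_N)
    (lam : 'I_n -> 'I_N) (K : R) (d kappa : nat) : (0 < N)%N -> definable RR F -> closed F ->
  0 < K -> (forall x y, fiber hmn (coord_proj lam @` F) x y ->
    forall b, - K <= y 0 b /\ y 0 b <= K) ->
  exists M : R, forall x,
    proj_dim (fiber hmn (coord_proj lam @` F) x) = (d%:R : R)%:E ->
    forall r : R, 0 < r -> r <= 1 ->
      (lne (net r (fiber hmn (coord_proj lam @` F) x)) <=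
       ((M + (d * kappa.+1 + 1)%:R * - ln r) / kappa.+1%:R)%:E)%E.
Proof.
move=> N0 dF cF K0 hK.
have [C hC] := fiber_separated_bound d kappa.+1 N0 dF cF K0 hK.
set p := (d * kappa.+1 + 1)%N in hC *.
have A0 : 0 < 2 * K + 1 by lra.
have C0 : 0 < C.+1%:R :> R by rewrite ltr0n.
exists (ln C.+1%:R + p%:R * ln (2 * K + 1)) => x dx r r0 r1.
have k0 : 0 < kappa.+1%:R :> R by rewrite ltr0n.
set L := (X in (_ <= X%:E)%E).
have -> : (L%:E = lne (expR L)%:E)%E by rewrite lne_EFin ?expR_gt0// expRK.
rewrite lee_lne ?in_itv /= ?net_ge0 ?leey ?lee_fin ?expR_ge0//.
apply: ge_ereal_sup => _ [k [y [Sy sep]] <-]; rewrite lee_fin.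
case: k y Sy sep => [|k] y Sy sep; first exact: expR_ge0.
have a0 : 0 <= 2 * K / r by rewrite divr_ge0// ?ltW//; lra.
have /andP[h1 h2] := truncn_itv a0.
set q := (Num.truncn (2 * K / r)).+1 in h2.
have qle : q%:R <= (2 * K + 1) / r.
  have rV : 1 <= r^-1 by rewrite -invr1 lef_pV2 ?posrE.
  have -> : q%:R = (Num.truncn (2 * K / r))%:R + 1 :> R by rewrite natr1.
  by rewrite [leRHS]mulrDl mul1r; exact: lerD.
have q0 : (0 < q)%N by [].
have rq : 2 * K < r * q%:R by rewrite [r * _]mulrC -ltr_pdivrMr.
have := hC x dx r q k.+1 y q0 rq Sy sep.
rewrite -(ler_nat R) natrX natrM natrX => hk.
have k1 : 0 < k.+1%:R :> R by rewrite ltr0n.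
rewrite -(@lnK _ k.+1%:R)// ler_expR /L ler_pdivlMr// mulrC.
have -> : kappa.+1%:R * ln k.+1%:R = ln (k.+1%:R ^+ kappa.+1) :> R.
  by rewrite lnXn// mulr_natl.
have -> : ln C.+1%:R + p%:R * ln (2 * K + 1) + p%:R * - ln r =
    ln (C.+1%:R * ((2 * K + 1) / r) ^+ p).
  rewrite lnM ?posrE ?exprn_gt0 ?divr_gt0// lnXn ?divr_gt0//.
  by rewrite ln_div ?posrE// -[(_ - _) *+ _]mulr_natl; ring.
rewrite ler_ln ?posrE ?mulr_gt0 ?exprn_gt0 ?divr_gt0//.
apply: le_trans hk _; apply: ler_pM => //; first by rewrite ler_nat.
by apply: lerXn2r => //; rewrite nnegrE ?divr_ge0 // ltW.
Qed.

End Final.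

Unset Implicit Arguments.
Set Strict Implicit.
Set Printing Implicit Defensive.

Theorem theoremB (R : realType) (RR : expansion R) (hN : ~ defines_nat RR)
    (m n : nat) (hmn : (m <= n)%N) (E : set 'rV[R]_n)
    (hbd : bounded_set E) (hDS : D_Sigma RR E)
    (d : nat) (hd : (d <= n - m)%N) :
  (upper_Minkowski_dim
     [set fiber hmn E x | x in [set x : 'rV[R]_m |
        proj_dim (fiber hmn E x) = (d%:R : R)%:E]]
   <= (d%:R : R)%:E)%E.
Proof.
case: hDS => N [F [lam [N0 dF cF _ EE]]]; subst E.
have [K [K0 hK]] : exists K : R, 0 < K /\ forall z, (coord_proj lam @` F) z -> `|z| <= K.
  have [K [_ hK]] := hbd.
  exists (Num.max (K + 1) 1); split; first by rewrite lt_max ltr01 orbT.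
  by move=> z Ez; apply: (hK (Num.max (K + 1) 1)) => //; rewrite lt_max ltrDl ltr01.
have hK' x y : fiber hmn (coord_proj lam @` F) x y ->
    forall b, - K <= y 0 b /\ y 0 b <= K.
  move=> /hK h b; apply/andP; rewrite -ler_norml; apply: le_trans h.
  set z := castmx _ _.
  have -> : y 0 b = z 0 (cast_ord (subnKC hmn) (rshift m b)).
    by rewrite castmxE cast_ordK row_mxEr cast_ord_id.
  exact: entry_le_norm.
apply: ge_ereal_sup => alpha [r [S [r0 rl hS cv]]].
apply/lee_addgt0Pr => e e0.
(* Half of [e] absorbs the exponent [1 / kappa.+1], the other half the constant [M], as soon as
   [- ln (r k)] exceeds [M]. *)
pose kappa := Num.truncn (2 / e).
have h0 : 0 <= 2 / e by rewrite divr_ge0// ltW.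
have /andP[_ hkap] := truncn_itv h0.
have k0 : 0 < kappa.+1%:R :> R by rewrite ltr0n.
have [M hM] := fiber_net_bound hN d kappa N0 dF cF K0 hK'.
apply: (cvge_to_le cv); rewrite /=.
pose t0 := Num.max M 1.
have rt : \forall k \near \oo, r k < expR (- t0).
  by apply: (cvgr_lt (0 : R)) => //; exact: expR_gt0.
apply: filterS rt => k rk.
have [x dx <-] := hS k.
have lnr : t0 < - ln (r k) by rewrite ltrNr -ltr_expR lnK// posrE.
have [t0M t01] : M <= t0 /\ 1 <= t0 by rewrite !le_max !lexx orbT.
have t1 : 0 < - ln (r k) by lra.
have r1 : r k <= 1.
  apply: ltW; apply: lt_le_trans rk _; rewrite -expR0 ler_expR; lra.
rewrite inver gt_eqF// lee_pdivrMr//; apply: le_trans (hM x dx _ (r0 k) r1) _.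
rewrite -EFinD -EFinM lee_fin ler_pdivrMr//.
rewrite natrD natrM; set s := - ln (r k) in lnr t1 *.
move: hkap; rewrite ltr_pdivrMr// -/kappa.
move: k0; set kk := kappa.+1%:R => k0 hkap.
have : 2 * s <= kk * e * s by rewrite ler_pM2r//; lra.
have -> : (d%:R + e) * s * kk = d%:R * kk * s + kk * e * s by ring.
have -> : (d%:R * kk + 1%:R) * s = d%:R * kk * s + s by ring.
by lra.
Qed.
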